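(* Let $n\ge1$, let $\Gamma$ be a torsion-free cocompact discrete subgroup of $\mathrm{Aut}(\mathbb B^n)$, and let $\Sigma=\mathbb B^n/\Gamma$ (a compact complex hyperbolic space form). Assume that $H^0(\Sigma,S^mT^*_\Sigma)=0$ for every $0<m\le n+1$. Then $\Omega=(\mathbb B^n\times\mathbb B^n)/\Gamma$ (quotient under the diagonal action) has no nonconstant bounded holomorphic function.
   Context: $\mathbb B^n=\{z\in\mathbb C^n:|z|<1\}$; the diagonal action is $\gamma(z,w)=(\gamma z,\gamma w)$ for $\gamma\in\Gamma$. $S^mT^*_\Sigma$ is the $m$-th symmetric power of the holomorphic cotangent bundle of $\Sigma$. *)

(* Defs.v *)
From HB Require Import structures.
From mathcomp Require Import all_boot all_order all_algebra.
From mathcomp Require Import all_classical all_reals all_analysis.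
From mathcomp Require Import generic_quotient.
From mathcomp.real_closed Require Import complex.

Set Implicit Arguments.
Unset Strict Implicit.
Unset Printing Implicit Defensive.

Import Order.TTheory GRing.Theory Num.Theory.
Import numFieldNormedType.Exports.

Local Open Scope classical_set_scope.
Local Open Scope ring_scope.
Local Open Scope complex_scope.
Local Open Scope quotient_scope.

HB.instance Definition _ (R : realType) := NormedModule.copy R[i] R[i]^o.

Section Holomorphic.
Context {R : realType}.

(* A function f : X -> W, seen through an injection i : X -> V as a function
   on the range of i, and extended by 0 outside that range. *)
Definition extend {X : Type} {V W : normedModType R[i]}
    (i : X -> V) (f : X -> W) : V -> W :=
  fun v => xget 0 [set f x | x in [set x | i x = v]].

Lemma extendE {X : Type} {V W : normedModType R[i]} (i : X -> V) (f : X -> W) :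
  injective i -> forall x, extend i f (i x) = f x.
Proof.
move=> inji x; apply: xget_unique; first by exists x.
by move=> _ [y /= /inji -> <-].
Qed.

(* Used with i identifying X with an open subset of V.  The scalars being R[i],
   differentiability is complex (Frechet) differentiability. *)
Definition holomorphic {X : Type} {V W : normedModType R[i]}
    (i : X -> V) (f : X -> W) : Prop :=
  forall x, differentiable (extend i f) (i x).

End Holomorphic.

Lemma sqnorm_continuous (K : numFieldType) n :
  continuous (fun z : 'rV[K]_n => \sum_(j < n) `|z ord0 j| ^+ 2).
Proof.
have -> : (fun z : 'rV[K]_n => \sum_(j < n) `|z ord0 j| ^+ 2) =
    \sum_(j < n) (fun z : 'rV[K]_n => `|z ord0 j| * `|z ord0 j|).
  apply/funext => z; rewrite fct_sumE; apply: eq_bigr => j _.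
  by rewrite expr2.
elim/big_ind: _ => [|f g cf cg|j _] z.
- exact: cst_continuous.
- by apply: continuousD; [exact: cf|exact: cg].
- have cj : {for z, continuous (fun z : 'rV[K]_n => `|z ord0 j|)}.
    apply: (@continuous_comp _ _ _ (fun z : 'rV[K]_n => z ord0 j) Num.norm).
      exact: coord_continuous.
    exact: norm_continuous.
  exact: (cvgM cj cj).
Qed.

Lemma near_diff (K : numFieldType) (V W : normedModType K) (f g : V -> W) a v :
  differentiable f a -> differentiable g a ->
  (\forall x \near a, f x = g x) -> 'd f a v = 'd g a v.
Proof.
by move=> df dg fg; rewrite -(deriveE v df) -(deriveE v dg) (near_eq_derive _ fg).
Qed.

Section Ball.
Context (R : realType) (n : nat).

Definition unit_ball : set 'rV[R[i]]_n :=
  [set z : 'rV[R[i]]_n | \sum_(j < n) `|z ord0 j| ^+ 2 < 1].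

Definition Ball : Type := set_type unit_ball.
HB.instance Definition _ := Topological.copy Ball (set_type unit_ball).

Definition ball_incl (z : Ball) : 'rV[R[i]]_n := val z.

Lemma ball_incl_inj : injective ball_incl.
Proof. exact: val_inj. Qed.

Lemma ball_inclP (z : Ball) : unit_ball (ball_incl z).
Proof. exact: set_valP. Qed.

Lemma ball_incl_surj v : unit_ball v -> exists z, ball_incl z = v.
Proof. by move=> vB; exists (SigSub (mem_set vB)). Qed.

Lemma open_unit_ball : open unit_ball.
Proof.
have -> : unit_ball =
    (fun z : 'rV[R[i]]_n => \sum_(j < n) `|z ord0 j| ^+ 2) @^-1`
      (ball (0 : R[i]) 1).
  apply/seteqP; split => z; rewrite /unit_ball /= -ball_normE /= sub0r normrN;
    by rewrite ger0_norm // sumr_ge0 // => j _; rewrite exprn_ge0.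
apply: open_comp; last exact: ball_open.
by move=> z _; exact: sqnorm_continuous.
Qed.

Definition Aut_ball : set (Ball -> Ball) :=
  [set g : Ball -> Ball | holomorphic ball_incl (ball_incl \o g) /\
     exists h, [/\ holomorphic ball_incl (ball_incl \o h),
                   cancel g h & cancel h g]].

Definition ball_diff (g : Ball -> Ball) (z : Ball) :
    'rV[R[i]]_n -> 'rV[R[i]]_n :=
  'd (extend ball_incl (ball_incl \o g)) (ball_incl z).

Record Aut_subgroup := AutSubgroup {
  aut_car : set (Ball -> Ball);
  aut_sub : aut_car `<=` Aut_ball;
  aut_id : aut_car id;
  aut_comp : forall g h, aut_car g -> aut_car h -> aut_car (g \o h);
  aut_inv : forall g, aut_car g ->
    exists h, [/\ aut_car h, cancel g h & cancel h g] }.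

Lemma near_extend {W : normedModType R[i]} (f : Ball -> W)
    (F : 'rV[R[i]]_n -> W) (z : Ball) :
  (forall x, f x = F (ball_incl x)) ->
  \forall v \near ball_incl z, F v = extend ball_incl f v.
Proof.
move=> fF; have : nbhs (ball_incl z) unit_ball.
  by apply: open_nbhs_nbhs; split; [exact: open_unit_ball|exact: ball_inclP].
apply: filterS => v /ball_incl_surj[x <-].
by rewrite extendE //; exact: ball_incl_inj.
Qed.

Lemma ball_diff_near (g : Ball -> Ball) (F : 'rV[R[i]]_n -> 'rV[R[i]]_n)
    (z : Ball) v :
  Aut_ball g -> differentiable F (ball_incl z) ->
  (forall x, ball_incl (g x) = F (ball_incl x)) ->
  ball_diff g z v = 'd F (ball_incl z) v.
Proof.
move=> [hg _] dF gF; apply/esym/near_diff; [exact: dF|exact: hg|].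
exact: near_extend.
Qed.

Lemma ball_diff_id z v : Aut_ball id -> ball_diff id z v = v.
Proof.
have [d1 d2] := is_diff_id (ball_incl z).
by move=> h; rewrite (ball_diff_near v h d1) // d2.
Qed.

Lemma ball_diff_comp g h z v :
  Aut_ball g -> Aut_ball h -> Aut_ball (g \o h) ->
  ball_diff (g \o h) z v = ball_diff g (h z) (ball_diff h z v).
Proof.
move=> Ag Ah Agh.
have dh : differentiable (extend ball_incl (ball_incl \o h)) (ball_incl z).
  by case: Ah => + _; apply.
have Eh x : extend ball_incl (ball_incl \o h) (ball_incl x) = ball_incl (h x).
  by rewrite extendE //; exact: ball_incl_inj.
have dg : differentiable (extend ball_incl (ball_incl \o g))
    (extend ball_incl (ball_incl \o h) (ball_incl z)).
  by rewrite Eh; case: Ag => + _; apply.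
have dgh := differentiable_comp dh dg.
rewrite (ball_diff_near v Agh dgh); last first.
  by move=> x; rewrite /= Eh extendE //; exact: ball_incl_inj.
have /(congr1 (@^~ v)) -> := diff_comp dh dg.
rewrite /ball_diff /comp.
by have -> := Eh z.
Qed.

Definition torsion_free (G : Aut_subgroup) : Prop :=
  forall g k, aut_car G g -> (0 < k)%N -> iter k g =1 id -> g = id.

(* Every point of G is isolated in G for the compact-open topology, i.e., the
   topology induced on G is discrete. *)
Definition discrete_subgroup (G : Aut_subgroup) : Prop :=
  isolated (aut_car G : set {compact-open, Ball -> Ball}) = aut_car G.

End Ball.

Section Quotients.
Context (R : realType) (n : nat) (G : Aut_subgroup R n).

Definition orbit_rel : rel (Ball R n) :=
  fun z z' => `[< exists2 g, aut_car G g & z' = g z >].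

Definition diag_rel : rel (Ball R n * Ball R n) :=
  fun p p' => `[< exists2 g, aut_car G g & p' = (g p.1, g p.2) >].

Definition tangent_rel : rel (Ball R n * 'rV[R[i]]_n) :=
  fun t t' => `[< exists2 g, aut_car G g & t' = (g t.1, ball_diff g t.1 t.2) >].

Lemma orbit_rel_equiv : equiv_class_of orbit_rel.
Proof.
split.
- by move=> z; apply/asboolP; exists id => //; exact: aut_id.
- suff H z z' : orbit_rel z z' -> orbit_rel z' z by move=> z z'; apply/idP/idP; apply: H.
  move=> /asboolP[g Gg ->]; have [h [Gh gh _]] := aut_inv Gg.
  by apply/asboolP; exists h => //; rewrite gh.
- move=> y x z /asboolP[g Gg ->] /asboolP[h Gh ->].
  by apply/asboolP; exists (h \o g) => //; exact: aut_comp.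
Qed.

Lemma diag_rel_equiv : equiv_class_of diag_rel.
Proof.
split.
- by move=> [z w]; apply/asboolP; exists id => //; exact: aut_id.
- suff H z z' : diag_rel z z' -> diag_rel z' z by move=> z z'; apply/idP/idP; apply: H.
  move=> /asboolP[g Gg ->]; have [h [Gh gh _]] := aut_inv Gg.
  by apply/asboolP; exists h => //=; rewrite !gh -surjective_pairing.
- move=> y x z /asboolP[g Gg ->] /asboolP[h Gh ->].
  by apply/asboolP; exists (h \o g) => //; exact: aut_comp.
Qed.

Lemma tangent_rel_equiv : equiv_class_of tangent_rel.
Proof.
split.
- move=> [z v]; apply/asboolP; exists id; first exact: aut_id.
  by rewrite /= ball_diff_id //; apply: aut_sub (aut_id G).
- suff H z z' : tangent_rel z z' -> tangent_rel z' z.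
    by move=> z z'; apply/idP/idP; apply: H.
  move=> /asboolP[g Gg ->]; have [h [Gh gh _]] := aut_inv Gg.
  apply/asboolP; exists h => //=; rewrite -ball_diff_comp ?gh;
    try by apply: (@aut_sub _ _ G) => //; apply: aut_comp.
  have -> : h \o g = id by apply/funext.
  by rewrite ball_diff_id -?surjective_pairing //; apply: aut_sub (aut_id G).
- move=> y x z /asboolP[g Gg ->] /asboolP[h Gh ->].
  apply/asboolP; exists (h \o g); first exact: aut_comp.
  by rewrite /= ball_diff_comp //; apply: (@aut_sub _ _ G) => //; apply: aut_comp.
Qed.

Canonical orbit_equiv := EquivRelPack orbit_rel_equiv.
Canonical diag_equiv := EquivRelPack diag_rel_equiv.
Canonical tangent_equiv := EquivRelPack tangent_rel_equiv.


Definition Sigma : Type := quotient_topology {eq_quot orbit_equiv}.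
HB.instance Definition _ := Topological.copy Sigma (quotient_topology {eq_quot orbit_equiv}).

Definition Omega : Type := {eq_quot diag_equiv}.

(* The holomorphic tangent bundle of Sigma, as the quotient of
   TB^n = B^n x C^n by g.(z, v) = (g z, dg_z v). *)
Definition TSigma : Type := {eq_quot tangent_equiv}.

Definition cocompact : Prop := compact [set: Sigma].

Definition Omega_pi (p : Ball R n * Ball R n) : Omega := \pi_{eq_quot diag_equiv} p.

Definition TSigma_pi (z : Ball R n) (v : 'rV[R[i]]_n) : TSigma :=
  \pi_{eq_quot tangent_equiv} (z, v).

(* H^0(Sigma, S^m T^*Sigma).  A section of S^m T^*Sigma is a function on
   TSigma that is a homogeneous polynomial of degree m on each fibre.  As
   the projection B^n -> Sigma is a local biholomorphism, the section is
   holomorphic iff its pullback to B^n is sum_{|a| = m} c_a(z) dz^a with c_a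
   holomorphic on B^n. *)
Definition sym_differentials (m : nat) : set (TSigma -> R[i]) :=
  [set s | exists c : {ffun 'I_n -> 'I_m.+1} -> Ball R n -> R[i],
     (forall a, holomorphic (@ball_incl R n) (c a)) /\
     forall z v, s (TSigma_pi z v) =
       \sum_(a : {ffun 'I_n -> 'I_m.+1} | (\sum_(j < n) a j == m)%N)
          c a z * \prod_(j < n) v ord0 j ^+ a j].

Definition ball2_incl (p : Ball R n * Ball R n) :
    ('rV[R[i]]_n * 'rV[R[i]]_n)%type :=
  (ball_incl p.1, ball_incl p.2).

(* The projection B^n x B^n -> Omega is a local biholomorphism, so that
   holomorphy on Omega is holomorphy of the pullback. *)
Definition Omega_holomorphic (F : Omega -> R[i]) : Prop :=
  holomorphic ball2_incl (F \o Omega_pi).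

Definition Omega_bounded (F : Omega -> R[i]) : Prop :=
  exists M : R, forall x, `|F x| <= M%:C.

End Quotients.

Arguments sym_differentials {R n} G m.

(* Main.v *)
(* On the ball put the pseudometric d(x, y) = sup |Re g(x) - Re g(y)|, over all
   holomorphic g with |g| <= 1; every automorphism is an isometry for d, and
   Moebius maps make the isometry group transitive.  Weil's covering argument
   yields an invariant positive functional L on Lipschitz functions with totally
   bounded support, and hence an averaging operator over small d-balls that
   commutes with isometries.  Rotations and the mean value theorem on circles
   show that this operator fixes Re g for every bounded holomorphic g.

   Let u(z, w) be the real part of (a rescaling of) the pulled-back function on
   B x B.  It is fixed by the averages A1 in z and A2 in w, and invariant under
   the diagonal action.  By Jensen, q = A1(u^2) - u^2 >= 0.  Let tau(v) be the
   integral over a fundamental domain of the values v(z, z) of an invariant v.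
   Mass transport gives tau(A1 v) = tau(A2 v), so the sum over m of
   tau(A2^m q) = tau(A2^(m+1) u^2) - tau(A2^m u^2) telescopes and stays bounded;
   as tau(A2^m q) is nondecreasing in m, again by Jensen, it vanishes.  Then
   q(z, w) = 0 whenever z and w are joined by m small steps, so q = 0 and u does
   not depend on z.  By symmetry u is constant. *)
Require Import Defs.
From HB Require Import structures.
From mathcomp Require Import all_boot all_order all_algebra generic_quotient.
From mathcomp Require Import all_classical all_reals all_analysis.
From mathcomp Require Import ring lra.
From mathcomp.real_closed Require Import complex.
Set Implicit Arguments.
Unset Strict Implicit.
Unset Printing Implicit Defensive.

Import Order.TTheory GRing.Theory Num.Theory.
Import numFieldNormedType.Exports.

Local Open Scope classical_set_scope.
Local Open Scope ring_scope.

(** * Lipschitz functions on a pseudometric space *)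

Section UltraLimit.
Context (R : realType).

(** Omega is not compact, so u^2 cannot be integrated over it to argue by orthogonality; only the
    diagonal has a compact quotient. This is why tau looks at diagonal values alone, while iterating
    A2 brings ever farther pairs (z, w) into view. Telescoping rests on A1 and A2 commuting, so that
    A2^m q = A1 v - v with v = A2^m u^2. The function q is subharmonic in w because it is the
    A1-average of the squares of the differences u(x, w) - u(z, w), each of them harmonic in w.

    Neither a measure nor the Bergman metric is constructed. The functional L is merely finitely
    additive, and no limit is ever taken under it. Hence Fubini's theorem is proved with finite
    partitions of unity, the mean over a circle is replaced by Riemann sums over finitely many
    rotations, and compactness takes the form of total boundedness. The distance d makes real parts
    of bounded holomorphic functions Lipschitz by definition; the work lies in comparing it with
    Euclidean distance, by a Cauchy estimate. *)

Definition bounded_seq (a : nat -> R) := exists K : R, forall n, `|a n| <= K.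

(** Normalised covering numbers need not converge as the radius shrinks. Along an ultrafilter finer
    than [\oo] every bounded sequence converges, by compactness of segments, and the limit remains
    linear and monotone; inequalities are needed only from some index on. *)
Lemma ultralimit_exists : exists L : (nat -> R) -> R,
  [/\ forall a b, bounded_seq a -> bounded_seq b ->
        L (fun n => a n + b n) = L a + L b,
      forall c a, bounded_seq a -> L (fun n => c * a n) = c * L a,
      forall a b, bounded_seq a -> bounded_seq b ->
        (exists N, forall n, (N <= n)%N -> a n <= b n) -> L a <= L b &
      L (fun=> 1) = 1].
Proof.
have [U [UU ooU]] := @ultraFilterLemma nat \oo _.
have cv a : bounded_seq a -> cvg (a @ U).
  move=> [K aK].
  have aF : ProperFilter (a @ U) by exact: fmap_proper_filter.
  have aI : (a @ U) [set` `[- K, K]].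
    change (U [set n | a n \in `[- K, K]]).
    apply: filterE => n /=. rewrite in_itv /= -ler_norml. exact: aK.
  have [p [_ clp]] := @segment_compact R (- K) K (a @ U) aF aI.
  apply/cvg_ex; exists p => V Vp.
  (* An ultrafilter contains the preimage of V or its complement, and the latter contradicts that p
     is a cluster point; so p is a limit. *)
  have [//|UV] := @in_ultra_setVsetC _ U (a @^-1` V) UU.
  by have [x [nVx Vx]] := clp (~` V) V UV Vp; case: (nVx Vx).
exists (fun a => lim (a @ U)); split.
- by move=> a b /cv ca /cv cb; apply: cvg_lim => //; exact: (cvgD ca cb).
- by move=> c a /cv ca; apply: cvg_lim => //; exact: (cvgM (cvg_cst c) ca).
- move=> a b /cv ca /cv cb [N Nab]; apply: ler_lim => //.
  by apply: ooU; exists N => // n; exact: Nab.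
- by apply: cvg_lim => //; exact: cvg_cst.
Qed.

End UltraLimit.

(** * Bounded Lipschitz functions, totally bounded supports and tent functions *)

Section MetricFunctions.
Context (R : realType) (T : choiceType) (d : T -> T -> R).

Definition pseudometric := [/\ forall x, d x x = 0, forall x y, d x y = d y x &
  forall x y z, d x z <= d x y + d y z].

(** The centres need not lie in A, so the property passes to subsets at once; [totbounded_in] moves
    them into A where that matters. *)
Definition totbounded (A : set T) := forall e, 0 < e ->
  exists s : seq T, forall x, A x -> exists2 y, y \in s & d y x < e.

Definition isometry (g : T -> T) :=
  (exists h, cancel g h /\ cancel h g) /\ forall x y, d (g x) (g y) = d x y.

Definition lipb (u : T -> R) := exists C : R,
  (forall x, `|u x| <= C) /\ (forall x y, `|u x - u y| <= C * d x y).

(* The Lipschitz counterpart of continuous functions with compact support. *)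
Definition lipc (u : T -> R) :=
  lipb u /\ exists2 A, totbounded A & forall x, ~ A x -> u x = 0.

(** The tent of height and radius e. It depends on the distance only, so isometries permute tents.
    Tents are the units of the covering numbers, the pieces of the partitions of unity and the
    averaging kernel. *)
Definition bump e x y := Num.max 0 (e - d x y).

Context (dP : pseudometric).

Lemma pm_ge0 x y : 0 <= d x y.
Proof. by case: dP => d0 dC dT; have := dT x y x; rewrite d0 (dC y x); lra. Qed.

Lemma lipbI (u : T -> R) : (exists C : R, forall x, `|u x| <= C) ->
  (exists C : R, forall x y, `|u x - u y| <= C * d x y) -> lipb u.
Proof.
move=> [C1 h1] [C2 h2]; exists (Num.max C1 C2); split=> [x|x y].
  by rewrite le_max h1.
apply: le_trans (h2 x y) _; apply: (ler_wpM2r (pm_ge0 x y)).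
by rewrite le_max lexx orbT.
Qed.

Lemma totboundedS A B : A `<=` B -> totbounded B -> totbounded A.
Proof. by move=> AB tB e /tB[s sB]; exists s => x /AB/sB. Qed.

Lemma totboundedU A B : totbounded A -> totbounded B -> totbounded (A `|` B).
Proof.
move=> tA tB e e0; have [s hs] := tA e e0; have [t ht] := tB e e0.
exists (s ++ t) => x [/hs|/ht] [y ys yx]; exists y => //;
  by rewrite mem_cat ys ?orbT.
Qed.

Lemma lipbD u v : lipb u -> lipb v -> lipb (fun x => u x + v x).
Proof.
move=> [C [b l]] [C' [b' l']]; exists (C + C'); split=> [x|x y].
  by apply: le_trans (ler_normD _ _) _; exact: lerD.
rewrite opprD addrACA mulrDl; apply: le_trans (ler_normD _ _) _; exact: lerD.
Qed.

Lemma lipb_cst (c : R) : lipb (fun=> c).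
Proof.
exists `|c|; split=> [//|x y]; rewrite subrr normr0 mulr_ge0 //.
exact: pm_ge0.
Qed.

Lemma lipbM u v : lipb u -> lipb v -> lipb (fun x => u x * v x).
Proof.
move=> [C [b l]] [C' [b' l']]; apply: lipbI.
  by exists (C * C') => x; rewrite normrM ler_pM.
exists (C * C' + C * C') => x y.
have -> : u x * v x - u y * v y = u x * (v x - v y) + v y * (u x - u y) by ring.
apply: le_trans (ler_normD _ _) _; rewrite !normrM mulrDl; apply: lerD.
  by rewrite -mulrA ler_pM.
by rewrite [C * C']mulrC -mulrA ler_pM.
Qed.

Lemma lipbZ c u : lipb u -> lipb (fun x => c * u x).
Proof. by move=> hu; apply: lipbM => //; exact: lipb_cst. Qed.

Lemma lipbN u : lipb u -> lipb (fun x => - u x).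
Proof.
by move=> /(lipbZ (- 1)); congr lipb; apply/funext => x; rewrite mulN1r.
Qed.

Lemma lipbB u v : lipb u -> lipb v -> lipb (fun x => u x - v x).
Proof. by move=> hu /lipbN; exact: lipbD. Qed.

Lemma lipb_iso g u : isometry g -> lipb u -> lipb (fun x => u (g x)).
Proof.
by move=> [_ ig] [C [b l]]; exists C; split=> // x y; rewrite -(ig x y).
Qed.

Lemma lip_max0 (a b : R) : `|Num.max 0 a - Num.max 0 b| <= `|a - b|.
Proof.
have ha := ler_norm (a - b); have hb := ler_norm (b - a).
rewrite distrC in hb.
have [a0|a0] := leP 0 a; have [b0|b0] := leP 0 b;
  rewrite ler_norml; apply/andP; split; lra.
Qed.

Lemma lipb_pos u : lipb u -> lipb (fun x => Num.max 0 (u x)).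
Proof.
move=> [C [b l]]; exists C; split=> [x|x y].
  apply: le_trans (b x); have := lip_max0 (u x) 0.
  by rewrite maxxx !subr0.
exact: le_trans (lip_max0 _ _) _.
Qed.

Lemma lipb_inv (c : R) u : 0 < c -> (forall x, c <= u x) -> lipb u ->
  lipb (fun x => (u x)^-1).
Proof.
move=> c0 cu [C [b l]].
have u0 x : 0 < u x by exact: lt_le_trans (cu x).
apply: lipbI.
  exists c^-1 => x; rewrite ger0_norm ?invr_ge0 ?(ltW (u0 _)) //.
  by rewrite lef_pV2 ?posrE.
exists (c^-1 * c^-1 * C) => x y.
have -> : (u x)^-1 - (u y)^-1 = (u x)^-1 * (u y)^-1 * (u y - u x).
  by have := u0 x; have := u0 y => *; field; rewrite !gt_eqF.
rewrite !normrM -[_ * C * _]mulrA; apply: ler_pM => //; last by rewrite distrC.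
apply: ler_pM => //; rewrite ger0_norm ?invr_ge0 ?(ltW (u0 _)) //;
  by rewrite lef_pV2 ?posrE.
Qed.

Lemma bump_ge0 e x y : 0 <= bump e x y.
Proof. by rewrite le_max lexx. Qed.

Lemma bump_le e x y : 0 <= e -> bump e x y <= e.
Proof. by move=> e0; rewrite ge_max e0; have := pm_ge0 x y; lra. Qed.

Lemma bumpC e x y : bump e x y = bump e y x.
Proof. by case: dP => _ dC _; rewrite /bump dC. Qed.

Lemma bump_iso e g x y : isometry g -> bump e (g x) (g y) = bump e x y.
Proof. by move=> [_ ig]; rewrite /bump ig. Qed.

Lemma bump_far e x y : e <= d x y -> bump e x y = 0.
Proof. by move=> h; apply/max_idPl; rewrite subr_le0. Qed.

Lemma bump_near e x y : e - d x y <= bump e x y.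
Proof. by rewrite le_max lexx orbT. Qed.

Lemma bump_gt0 e x y : d x y < e -> 0 < bump e x y.
Proof. by move=> h; rewrite lt_max subr_gt0 h orbT. Qed.

Lemma bump_lip e x y z : `|bump e x y - bump e x z| <= d y z.
Proof.
apply: le_trans (lip_max0 _ _) _; case: dP => d0 dC dT.
have := dT x y z; have := dT x z y; rewrite (dC z y) ler_norml => *.
by apply/andP; split; lra.
Qed.

Lemma lipb_bump e x : lipb (bump e x).
Proof.
apply: lipbI; last by exists 1 => y z; rewrite mul1r; exact: bump_lip.
exists (Num.max 0 e) => y; rewrite ger0_norm ?bump_ge0 //.
rewrite ge_max le_max lexx le_max /=; apply/orP; right.
by have := pm_ge0 x y; lra.
Qed.

Lemma lipcD u v : lipc u -> lipc v -> lipc (fun x => u x + v x).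
Proof.
move=> [hu [A tA A0]] [hv [B tB B0]]; split; first exact: lipbD.
exists (A `|` B); first exact: totboundedU.
by move=> x /not_orP[/A0 -> /B0 ->]; rewrite addr0.
Qed.

Lemma lipcMl u v : lipb u -> lipc v -> lipc (fun x => u x * v x).
Proof.
move=> hu [hv [A tA A0]]; split; first exact: lipbM.
by exists A => // x /A0 ->; rewrite mulr0.
Qed.

Lemma lipcMr u v : lipc u -> lipb v -> lipc (fun x => u x * v x).
Proof.
move=> [hu [A tA A0]] hv; split; first exact: lipbM.
by exists A => // x /A0 ->; rewrite mul0r.
Qed.

Lemma lipcZ c u : lipc u -> lipc (fun x => c * u x).
Proof. by apply: lipcMl; exact: lipb_cst. Qed.

Lemma lipcN u : lipc u -> lipc (fun x => - u x).
Proof.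
by move=> /(lipcZ (- 1)); congr lipc; apply/funext => x; rewrite mulN1r.
Qed.

Lemma lipcB u v : lipc u -> lipc v -> lipc (fun x => u x - v x).
Proof. by move=> hu /lipcN; exact: lipcD. Qed.

Lemma lipc0 : lipc (fun=> 0).
Proof.
split; first exact: lipb_cst.
by exists set0 => // e _; exists [::].
Qed.

Lemma lipc_sum (I : Type) (s : seq I) (F : I -> T -> R) :
  (forall i, lipc (F i)) -> lipc (fun x => \sum_(i <- s) F i x).
Proof.
move=> hF; elim: s => [|i s IH].
  by move: lipc0; congr lipc; apply/funext => x; rewrite big_nil.
by move: (lipcD (hF i) IH); congr lipc; apply/funext => x; rewrite big_cons.
Qed.

Lemma lipb_sum (I : Type) (s : seq I) (F : I -> T -> R) :
  (forall i, lipb (F i)) -> lipb (fun x => \sum_(i <- s) F i x).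
Proof.
move=> hF; elim: s => [|i s IH].
  by move: (lipb_cst 0); congr lipb; apply/funext => x; rewrite big_nil.
by move: (lipbD (hF i) IH); congr lipb; apply/funext => x; rewrite big_cons.
Qed.

Lemma isometry_inv g h : isometry g -> cancel g h -> cancel h g -> isometry h.
Proof.
move=> [_ ig] gh hg; split; first by exists g.
by move=> x y; rewrite -ig !hg.
Qed.

Lemma totbounded_iso g A : isometry g -> totbounded A ->
  totbounded [set x | A (g x)].
Proof.
move=> ig tA e /tA[s hs]; have [[h [gh hg]] _] := ig.
exists (map h s) => x /hs[y ys yx]; exists (h y); first exact: map_f.
by case: ig => _ ig; rewrite -ig hg.
Qed.

Lemma lipc_iso g u : isometry g -> lipc u -> lipc (fun x => u (g x)).
Proof.
move=> ig [hu [A tA A0]]; split; first exact: lipb_iso.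
by exists [set x | A (g x)]; [exact: totbounded_iso|move=> x /A0].
Qed.

Lemma lipc_pos u : lipc u -> lipc (fun x => Num.max 0 (u x)).
Proof.
move=> [hu [A tA A0]]; split; first exact: lipb_pos.
by exists A => // x /A0 ->; rewrite maxxx.
Qed.

Lemma lipc_bump e x : totbounded [set y | d x y < e] -> lipc (bump e x).
Proof.
move=> te; split; first exact: lipb_bump.
by exists [set y | d x y < e] => // y /negP; rewrite -leNgt => /bump_far.
Qed.

(** At distance less than e / 2 from its centre a tent of radius e is at least e / 2, so an e /
    2-net supplies the centres. *)
Lemma totbounded_dominate A e : 0 < e -> totbounded A -> exists s : seq T,
  forall x, A x -> 1 <= \sum_(y <- s) (e / 2)^-1 * bump e y x.
Proof.
move=> e0 tA; have e20 : 0 < e / 2 by lra.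
have [s hs] := tA (e / 2) e20; exists s => x /hs[y ys yx].
rewrite (big_rem y) //=; apply: (@le_trans _ _ ((e / 2)^-1 * bump e y x)).
  rewrite ler_pdivlMl // mulr1; apply: le_trans (bump_near _ _ _); lra.
rewrite lerDl sumr_ge0 // => i _; rewrite mulr_ge0 ?bump_ge0 // invr_ge0; lra.
Qed.

End MetricFunctions.

(** * Weil's construction of an invariant functional *)

Section Haar.
Context (R : realType) (T : choiceType) (d : T -> T -> R).
Context (dP : pseudometric d) (r0 : R) (r0_gt0 : 0 < r0).
Context (ball_tb : forall x, totbounded d [set y | d x y < r0]).
Context (homog : forall x y, exists g, isometry d g /\ g x = y).

Local Notation bump := (bump d).
Local Notation lipc := (lipc d).

(** Weil's covers by translates of a small function: a pair consists of a weight and a centre, and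
    the centres play the part of the group elements. The infimum [cov] of the total weights is his
    covering number. *)
Definition covers (e : R) (u : T -> R) (s : seq (R * T)) :=
  (forall c, c \in s -> 0 <= c.1) /\
  forall y, u y <= \sum_(c <- s) c.1 * bump e c.2 y.

Definition weight (s : seq (R * T)) := \sum_(c <- s) c.1.

Definition cov e u := inf [set weight s | s in covers e u].

Lemma bump_lipc e x : e <= r0 -> lipc (bump e x).
Proof.
move=> er0; apply: lipc_bump => //; apply: totboundedS (ball_tb x) => y /=.
by move=> h; exact: lt_le_trans er0.
Qed.

Lemma half_inv_ge0 : 0 <= (r0 / 2)^-1.
Proof. by rewrite invr_ge0 divr_ge0 // ltW. Qed.

Lemma lipc_dominated u : lipc u -> exists K : R, 0 <= K /\
  forall e : R, 0 < e -> exists s : seq T,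
    forall x, u x <= \sum_(y <- s) (K * (e / 2)^-1) * bump e y x.
Proof.
move=> [[C [uC _]] [A tA A0]]; exists `|C|; split=> // e e0.
have [s hs] := totbounded_dominate e0 tA; exists s => x.
have [/hs Ax|/A0 ->] := pselect (A x).
  have -> : \sum_(y <- s) `|C| * (e / 2)^-1 * bump e y x =
            `|C| * \sum_(y <- s) (e / 2)^-1 * bump e y x.
    by rewrite mulr_sumr; apply: eq_bigr => y _; rewrite mulrA.
  apply: (@le_trans _ _ (`|C| * 1)); last by rewrite ler_wpM2l.
  by rewrite mulr1; apply: le_trans (ler_norm C); apply: le_trans (uC x);
     exact: ler_norm.
apply: sumr_ge0 => y _; rewrite !mulr_ge0 ?bump_ge0 // invr_ge0; lra.
Qed.

Lemma weight_ge0 e u s : covers e u s -> 0 <= weight s.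
Proof.
by move=> [s0 _]; rewrite /weight big_seq sumr_ge0 // => c /s0.
Qed.

Lemma covers_ex e u : 0 < e -> lipc u -> exists s, covers e u s.
Proof.
move=> e0 /lipc_dominated[K [K0 /(_ e e0)[s hs]]].
exists [seq (K * (e / 2)^-1, y) | y <- s]; split.
  by move=> c /mapP[y _ ->] /=; rewrite mulr_ge0 // invr_ge0; lra.
by move=> y; rewrite big_map; exact: hs.
Qed.

Lemma cov_has_inf e u : 0 < e -> lipc u ->
  has_inf [set weight s | s in covers e u].
Proof.
move=> e0 /(covers_ex e0)[s hs]; split; first by exists (weight s), s.
by exists 0 => _ [t ht <-]; exact: weight_ge0 ht.
Qed.

Lemma cov_le e u s : covers e u s -> cov e u <= weight s.
Proof.
move=> hs; apply: ge_inf; last by exists s.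
by exists 0 => _ [t ht <-]; exact: weight_ge0 ht.
Qed.

Lemma cov_lb e u b : 0 < e -> lipc u ->
  (forall s, covers e u s -> b <= weight s) -> b <= cov e u.
Proof.
move=> e0 hu h; apply: lb_le_inf; first by case: (cov_has_inf e0 hu).
by move=> _ [s hs <-]; exact: h.
Qed.

Lemma cov_adherent e u eps : 0 < e -> lipc u -> 0 < eps ->
  exists s, covers e u s /\ weight s < cov e u + eps.
Proof.
move=> e0 hu eps0.
have [_ [s hs <-] h] := inf_adherent eps0 (cov_has_inf e0 hu).
by exists s.
Qed.

Lemma cov_ge0 e u : 0 < e -> lipc u -> 0 <= cov e u.
Proof. by move=> e0 hu; apply: cov_lb => // s; exact: weight_ge0. Qed.

Lemma covers_cat e u v s t : covers e u s -> covers e v t ->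
  covers e (fun x => u x + v x) (s ++ t).
Proof.
move=> [s0 hs] [t0 ht]; split.
  by move=> c; rewrite mem_cat => /orP[/s0|/t0].
by move=> y; rewrite big_cat lerD.
Qed.

Lemma weight_cat s t : weight (s ++ t) = weight s + weight t.
Proof. by rewrite /weight big_cat. Qed.

Lemma covers_scale e u c s : 0 <= c -> covers e u s ->
  covers e (fun x => c * u x) [seq (c * p.1, p.2) | p <- s].
Proof.
move=> c0 [s0 hs]; split.
  by move=> _ /mapP[p ps ->] /=; rewrite mulr_ge0 // s0.
move=> y; rewrite big_map /=.
have -> : \sum_(j <- s) c * j.1 * bump e j.2 y =
          c * \sum_(j <- s) j.1 * bump e j.2 y.
  by rewrite mulr_sumr; apply: eq_bigr => i _; rewrite mulrA.
exact: ler_wpM2l.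
Qed.

Lemma weight_scale c s : weight [seq (c * p.1, p.2) | p <- s] = c * weight s.
Proof. by rewrite /weight big_map mulr_sumr. Qed.

Lemma covers_le e u v s : (forall x, u x <= v x) -> covers e v s -> covers e u s.
Proof. by move=> uv [s0 hs]; split=> // y; exact: le_trans (uv y) (hs y). Qed.

Lemma cov_mono e u v : 0 < e -> lipc v -> (forall x, u x <= v x) ->
  cov e u <= cov e v.
Proof.
by move=> e0 hv uv; apply: cov_lb => // s /(covers_le uv); exact: cov_le.
Qed.

Lemma covD e u v : 0 < e -> lipc u -> lipc v ->
  cov e (fun x => u x + v x) <= cov e u + cov e v.
Proof.
move=> e0 hu hv; apply/ler_addgt0Pr => eps eps0.
have eps2 : 0 < eps / 2 by lra.
have [s [hs ws]] := cov_adherent e0 hu eps2.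
have [t [ht wt]] := cov_adherent e0 hv eps2.
have := cov_le (covers_cat hs ht); rewrite weight_cat; lra.
Qed.

Lemma covZ_le e u c : 0 < e -> 0 < c -> lipc u ->
  cov e (fun x => c * u x) <= c * cov e u.
Proof.
move=> e0 c0 hu; rewrite -ler_pdivrMl //; apply: cov_lb => // s hs.
rewrite ler_pdivrMl // -weight_scale; apply: cov_le.
by apply: covers_scale => //; exact: ltW.
Qed.

Lemma covZ e u c : 0 < e -> 0 < c -> lipc u ->
  cov e (fun x => c * u x) = c * cov e u.
Proof.
move=> e0 c0 hu; apply/eqP; rewrite eq_le covZ_le //=.
rewrite -ler_pdivlMl //; have ci0 : 0 < c^-1 by rewrite invr_gt0.
have := covZ_le e0 ci0 (lipcZ dP c hu).
have -> // : (fun x => c^-1 * (c * u x)) = u.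
by apply/funext => x; rewrite mulKf // gt_eqF.
Qed.

Lemma cov_iso_le e u g : 0 < e -> lipc u -> isometry d g ->
  cov e (fun x => u (g x)) <= cov e u.
Proof.
move=> e0 hu ig; apply: cov_lb => // s [s0 hs].
have [[h [gh hg]] _] := ig.
have -> : weight s = weight [seq (p.1, h p.2) | p <- s].
  by rewrite /weight big_map.
apply: cov_le; split; first by move=> _ /mapP[p /s0 p0 ->].
move=> y; rewrite big_map /=; apply: le_trans (hs (g y)) _.
apply: ler_sum => c _.
by rewrite -(bump_iso e (h c.2) y ig) hg.
Qed.

Lemma cov_iso e u g : 0 < e -> lipc u -> isometry d g ->
  cov e (fun x => u (g x)) = cov e u.
Proof.
move=> e0 hu ig; apply/eqP; rewrite eq_le cov_iso_le //=.
have [[h [gh hg]] _] := ig; have ih := isometry_inv ig gh hg.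
have := cov_iso_le e0 (lipc_iso ig hu) ih.
have -> // : (fun x => u (g (h x))) = u by apply/funext => x; rewrite hg.
Qed.

Lemma cov_bump e r x y : 0 < e -> r <= r0 -> cov e (bump r x) = cov e (bump r y).
Proof.
move=> e0 rr; have [g [ig gx]] := homog x y.
rewrite -(cov_iso e0 (bump_lipc y rr) ig); congr cov; apply/funext => z.
by rewrite -(bump_iso r x z ig) gx.
Qed.

Lemma cov_sum e (s : seq T) (F : T -> T -> R) : 0 < e ->
  (forall y, lipc (F y)) ->
  cov e (fun x => \sum_(y <- s) F y x) <= \sum_(y <- s) cov e (F y).
Proof.
move=> e0 hF; elim: s => [|y s IH].
  rewrite big_nil; apply: (@le_trans _ _ (weight [::])); last first.
    by rewrite /weight big_nil.
  by apply: (@cov_le _ _ [::]); split=> [c|z]; rewrite ?in_nil // !big_nil.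
rewrite big_cons.
have -> : (fun x => \sum_(j <- y :: s) F j x) =
    (fun x => F y x + \sum_(j <- s) F j x).
  by apply/funext => x; rewrite big_cons.
apply: le_trans (covD e0 (hF y) (lipc_sum dP s hF)) _.
exact: lerD.
Qed.

(** The reference tent has value r0 at its centre, where each covering tent contributes at most e
    times its weight; so every cover weighs at least r0 / e. *)
Lemma cov_ref_gt0 e x : 0 < e -> 0 < cov e (bump r0 x).
Proof.
move=> e0; apply: (@lt_le_trans _ _ (r0 / e)); first exact: divr_gt0.
apply: cov_lb => //; first exact: bump_lipc.
move=> s [s0 hs]; rewrite ler_pdivrMr //.
case: (dP) => d0 _ _.
apply: (@le_trans _ _ (bump r0 x x)); first by have := bump_near d r0 x x; rewrite d0 subr0.
apply: le_trans (hs x) _; rewrite /weight mulr_suml !big_seq.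
by apply: ler_sum => c /s0 c0; rewrite ler_wpM2l // bump_le // ltW.
Qed.

(** What matters is that K does not depend on e: it makes the normalised covering numbers a bounded
    sequence. Finitely many tents of radius r0 dominate u, and by homogeneity all of them have the
    same covering number. *)
Lemma cov_ref x0 u : lipc u -> exists2 K : R, 0 <= K &
  forall e : R, 0 < e -> cov e u <= K * cov e (bump r0 x0).
Proof.
move=> hu; have [K [K0 /(_ r0 r0_gt0)[s hs]]] := lipc_dominated hu.
(* The [+ 1] makes the coefficient positive, as [covZ] requires. *)
exists ((K * (r0 / 2)^-1 + 1) * (size s)%:R).
  by rewrite mulr_ge0 // addr_ge0 // mulr_ge0 // half_inv_ge0.
move=> e e0; set c := K * (r0 / 2)^-1 + 1.
have c0 : 0 < c by rewrite ltr_wpDl // mulr_ge0 // half_inv_ge0.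
have hF y : lipc (fun x => c * bump r0 y x).
  by apply: lipcZ => //; exact: bump_lipc.
have h : forall x, u x <= \sum_(y <- s) c * bump r0 y x.
  move=> x; apply: le_trans (hs x) _; apply: ler_sum => y _.
  by rewrite ler_wpM2r ?bump_ge0 // lerDl.
apply: le_trans (cov_mono e0 (lipc_sum dP s hF) h) _.
apply: le_trans (cov_sum _ e0 hF) _.
rewrite (eq_bigr (fun=> c * cov e (bump r0 x0))); last first.
  move=> y _; rewrite covZ //; last exact: bump_lipc.
  by rewrite (cov_bump y x0).
by rewrite big_const_seq count_predT iter_addr addr0 mulr_natr mulrnAl.
Qed.

(** On a tent of radius e the factor a exceeds its value at the centre by at most eta. Multiplying
    each weight by that value plus eta therefore turns a cover of u into a cover of a u. *)
Lemma covers_part e u a w eta s t : 0 <= eta ->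
  (forall x y, d x y < e -> `|a x - a y| <= eta) ->
  (forall x, 0 <= a x) ->
  covers e (fun x => u x) s -> covers e w t ->
  covers e (fun x => a x * u x + eta * w x)
    ([seq (p.1 * (a p.2 + eta), p.2) | p <- s] ++
     [seq (eta * p.1, p.2) | p <- t]).
Proof.
move=> eta0 ha a0 [s0 hs] ht.
apply: covers_cat; last exact: covers_scale.
split; first by move=> _ /mapP[p ps ->] /=; rewrite mulr_ge0 ?s0 ?addr_ge0.
move=> y; rewrite big_map /=.
apply: le_trans (ler_wpM2l (a0 y) (hs y)) _.
rewrite mulr_sumr !big_seq; apply: ler_sum => c /s0 c0.
rewrite mulrCA -mulrA; apply: ler_wpM2l => //.
have [cy|/(bump_far (d:=d)) ->] := ltP (d c.2 y) e; last by rewrite !mulr0.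
apply: ler_wpM2r (bump_ge0 _ _ _ _) _ _ _.
by have := ha _ _ cy; rewrite ler_norml => /andP[]; lra.
Qed.

(** Covering numbers are only subadditive; additivity holds in the limit of small e. A cover of u +
    v is split between u and v in the proportions a = u / m and b = v / m, where a + b <= 1. The two
    slacks eta of [covers_part] produce the factor 1 + 2 eta, and w does not depend on eta. *)
Lemma cov_superadd u v : lipc u -> lipc v -> (forall x, 0 <= u x) ->
  (forall x, 0 <= v x) -> exists2 w, lipc w & forall eta : R, 0 < eta -> eta < 1 ->
  exists2 e1 : R, 0 < e1 & forall e : R, 0 < e -> e < e1 ->
  cov e u + cov e v <=
    (1 + 2 * eta) * cov e (fun x => u x + v x) + 2 * eta * cov e w.
Proof.
move=> hu hv u0 v0; have [[bu [A tA A0]] [bv [B tB B0]]] := (hu, hv).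
have [s hs] := totbounded_dominate r0_gt0 (totboundedU tA tB).
pose w (x : T) := \sum_(y <- s) (r0 / 2)^-1 * bump r0 y x.
have hw : lipc w.
  apply: lipc_sum => // y; apply: lipcZ => //; exact: bump_lipc.
have w0 x : 0 <= w x.
  by apply: sumr_ge0 => y _; rewrite mulr_ge0 ?bump_ge0 // half_inv_ge0.
exists w => //; move=> eta eta0 eta1.
(* The summand eta keeps m away from 0, so that a and b are Lipschitz. Its price is the error eta a
   in [uE], at most eta w because w is at least 1 on both supports. *)
pose m x := u x + v x + eta.
have m0 x : eta <= m x by rewrite /m lerDr addr_ge0.
have mp x : 0 < m x by exact: lt_le_trans (m0 x).
have bm : lipb d (fun x => (m x)^-1).
  apply: (lipb_inv dP eta0 m0); apply: lipbD; last exact: lipb_cst.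
  exact: lipbD.
pose a x := u x * (m x)^-1; pose b x := v x * (m x)^-1.
have ba : lipb d a by exact: lipbM.
have bb : lipb d b by exact: lipbM.
have a0 x : 0 <= a x by rewrite mulr_ge0 // invr_ge0 ltW.
have b0 x : 0 <= b x by rewrite mulr_ge0 // invr_ge0 ltW.
have ab1 x : a x + b x <= 1.
  by rewrite /a /b -mulrDl ler_pdivrMr // mul1r /m lerDl ltW.
have uE x : u x = a x * (u x + v x) + eta * a x.
  have e : a x * m x = u x by rewrite mulfVK ?gt_eqF.
  by rewrite -[LHS]e /m; ring.
have vE x : v x = b x * (u x + v x) + eta * b x.
  have e : b x * m x = v x by rewrite mulfVK ?gt_eqF.
  by rewrite -[LHS]e /m; ring.
have aw x : a x <= w x.
  have [/hs h|h] := pselect ((A `|` B) x); last first.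
    by rewrite /a A0 ?mul0r // => Ax; apply: h; left.
  apply: le_trans h; have := b0 x; have := ab1 x; lra.
have bw x : b x <= w x.
  have [/hs h|h] := pselect ((A `|` B) x); last first.
    by rewrite /b B0 ?mul0r // => Bx; apply: h; right.
  apply: le_trans h; have := a0 x; have := ab1 x; lra.
have [L1 [_ aL]] := ba; have [L2 [_ bL]] := bb.
pose L : R := `|L1| + `|L2| + 1.
have L0 : 0 < L by rewrite ltr_wpDl // addr_ge0.
have near_ab (c : T -> R) (Lc e : R) : (forall x y, `|c x - c y| <= Lc * d x y) -> Lc <= L ->
    e < eta / L -> forall x y, d x y < e -> `|c x - c y| <= eta.
  move=> cL LcL el x y xy; apply: le_trans (cL x y) _.
  apply: (@le_trans _ _ (L * d x y)); first by rewrite ler_wpM2r ?(pm_ge0 dP).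
  rewrite mulrC -ler_pdivlMr // ltW //; exact: lt_trans el.
exists (eta / L); first exact: divr_gt0.
move=> e e0 el.
have near_a : forall x y, d x y < e -> `|a x - a y| <= eta.
  apply: near_ab aL _ el; rewrite /L; have := ler_norm L1; have := normr_ge0 L2; lra.
have near_b : forall x y, d x y < e -> `|b x - b y| <= eta.
  apply: near_ab bL _ el; rewrite /L; have := ler_norm L2; have := normr_ge0 L1; lra.
(* The weight of p enters with factor 1 + 2 eta < 3 and that of q twice with factor eta < 1: five
   shares of eps / 5. *)
apply/ler_addgt0Pr => eps eps0; have eps5 : 0 < eps / 5 by lra.
have [p [hp wp]] := cov_adherent e0 (lipcD hu hv) eps5.
have [q [hq wq]] := cov_adherent e0 hw eps5.
have cu : covers e u ([seq (p.1 * (a p.2 + eta), p.2) | p <- p] ++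
     [seq (eta * p.1, p.2) | p <- q]).
  apply: covers_le (covers_part (ltW eta0) near_a a0 hp hq) => x.
  by rewrite {1}uE lerD2l ler_wpM2l // ltW.
have cv : covers e v ([seq (p.1 * (b p.2 + eta), p.2) | p <- p] ++
     [seq (eta * p.1, p.2) | p <- q]).
  apply: covers_le (covers_part (ltW eta0) near_b b0 hp hq) => x.
  by rewrite {1}vE lerD2l ler_wpM2l // ltW.
have := cov_le cu; have := cov_le cv; rewrite !weight_cat !weight_scale.
have : weight [seq (p.1 * (a p.2 + eta), p.2) | p <- p] +
       weight [seq (p.1 * (b p.2 + eta), p.2) | p <- p] <=
       (1 + 2 * eta) * weight p.
  rewrite /weight !big_map -big_split mulr_sumr !big_seq /=.
  case: hp => p0 _; apply: ler_sum => c /p0 c0.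
  rewrite -mulrDr mulrC ler_wpM2r //; have := ab1 c.2; lra.
have : (1 + 2 * eta) * weight p <=
    (1 + 2 * eta) * cov e (fun x => u x + v x) + 3 * (eps / 5).
  apply: (@le_trans _ _ ((1 + 2 * eta) * (cov e (fun x => u x + v x) + eps / 5))).
    by rewrite ler_wpM2l ?ltW // addr_gt0 // mulr_gt0.
  by rewrite mulrDr lerD2l ler_wpM2r ?ltW //; lra.
have : eta * weight q <= eta * cov e w + eps / 5.
  apply: (@le_trans _ _ (eta * (cov e w + eps / 5))).
    by rewrite ler_wpM2l ?ltW.
  by rewrite mulrDr lerD2l -[leRHS]mul1r ler_wpM2r ?ltW.
rewrite -mulrA; lra.
Qed.

End Haar.

(** An invariant integral that is only finitely additive: nothing is asked about limits, nor about
    values outside [lipc]. The last field excludes the zero functional; tents of radius at most r0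
    are those known to have totally bounded support. *)
Record haar (R : realType) (T : choiceType) (d : T -> T -> R) (r0 : R)
    (L : (T -> R) -> R) : Prop := Haar {
  haarD : forall u v, lipc d u -> lipc d v ->
    L (fun x => u x + v x) = L u + L v;
  haarZ : forall c u, lipc d u -> L (fun x => c * u x) = c * L u;
  haar_ge0 : forall u, lipc d u -> (forall x, 0 <= u x) -> 0 <= L u;
  haar_iso : forall g u, isometry d g -> lipc d u -> L (fun x => u (g x)) = L u;
  haar_bump : forall (e : R) x, 0 < e -> e <= r0 -> 0 < L (bump d e x) }.

(** * Existence of the invariant functional *)

Section HaarExists.
Context (R : realType) (T : choiceType) (d : T -> T -> R).
Context (dP : pseudometric d) (r0 : R) (r0_gt0 : 0 < r0).
Context (ball_tb : forall x, totbounded d [set y | d x y < r0]).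
Context (homog : forall x y, exists g, isometry d g /\ g x = y).

Local Notation bump := (bump d).
Local Notation lipc := (lipc d).
Local Notation cov := (cov d).

(* Weil's construction of the Haar functional: the limit of the normalised
   covering numbers by bumps of radius tending to 0. *)
Lemma haar_nonneg_exists (x0 : T) : exists L : (T -> R) -> R,
  [/\ forall u v, lipc u -> lipc v -> (forall x, 0 <= u x) ->
        (forall x, 0 <= v x) -> L (fun x => u x + v x) = L u + L v,
      forall (c : R) u, 0 < c -> lipc u -> L (fun x => c * u x) = c * L u,
      forall u v, lipc u -> lipc v -> (forall x, u x <= v x) -> L u <= L v,
      forall g u, isometry d g -> lipc u -> L (fun x => u (g x)) = L u &
      L (bump r0 x0) = 1].
Proof.
have [Lu [LuD LuZ Lule Lu1]] := ultralimit_exists R.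
pose en n : R := r0 / n.+1%:R.
have en0 n : 0 < en n by rewrite divr_gt0.
have c0 n : 0 < cov (en n) (bump r0 x0) by exact: cov_ref_gt0.
pose I u n : R := cov (en n) u / cov (en n) (bump r0 x0).
have Ibd u : lipc u -> bounded_seq (I u).
  move=> hu; have [K K0 hK] : exists2 K : R, 0 <= K & forall e : R, 0 < e -> cov e u <= K * cov e (bump r0 x0).
    exact: cov_ref.
  exists K => n; rewrite ger0_norm.
    by rewrite ler_pdivrMr // hK.
  by rewrite divr_ge0 ?(ltW (c0 n)) // cov_ge0.
have bD a b : bounded_seq a -> bounded_seq b -> bounded_seq (fun n => a n + b n).
  move=> [A hA] [B hB]; exists (A + B) => n.
  by apply: le_trans (ler_normD _ _) _; exact: lerD.
have bZ c a : bounded_seq a -> bounded_seq (fun n => c * a n).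
  by move=> [A hA]; exists (`|c| * A) => n; rewrite normrM ler_wpM2l.
have LD u v : lipc u -> lipc v ->
    Lu (I (fun x => u x + v x)) <= Lu (I u) + Lu (I v).
  move=> hu hv; rewrite -LuD; [|exact: Ibd|exact: Ibd].
  apply: Lule; [exact/Ibd/lipcD|by apply: bD; exact: Ibd|].
  exists 0%N => n _; rewrite /I -mulrDl ler_wpM2r ?invr_ge0 ?(ltW (c0 n)) //.
  exact: covD.
exists (fun u => Lu (I u)); split.
- move=> u v hu hv u0 v0; apply/eqP; rewrite eq_le LD //=.
  have [w hw hsup] := cov_superadd dP r0_gt0 ball_tb hu hv u0 v0.
  (* [cov_superadd] holds for radii below a bound depending on eta, hence for all large n, which is
     all that the ultralimit sees. *)
  have key (eta : R) : 0 < eta -> eta < 1 -> Lu (I u) + Lu (I v) <=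
      (1 + 2 * eta) * Lu (I (fun x => u x + v x)) + 2 * eta * Lu (I w).
    move=> eta0 eta1; have [e1 e10 he] := hsup eta eta0 eta1.
    have Iuv : bounded_seq (I (fun x => u x + v x)) by exact/Ibd/lipcD.
    rewrite -!LuZ -?LuD; [|apply: bZ| apply: bZ|..]; do ?exact: Ibd; try by [].
    apply: Lule; [by apply: bD; exact: Ibd|by apply: bD; apply: bZ => //; exact: Ibd|].
    have [N hN] : exists N : nat, r0 / e1 < N%:R.
      by exists (Num.bound (r0 / e1)); rewrite archi_boundP // divr_ge0 // ltW.
    exists N => n Nn; rewrite /I -mulrDl !mulrA -mulrDl.
    rewrite ler_wpM2r ?invr_ge0 ?(ltW (c0 n)) //; apply: he => //.
    rewrite /en ltr_pdivrMr // mulrC -ltr_pdivrMr //; apply: lt_le_trans hN _.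
    by rewrite ler_nat leqW.
  set X := Lu _ + Lu _ in key *; set Y := Lu (I _) in key *.
  set Z := Lu (I w) in key.
  apply/ler_addgt0Pr => eps eps0.
  (* With eta at most eps / M the correction eta (2 Y + 2 Z) is at most eps. *)
  pose M := 2 * `|Y| + 2 * `|Z| + 1.
  have M0 : 0 < M by rewrite /M; have := normr_ge0 Y; have := normr_ge0 Z; lra.
  pose eta := Num.min (1 / 2) (eps / M).
  have eta0 : 0 < eta by rewrite lt_min divr_gt0 // divr_gt0.
  have eta1 : eta < 1 by rewrite gt_min; apply/orP; left; lra.
  apply: le_trans (key eta eta0 eta1) _.
  have -> : (1 + 2 * eta) * Y + 2 * eta * Z = Y + eta * (2 * Y + 2 * Z) by ring.
  rewrite lerD2l; apply: (@le_trans _ _ (eta * M)).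
    rewrite ler_wpM2l ?ltW //.
    by rewrite /M; have := ler_norm Y; have := ler_norm Z; lra.
  by rewrite -ler_pdivlMr // ge_min lexx orbT.
- move=> c u cp hu; rewrite -LuZ; last exact: Ibd.
  by congr Lu; apply/funext => n; rewrite /I covZ // mulrA.
- move=> u v hu hv uv; apply: Lule; [exact: Ibd|exact: Ibd|].
  exists 0%N => n _; rewrite /I ler_wpM2r ?invr_ge0 ?(ltW (c0 n)) //.
  exact: cov_mono.
- move=> g u ig hu; congr Lu; apply/funext => n.
  by rewrite /I cov_iso.
- rewrite -[RHS]Lu1; congr Lu; apply/funext => n.
  by rewrite /I divff // gt_eqF.
Qed.

(** The functional on nonnegative functions extends to differences p - q; by [LamE] the value does
    not depend on the decomposition, which yields linearity. *)
Lemma haar_exists (x0 : T) : exists L, haar d r0 L.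
Proof.
have [L [LD LZ Lle Liso L1]] := haar_nonneg_exists x0.
pose pos (u : T -> R) (x : T) : R := Num.max 0 (u x).
have pos0 u x : 0 <= pos u x by rewrite le_max lexx.
have cpos u : lipc u -> lipc (pos u) by exact: lipc_pos.
have posE u x : u x = pos u x - pos (fun y => - u y) x.
  by rewrite /pos; have [h|h] := leP 0 (u x); have [h'|h'] := leP 0 (- u x); lra.
have cneg u : lipc u -> lipc (pos (fun y => - u y)).
  by move=> hu; apply: cpos; exact: lipcN.
pose Lam u := L (pos u) - L (pos (fun y => - u y)).
have LamE u p q : lipc u -> lipc p -> lipc q -> (forall x, 0 <= p x) ->
    (forall x, 0 <= q x) -> (forall x, u x = p x - q x) -> Lam u = L p - L q.
  move=> hu hp hq p0 q0 upq.
  have : L (fun x => pos u x + q x) = L (fun x => pos (fun y => - u y) x + p x).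
    congr L; apply/funext => x; have := posE u x; rewrite upq; lra.
  rewrite !LD //; [|exact: cneg|exact: cpos].
  rewrite /Lam; lra.
have L0 : L (fun=> 0) = 0.
  have z : lipc (fun=> 0) by exact: lipc0.
  have h0 : forall x : T, 0 <= (0 : R) by [].
  have := LD _ _ z z h0 h0.
  have -> : (fun x : T => (0 : R) + 0) = (fun=> 0) by apply/funext => x; rewrite addr0.
  by move: (L (fun=> 0)) => {h0 z LamE} l; lra.
have Lampos u : lipc u -> (forall x, 0 <= u x) -> Lam u = L u.
  move=> hu u0; rewrite (LamE _ u (fun=> 0)) ?L0 ?subr0 //.
    exact: lipc0.
  by move=> x; rewrite subr0.
have Lamle u : lipc u -> (forall x, 0 <= u x) -> 0 <= Lam u.
  by move=> hu u0; rewrite Lampos // -L0 Lle //; exact: lipc0.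
have LamD u v : lipc u -> lipc v -> Lam (fun x => u x + v x) = Lam u + Lam v.
  move=> hu hv.
  rewrite (LamE _ (fun x => pos u x + pos v x)
     (fun x => pos (fun y => - u y) x + pos (fun y => - v y) x)).
  - by rewrite !LD ?/Lam; [ring|exact: cneg|exact: cneg|by []|by []|exact: cpos|exact: cpos|by []|by []].
  - exact: lipcD.
  - by apply: lipcD; exact: cpos.
  - by apply: lipcD; exact: cneg.
  - by move=> x; rewrite addr_ge0.
  - by move=> x; rewrite addr_ge0.
  - by move=> x; rewrite [u x]posE [v x]posE; ring.
have LamZ c u : lipc u -> Lam (fun x => c * u x) = c * Lam u.
  move=> hu; have [c0|c0|c0] := ltgtP c 0.
  - have nc : 0 < - c by rewrite oppr_gt0.
    rewrite (LamE _ (fun x => - c * pos (fun y => - u y) x)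
      (fun x => - c * pos u x)).
    + by rewrite !LZ // ?/Lam; [ring|exact: cpos|exact: cneg].
    + exact: lipcZ.
    + by apply: lipcZ => //; exact: cneg.
    + by apply: lipcZ => //; exact: cpos.
    + by move=> x; rewrite mulr_ge0 // ltW.
    + by move=> x; rewrite mulr_ge0 // ltW.
    + by move=> x; rewrite {1}[u x]posE; ring.
  - rewrite (LamE _ (fun x => c * pos u x)
      (fun x => c * pos (fun y => - u y) x)).
    + by rewrite !LZ // ?/Lam; [ring|exact: cneg|exact: cpos].
    + exact: lipcZ.
    + by apply: lipcZ => //; exact: cpos.
    + by apply: lipcZ => //; exact: cneg.
    + by move=> x; rewrite mulr_ge0 // ltW.
    + by move=> x; rewrite mulr_ge0 // ltW.
    + by move=> x; rewrite {1}[u x]posE; ring.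
  - rewrite c0 mul0r.
    have -> : (fun x => 0 * u x) = (fun=> 0) by apply/funext => x; rewrite mul0r.
    by rewrite Lampos //; exact: lipc0.
exists Lam; split=> //.
  move=> g u ig hu; rewrite (LamE _ (fun x => pos u (g x))
    (fun x => pos (fun y => - u y) (g x))) //.
  - rewrite (Liso g (pos u)) ?(Liso g (pos (fun y => - u y))) //;
      [exact: cneg|exact: cpos].
  - exact: lipc_iso.
  - by apply: (lipc_iso ig); exact: cpos.
  - by apply: (lipc_iso ig); exact: cneg.
move=> e x e0 er; have cb y : lipc (bump e y) by exact: bump_lipc.
have c0 : lipc (bump r0 x0) by exact: bump_lipc.
rewrite Lampos //; last by move=> y; exact: bump_ge0.
(* All tents of radius e have the same integral, by homogeneity. Were it nonpositive, the reference
   tent, dominated by finitely many multiples of them, could not have integral 1. *)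
rewrite ltNge; apply/negP => Lb.
have [K [K0 /(_ e e0)[s hs]]] := lipc_dominated c0.
have Lx y : L (bump e y) <= 0.
  have [g [ig gx]] := homog x y.
  apply: le_trans Lb; rewrite -(Liso g (bump e y)) //.
  have -> // : (fun z => bump e y (g z)) = bump e x.
  by apply/funext => z; rewrite -gx bump_iso.
pose M := K * (e / 2)^-1 + 1.
have M0 : 0 < M by rewrite ltr_wpDl // mulr_ge0 // invr_ge0 divr_ge0 // ltW.
have cF y : lipc (fun x => M * bump e y x) by exact: lipcZ.
have : L (bump r0 x0) <= L (fun x => \sum_(y <- s) M * bump e y x).
  apply: Lle => //; first exact: lipc_sum.
  move=> y; apply: le_trans (hs y) _; apply: ler_sum => z _.
  by rewrite ler_wpM2r ?bump_ge0 // lerDl.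
have : L (fun x => \sum_(y <- s) M * bump e y x) <= 0.
  elim: s {hs} => [|y s IH].
    rewrite -L0 le_eqVlt; apply/orP; left; apply/eqP; congr L.
    by apply/funext => z; rewrite big_nil.
  have -> : (fun x => \sum_(j <- y :: s) M * bump e j x) =
    (fun x => M * bump e y x + \sum_(j <- s) M * bump e j x).
    by apply/funext => z; rewrite big_cons.
  have Mb0 z y' : 0 <= M * bump e y' z by rewrite mulr_ge0 ?bump_ge0 // ltW.
  rewrite LD //; [|exact: lipc_sum|by move=> z; exact: sumr_ge0].
  rewrite LZ // -[leRHS]addr0 lerD //.
  by rewrite mulr_ge0_le0 // ltW.
by rewrite L1; lra.
Qed.

End HaarExists.

(** * Fubini's theorem *)

Section HaarTheory.
Context (R : realType) (T : choiceType) (d : T -> T -> R).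
Context (dP : pseudometric d) (r0 : R) (r0_gt0 : 0 < r0).
Context (ball_tb : forall x, totbounded d [set y | d x y < r0]).
Context (homog : forall x y, exists g, isometry d g /\ g x = y).
Context (L : (T -> R) -> R) (LP : haar d r0 L).

Local Notation bump := (bump d).
Local Notation lipc := (lipc d).
Local Notation lipb := (lipb d).

Lemma haarN u : lipc u -> L (fun x => - u x) = - L u.
Proof.
move=> hu; rewrite -mulN1r -(haarZ LP) //; congr L.
by apply/funext => x; rewrite mulN1r.
Qed.

Lemma haarB u v : lipc u -> lipc v -> L (fun x => u x - v x) = L u - L v.
Proof.
by move=> hu hv; rewrite (haarD LP) // ?haarN //; exact: lipcN.
Qed.

Lemma haar_le u v : lipc u -> lipc v -> (forall x, u x <= v x) -> L u <= L v.
Proof.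
move=> hu hv uv; rewrite -subr_ge0 -haarB //; apply: (haar_ge0 LP).
  exact: lipcB.
by move=> x; rewrite subr_ge0.
Qed.

Lemma haar_dist u v a : lipc u -> lipc v -> lipc a ->
  (forall x, `|u x - v x| <= a x) -> `|L u - L v| <= L a.
Proof.
move=> hu hv ha uva; rewrite -haarB // ler_norml -haarN //.
have cN : lipc (fun x => - a x) by exact: lipcN.
have cB : lipc (fun x => u x - v x) by exact: lipcB.
by apply/andP; split; apply: haar_le => // x; have := uva x;
   rewrite ler_norml => /andP[].
Qed.

Lemma haar_sum (I : Type) (s : seq I) (F : I -> T -> R) :
  (forall i, lipc (F i)) -> L (fun x => \sum_(i <- s) F i x) =
  \sum_(i <- s) L (F i).
Proof.
move=> hF; elim: s => [|i s IH].
  rewrite big_nil.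
  have -> : (fun x => \sum_(i <- [::]) F i x) = (fun x : T => 0 * (0 : R)).
    by apply/funext => x; rewrite big_nil mul0r.
  by rewrite (haarZ LP) ?mul0r //; exact: lipc0.
rewrite big_cons -IH -(haarD LP) //; last exact: lipc_sum.
by congr L; apply/funext => x; rewrite big_cons.
Qed.

(** A cut-off function: a sum of tents that is at least 1 on A, truncated at 1. The minimum of b and
    1 is written with a positive part in order to use [lipb_pos]. *)
Lemma lipc_dominator A : totbounded d A -> exists a, [/\ lipc a,
  forall x, 0 <= a x, forall x, a x <= 1 & forall x, A x -> a x = 1].
Proof.
move=> tA; have [s hs] := totbounded_dominate r0_gt0 tA.
pose b (x : T) : R := \sum_(y <- s) (r0 / 2)^-1 * bump r0 y x.
have cb : lipc b.
  by apply: lipc_sum => // y; apply: lipcZ => //; exact: bump_lipc.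
have b0 x : 0 <= b x.
  apply: sumr_ge0 => y _; rewrite mulr_ge0 ?bump_ge0 //.
  by rewrite invr_ge0 divr_ge0 // ltW.
pose a x : R := b x - Num.max 0 (b x - 1).
have pb x : 0 <= Num.max 0 (b x - 1) /\ b x - 1 <= Num.max 0 (b x - 1) /\
   (Num.max 0 (b x - 1) = 0 \/ Num.max 0 (b x - 1) = b x - 1).
  by have [h|h] := leP 0 (b x - 1); split; rewrite //; split; auto; lra.
exists a; split.
- split.
    apply: lipbB => //; first by case: cb.
    by apply: lipb_pos; apply: lipbB => //; [case: cb|exact: lipb_cst].
  case: cb => _ [B tB B0]; exists B => // x /B0 bx.
  have := pb x; rewrite /a bx; lra.
- by move=> x; rewrite /a; have := b0 x; have := pb x; lra.
- by move=> x; rewrite /a; have := b0 x; have := pb x; lra.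
- by move=> x /hs; rewrite -/(b x) /a; have := pb x; lra.
Qed.

Definition lipb2 (v : T -> T -> R) := exists C : R,
  (forall z w, `|v z w| <= C) /\
  forall z w z' w', `|v z w - v z' w'| <= C * (d z z' + d w w').

Definition supp2 (v : T -> T -> R) := exists A B, [/\ totbounded d A, totbounded d B,
  forall z w, ~ A z -> v z w = 0 & forall z w, ~ B w -> v z w = 0].

Lemma lipb2_swap v : lipb2 v -> lipb2 (fun z w => v w z).
Proof.
move=> [C [b l]]; exists C; split=> // z w z' w'.
by rewrite [d z z' + _]addrC; exact: l.
Qed.

Lemma supp2_swap v : supp2 v -> supp2 (fun z w => v w z).
Proof. by move=> [A [B [tA tB hA hB]]]; exists B, A; split=> // z w; auto. Qed.

Lemma lipb2_r v z : lipb2 v -> lipb (v z).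
Proof.
move=> [C [b l]]; exists C; split=> // x y; case: dP => d0 _ _.
by have := l z x z y; rewrite d0 add0r.
Qed.

Lemma lipb2_l v w : lipb2 v -> lipb (v^~ w).
Proof. by move=> /lipb2_swap; exact: lipb2_r. Qed.

Lemma lipc2_r v z : lipb2 v -> supp2 v -> lipc (v z).
Proof.
move=> hv [A [B [tA tB hA hB]]]; split; first exact: lipb2_r.
by exists B => // w; exact: hB.
Qed.

Lemma lipc2_l v w : lipb2 v -> supp2 v -> lipc (v^~ w).
Proof. by move=> /lipb2_swap hv /supp2_swap; exact: lipc2_r. Qed.

(** All the functions v z live on one totally bounded set B. A uniform bound K on v z - v z' is thus
    a bound by K times a fixed cut-off of B, which L turns into K L(a). *)
Lemma lipc_haar_r v : lipb2 v -> supp2 v -> lipc (fun z => L (v z)).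
Proof.
move=> hv sv; have cv z := lipc2_r z hv sv.
case: sv => A [B [tA tB hA hB]]; case: hv => C [b l].
have [a [ca a0 a1 aB]] := lipc_dominator tB.
have La : 0 <= L a by exact: (haar_ge0 LP).
have L0 : L (fun=> 0) = 0.
  by have := haarZ LP 0 (lipc0 dP); rewrite !mul0r.
have key z z' (K : R) : (forall w, `|v z w - v z' w| <= K) ->
    `|L (v z) - L (v z')| <= K * L a.
  move=> h; rewrite -(haarZ LP) //; apply: haar_dist => //; first exact: lipcZ.
  move=> w; have [/aB ->|nB] := pselect (B w); first by rewrite mulr1.
  rewrite !hB // subr0 normr0 mulr_ge0 //; apply: le_trans (h w).
  exact: normr_ge0.
split; last first.
  exists A => // z nA; rewrite -L0; congr L; apply/funext => w; exact: hA.
apply: lipbI => //.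
  exists (C * L a) => z.
  have := haar_dist (cv z) (lipc0 dP) (lipcZ dP C ca).
  rewrite L0 subr0 (haarZ LP) //; apply.
  move=> w; rewrite subr0; have [/aB ->|nB] := pselect (B w).
    by rewrite mulr1.
  rewrite hB // normr0 mulr_ge0 //; apply: le_trans (b z w); exact: normr_ge0.
exists (C * L a) => z z'; rewrite mulrAC; apply: key => w.
by have := l z w z' w; case: dP => d0 _ _; rewrite d0 addr0.
Qed.

Lemma lipc_haar_l v : lipb2 v -> supp2 v -> lipc (fun w => L (v^~ w)).
Proof. by move=> /lipb2_swap hv /supp2_swap; exact: lipc_haar_r. Qed.

(* Both iterated integrals are approximated by those of
   [sum_y v(z, y) b_y(w)], with [b_y] a fine partition of unity. *)
Lemma haar_fubini v : lipb2 v -> supp2 v ->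
  L (fun z => L (v z)) = L (fun w => L (v^~ w)).
Proof.
move=> hv sv; have cr z := lipc2_r z hv sv; have cl w := lipc2_l w hv sv.
have Jr := lipc_haar_r hv sv; have Jl := lipc_haar_l hv sv.
case: sv => A [B [tA tB hA hB]]; case: hv => C [b l].
have [a [ca a0 a1 aA]] := lipc_dominator tA.
have [e [ce e0 e1 eB]] := lipc_dominator tB.
have La : 0 <= L a by exact: (haar_ge0 LP).
have Le : 0 <= L e by exact: (haar_ge0 LP).
have key (D : R) : 0 < D -> `|L (fun z => L (v z)) - L (fun w => L (v^~ w))| <=
    2 * (`|C| * D * L a * L e).
  move=> D0; have D2 : 0 < D / 2 by rewrite divr_gt0.
  have [s hs] := tB (D / 2) D2.
  pose m w : R := \sum_(y <- s) bump D y w.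
  have bm : lipb m by apply: lipb_sum => // y; exact: lipb_bump.
  have m0 w : 0 <= m w by apply: sumr_ge0 => y _; exact: bump_ge0.
  have mB w : B w -> D / 2 <= m w.
    move=> /hs[y ys yw]; rewrite /m (big_rem y) //=.
    apply: (@le_trans _ _ (bump D y w)).
      by apply: le_trans (bump_near _ _ _ _); lra.
    by rewrite lerDl sumr_ge0 // => x _; exact: bump_ge0.
  (* The maximum of D / 2 and m: it equals m on B, and having a positive lower bound everywhere it
     has a Lipschitz inverse. *)
  pose n w : R := D / 2 + Num.max 0 (m w - D / 2).
  have nD w : D / 2 <= n w by rewrite /n lerDl le_max lexx.
  have bn : lipb n.
    apply: lipbD; first exact: lipb_cst.
    by apply: lipb_pos; apply: lipbB => //; exact: lipb_cst.
  have mn w : m w <= n w.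
    by rewrite /n -lerBlDl le_max lexx orbT.
  have mnB w : B w -> n w = m w.
    by move=> /mB h; rewrite /n; have [?|?] := leP 0 (m w - D / 2); lra.
  have n0 w : 0 < n w by exact: lt_le_trans (nD w).
  pose q y w : R := bump D y w * (n w)^-1 * e w.
  have cq y : lipc (q y).
    apply: lipcMl => //; apply: lipbM => //; first exact: lipb_bump.
    exact: (lipb_inv dP D2).
  have q0 y w : 0 <= q y w by rewrite !mulr_ge0 ?bump_ge0 // invr_ge0 ltW.
  have qsum w : \sum_(y <- s) q y w <= e w.
    rewrite /q -mulr_suml -mulr_suml -/(m w) ler_piMl // ler_pdivrMr //.
    by rewrite mul1r.
  have vsum z w : v z w = \sum_(y <- s) v z w * q y w.
    rewrite -mulr_sumr /q -mulr_suml -mulr_suml -/(m w).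
    have [Bw|nB] := pselect (B w); last by rewrite hB // mul0r.
    rewrite eB // mulr1 mnB // divff ?mulr1 // gt_eqF //.
    exact: lt_le_trans (mB _ Bw).
  have est z w : `|v z w - \sum_(y <- s) v z y * q y w| <=
      `|C| * D * a z * e w.
    rewrite vsum -sumrB; apply: le_trans (ler_norm_sum _ _ _) _.
    apply: (@le_trans _ _ (\sum_(y <- s) (`|C| * D * a z) * q y w)); last first.
      by rewrite -mulr_sumr ler_wpM2l // !mulr_ge0 // ltW.
    apply: ler_sum => y _; rewrite -mulrBl normrM [`|q y w|]ger0_norm //.
    have [yw|yw] := ltP (d y w) D; last first.
      by rewrite /q (bump_far yw) !mul0r !mulr0.
    apply: ler_wpM2r => //; have [Az|nA] := pselect (A z); last first.
      by rewrite !hA // subr0 normr0 !mulr_ge0 // ltW.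
    rewrite aA // mulr1; apply: le_trans (l z w z y) _.
    case: (dP) => d00 dC _; rewrite d00 add0r (dC w y).
    apply: (@le_trans _ _ (`|C| * d y w)).
      by rewrite ler_wpM2r ?(pm_ge0 dP) // ler_norm.
    by rewrite ler_wpM2l // ltW.
  (* The common value of both iterated integrals of the separated function, for which exchanging
     them is exchanging a finite sum with L. *)
  pose X : R := \sum_(y <- s) L (v^~ y) * L (q y).
  have X1 : `|L (fun z => L (v z)) - X| <= `|C| * D * L a * L e.
    have cX : lipc (fun z => \sum_(y <- s) L (q y) * v z y).
      by apply: lipc_sum => // y; exact: lipcZ.
    have -> : X = L (fun z => \sum_(y <- s) L (q y) * v z y).
      rewrite haar_sum => [|y]; last exact: lipcZ.
      by apply: eq_bigr => y _; rewrite (haarZ LP) // mulrC.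
    rewrite -mulrA [L a * _]mulrC mulrA -(haarZ LP) //.
    apply: haar_dist => //; first exact: lipcZ.
    move=> z.
    have -> : \sum_(y <- s) L (q y) * v z y = L (fun w => \sum_(y <- s) v z y * q y w).
      rewrite haar_sum => [|y]; last exact: lipcZ.
      by apply: eq_bigr => y _; rewrite (haarZ LP) // mulrC.
    rewrite mulrAC -(haarZ LP) //; apply: haar_dist => //.
      by apply: lipc_sum => // y; exact: lipcZ.
    exact: lipcZ.
  have X2 : `|L (fun w => L (v^~ w)) - X| <= `|C| * D * L a * L e.
    have cX : lipc (fun w => \sum_(y <- s) L (v^~ y) * q y w).
      by apply: lipc_sum => // y; exact: lipcZ.
    have -> : X = L (fun w => \sum_(y <- s) L (v^~ y) * q y w).
      rewrite haar_sum => [|y]; last exact: lipcZ.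
      by apply: eq_bigr => y _; rewrite (haarZ LP).
    rewrite -(haarZ LP) //.
    apply: haar_dist => //; first exact: lipcZ.
    move=> w.
    have -> : \sum_(y <- s) L (v^~ y) * q y w = L (fun z => \sum_(y <- s) q y w * v z y).
      rewrite haar_sum => [|y]; last exact: lipcZ.
      by apply: eq_bigr => y _; rewrite (haarZ LP) // mulrC.
    rewrite mulrAC -(haarZ LP) //; apply: haar_dist => //.
    - by apply: lipc_sum => // y; exact: lipcZ.
    - exact: lipcZ.
    - move=> z; rewrite mulrAC.
      by under eq_bigr do rewrite mulrC; exact: est.
  move: X1 X2; rewrite !ler_norml => /andP[? ?] /andP[? ?].
  by apply/andP; split; lra.
apply/eqP; rewrite -subr_eq0 -normr_eq0 eq_le normr_ge0 andbT.
apply/ler_addgt0Pr => eps eps0; rewrite add0r.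
pose M : R := 2 * (`|C| * L a * L e) + 1.
have M0 : 0 < M by rewrite ltr_wpDl // !mulr_ge0.
apply: le_trans (key (eps / M) _) _; first exact: divr_gt0.
have -> : 2 * (`|C| * (eps / M) * L a * L e) = (2 * (`|C| * L a * L e)) * (eps / M).
  by ring.
apply: (@le_trans _ _ (M * (eps / M))); last by rewrite mulrC divfK // gt_eqF.
apply: ler_wpM2r; first by rewrite divr_ge0 // ltW.
by rewrite /M lerDl.
Qed.

End HaarTheory.

(** * Averaging over balls *)

Section Averaging.
Context (R : realType) (T : choiceType) (d : T -> T -> R).
Context (dP : pseudometric d) (r0 : R) (r0_gt0 : 0 < r0).
Context (ball_tb : forall x, totbounded d [set y | d x y < r0]).
Context (homog : forall x y, exists g, isometry d g /\ g x = y).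
Context (L : (T -> R) -> R) (LP : haar d r0 L).
Context (r : R) (r_gt0 : 0 < r) (r_le : r + r <= r0).

Local Notation bump := (bump d).
Local Notation lipc := (lipc d).
Local Notation lipb := (lipb d).
Local Notation lipb2 := (lipb2 d).
Local Notation supp2 := (supp2 d).

(** The kernel is a tent of radius r. The condition r + r <= r0 makes room for the tents of radius r
    + r that dominate differences of kernels. *)
Definition avg (v : T -> R) (w : T) : R :=
  (L (bump r w))^-1 * L (fun y => bump r w y * v y).

Lemma haar_bump_cst e x y : e <= r0 -> L (bump e x) = L (bump e y).
Proof.
move=> er; have [g [ig gx]] := homog x y.
rewrite -(haar_iso LP ig (bump_lipc dP ball_tb y er)); congr L.
by apply/funext => z; rewrite -gx bump_iso.
Qed.

(** If v x were positive, the Lipschitz bound would keep v above v x / 2 on a small ball, so v would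
    dominate a multiple of a tent and have positive integral. *)
Lemma haar_faithful v : lipc v -> (forall x, 0 <= v x) -> L v = 0 ->
  forall x, v x = 0.
Proof.
move=> hv v0 Lv x; apply/eqP; rewrite eq_le v0 andbT leNgt; apply/negP => vx.
have [[C [_ l]] _] := hv.
pose e := Num.min r0 (v x / 2 / (`|C| + 1)).
have C1 : 0 < `|C| + 1 by rewrite ltr_wpDl.
have e0 : 0 < e by rewrite lt_min r0_gt0 !divr_gt0.
have er : e <= r0 by rewrite ge_min lexx.
have cb : lipc (bump e x) by exact: bump_lipc.
have k0 : 0 < v x / 2 / e by rewrite !divr_gt0.
have : L (fun y => v x / 2 / e * bump e x y) <= L v.
  apply: (haar_le dP LP) => //; first exact: lipcZ.
  move=> y; have [yx|/bump_far ->] := ltP (d x y) e; last by rewrite mulr0.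
  apply: (@le_trans _ _ (v x / 2)).
    by rewrite -mulrA ler_piMr ?divr_ge0 // mulrC ler_pdivrMr // mul1r bump_le // ltW.
  have : `|C| * d x y <= v x / 2.
    apply: (@le_trans _ _ ((`|C| + 1) * e)).
      by apply: ler_pM => //; [exact: (pm_ge0 dP)|rewrite lerDl|exact: ltW].
    by rewrite mulrC -ler_pdivlMr // ge_min lexx orbT.
  have : C * d x y <= `|C| * d x y by rewrite ler_wpM2r ?(pm_ge0 dP) // ler_norm.
  have := l x y; rewrite ler_norml => /andP[]; lra.
rewrite (haarZ LP) // Lv leNgt => /negP; apply.
by rewrite mulr_gt0 // (haar_bump LP).
Qed.

Let r_le0 : r <= r0.
Proof. by apply: le_trans r_le; rewrite lerDl ltW. Qed.

Lemma bump_r_lipc w : lipc (bump r w).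
Proof. exact: bump_lipc. Qed.

Lemma bump_mul_lipc v w : lipb v -> lipc (fun y => bump r w y * v y).
Proof. by move=> hv; apply: lipcMr => //; exact: bump_r_lipc. Qed.

Lemma haar_r_gt0 w : 0 < L (bump r w).
Proof. exact: (haar_bump LP). Qed.

Lemma avg_cst (a : R) w : avg (fun=> a) w = a.
Proof.
have -> : avg (fun=> a) w = (L (bump r w))^-1 * L (fun y => a * bump r w y).
  by congr (_ * L _); apply/funext => y; rewrite mulrC.
rewrite (haarZ LP); last exact: bump_r_lipc.
by rewrite mulrC mulfK // gt_eqF // haar_r_gt0.
Qed.

Lemma avgB u v w : lipb u -> lipb v ->
  avg (fun x => u x - v x) w = avg u w - avg v w.
Proof.
move=> hu hv; rewrite /avg -mulrBr -(haarB dP LP); try exact: bump_mul_lipc.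
by congr (_ * L _); apply/funext => y; rewrite mulrBr.
Qed.

Lemma avgD u v w : lipb u -> lipb v ->
  avg (fun x => u x + v x) w = avg u w + avg v w.
Proof.
move=> hu hv; rewrite /avg -mulrDr -(haarD LP); try exact: bump_mul_lipc.
by congr (_ * L _); apply/funext => y; rewrite mulrDr.
Qed.

Lemma avgZ a v w : lipb v -> avg (fun x => a * v x) w = a * avg v w.
Proof.
move=> hv; rewrite /avg mulrCA -(haarZ LP a); last exact: bump_mul_lipc.
by congr (_ * L _); apply/funext => y; rewrite mulrCA.
Qed.

(** The kernel vanishes at distance r and beyond; this form serves for estimates known only near
    w. *)
Lemma avg_le_near u v w : lipb u -> lipb v ->
  (forall x, d w x < r -> u x <= v x) -> avg u w <= avg v w.
Proof.
move=> hu hv uv; rewrite /avg ler_wpM2l ?invr_ge0 ?(ltW (haar_r_gt0 w)) //.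
apply: (haar_le dP LP); try exact: bump_mul_lipc.
move=> x; have [wx|/bump_far ->] := ltP (d w x) r; last by rewrite !mul0r.
by rewrite ler_wpM2l ?bump_ge0 // uv.
Qed.

Lemma avg_le u v w : lipb u -> lipb v -> (forall x, u x <= v x) ->
  avg u w <= avg v w.
Proof. by move=> hu hv uv; apply: avg_le_near. Qed.

Lemma avg_sum (I : Type) (s : seq I) (F : I -> T -> R) w :
  (forall i, lipb (F i)) ->
  avg (fun y => \sum_(i <- s) F i y) w = \sum_(i <- s) avg (F i) w.
Proof.
move=> hF; elim: s => [|i s IH].
  rewrite big_nil -[RHS](avg_cst 0 w); congr avg.
  by apply/funext => y; rewrite big_nil.
rewrite big_cons -IH -avgD //; last exact: lipb_sum.
by congr avg; apply/funext => y; rewrite big_cons.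
Qed.

Lemma avg_norm v w (C : R) : lipb v -> (forall x, `|v x| <= C) -> `|avg v w| <= C.
Proof.
move=> hv vC; rewrite ler_norml -(avg_cst (- C) w) -[X in _ && (_ <= X)](avg_cst C w).
have hc a : lipb (fun=> a) by exact: lipb_cst.
by apply/andP; split; apply: avg_le => // x; have := vC x; rewrite ler_norml => /andP[].
Qed.

Lemma avg_iso g v w : isometry d g -> lipb v ->
  avg (fun x => v (g x)) w = avg v (g w).
Proof.
move=> ig hv; rewrite /avg (haar_bump_cst w (g w)) //; congr (_ * _).
rewrite -(haar_iso LP ig (bump_mul_lipc (g w) hv)); congr L.
by apply/funext => y; rewrite bump_iso.
Qed.

Lemma avg_eq0 v : lipb v -> (forall x, 0 <= v x) -> forall w, avg v w = 0 ->
  forall y, d w y < r -> v y = 0.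
Proof.
move=> hv v0 w /eqP; rewrite mulf_eq0 invr_eq0 (gt_eqF (haar_r_gt0 w)) /= => /eqP.
move=> h y wy.
have := haar_faithful (bump_mul_lipc w hv) _ h y.
move=> /(_ _)/eqP; rewrite mulf_eq0 (gt_eqF (bump_gt0 wy)) /= => H.
by apply/eqP/H => x; rewrite mulr_ge0 ?bump_ge0.
Qed.

(** The difference is at most d w w', and vanishes unless y is within r of w or w'. There one of the
    two wider tents is at least r. *)
Lemma bump_diff_le w w' y :
  `|bump r w y - bump r w' y| <= d w w' * (r^-1 * (bump (r + r) w y + bump (r + r) w' y)).
Proof.
have near x : d x y < r -> 1 <= r^-1 * bump (r + r) x y.
  move=> h; rewrite ler_pdivlMl // mulr1; apply: le_trans (bump_near _ _ _ _); lra.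
have b0 x : 0 <= r^-1 * bump (r + r) x y by rewrite mulr_ge0 ?bump_ge0 // invr_ge0 ltW.
have lip : `|bump r w y - bump r w' y| <= d w w'.
  by rewrite ![bump r _ y]bumpC //; exact: bump_lip.
have d0 : 0 <= d w w' by exact: (pm_ge0 dP).
have [h|h] := ltP (d w y) r.
  apply: le_trans lip _; rewrite -[leLHS]mulr1 ler_wpM2l // mulrDr.
  by have := near w h; have := b0 w'; lra.
have [h'|h'] := ltP (d w' y) r.
  apply: le_trans lip _; rewrite -[leLHS]mulr1 ler_wpM2l // mulrDr.
  by have := near w' h'; have := b0 w; lra.
rewrite (bump_far h) (bump_far h') subrr normr0 mulr_ge0 // mulrDr addr_ge0 //.
Qed.

(** Averaging regularises: the Lipschitz constant of the average depends on the supremum C of v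
    only, since the kernel carries all dependence on w. *)
Lemma avg_lip : exists2 K : R, 0 <= K & forall v (C : R), lipb v ->
  (forall x, `|v x| <= C) -> forall w w', `|avg v w - avg v w'| <= C * (K * d w w').
Proof.
have [[x0]|noT] := pselect (exists x0 : T, True); last first.
  by exists 0 => // v C _ _ w; case: noT; exists w.
move=> _.
have cb x : lipc (bump (r + r) x) by exact: bump_lipc.
have c0 := haar_r_gt0 x0.
pose c := L (bump r x0); pose m := L (bump (r + r) x0).
have m0 : 0 <= m by apply: (haar_ge0 LP) => // y; exact: bump_ge0.
exists (c^-1 * (r^-1 * (m + m))).
  by rewrite !mulr_ge0 ?invr_ge0 ?addr_ge0 ?(ltW c0) // ltW.
move=> v C hv vC w w'; have C0 : 0 <= C by exact: le_trans (vC w).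
have -> : avg v w - avg v w' =
   c^-1 * (L (fun y => bump r w y * v y) - L (fun y => bump r w' y * v y)).
  by rewrite /avg !(haar_bump_cst _ x0) // -mulrBr.
rewrite normrM ger0_norm ?invr_ge0 ?(ltW c0) //.
have -> : C * (c^-1 * (r^-1 * (m + m)) * d w w') =
  c^-1 * ((C * d w w' * r^-1) * (m + m)) by ring.
rewrite ler_wpM2l ?invr_ge0 ?(ltW c0) //.
have -> : C * d w w' * r^-1 * (m + m) = L (fun y => C * d w w' * r^-1 *
    (bump (r + r) w y + bump (r + r) w' y)).
  rewrite (haarZ LP); last exact: lipcD.
  by rewrite (haarD LP) // !(haar_bump_cst _ x0).
apply: (haar_dist dP LP); try exact: bump_mul_lipc.
  by apply: lipcZ => //; exact: lipcD.
move=> y; rewrite -mulrBl normrM mulrC -!mulrA; apply: ler_pM => //.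
exact: bump_diff_le.
Qed.

Definition avg1 (v : T -> T -> R) z w := avg (v^~ w) z.
Definition avg2 (v : T -> T -> R) z w := avg (v z) w.

Lemma lipb2_avg2 v : lipb2 v -> lipb2 (avg2 v).
Proof.
move=> hv; have hr z := lipb2_r dP z hv; case: (hv) => C [b l].
have [K K0 hK] := avg_lip.
exists (Num.max C (C * K)); split=> [z w|z w z' w'].
  by rewrite le_max; apply/orP; left; exact: avg_norm.
have C0 : 0 <= C by exact: le_trans (b z w).
have d1 := pm_ge0 dP z z'; have d2 := pm_ge0 dP w w'.
have -> : avg2 v z w - avg2 v z' w' =
  (avg2 v z w - avg2 v z' w) + (avg2 v z' w - avg2 v z' w') by ring.
apply: le_trans (ler_normD _ _) _; rewrite mulrDr; apply: lerD.
  apply: (@le_trans _ _ (C * d z z')).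
    rewrite /avg2 -avgB //; apply: avg_norm; first exact: lipbB.
    by move=> x; have := l z x z' x; case: (dP) => d0 _ _; rewrite d0 addr0.
  by rewrite ler_wpM2r // le_max lexx.
apply: (@le_trans _ _ (C * (K * d w w'))); first exact: hK.
by rewrite mulrA ler_wpM2r // le_max lexx orbT.
Qed.

Lemma lipb2_avg1 v : lipb2 v -> lipb2 (avg1 v).
Proof. by move=> /lipb2_swap/lipb2_avg2/lipb2_swap. Qed.

Lemma lipb2M u v : lipb2 u -> lipb2 v -> lipb2 (fun z w => u z w * v z w).
Proof.
move=> [C [b l]] [C' [b' l']]; exists (C * C' + C * C'); split=> [z w|z w z' w'].
  rewrite normrM; have C0 : 0 <= C by exact: le_trans (b z w).
  have C'0 : 0 <= C' by exact: le_trans (b' z w).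
  have : `|u z w| * `|v z w| <= C * C' by exact: ler_pM.
  by move=> h; apply: le_trans h _; rewrite lerDl mulr_ge0.
have -> : u z w * v z w - u z' w' * v z' w' =
  u z w * (v z w - v z' w') + v z' w' * (u z w - u z' w') by ring.
apply: le_trans (ler_normD _ _) _; rewrite !normrM mulrDl; apply: lerD.
  by rewrite -mulrA ler_pM.
by rewrite [C * C']mulrC -mulrA ler_pM.
Qed.

Lemma lipb2D u v : lipb2 u -> lipb2 v -> lipb2 (fun z w => u z w + v z w).
Proof.
move=> [C [b l]] [C' [b' l']]; exists (C + C'); split=> [z w|z w z' w'].
  by apply: le_trans (ler_normD _ _) _; exact: lerD.
by rewrite opprD addrACA mulrDl; apply: le_trans (ler_normD _ _) _; exact: lerD.
Qed.

Lemma lipb2_fst u : lipb u -> lipb2 (fun z _ => u z).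
Proof.
move=> [C [b l]]; exists C; split=> // z w z' w'; apply: le_trans (l _ _) _.
have C0 : 0 <= C by exact: le_trans (b z).
by rewrite ler_wpM2l // lerDl (pm_ge0 dP).
Qed.

Lemma lipb2_snd u : lipb u -> lipb2 (fun _ w => u w).
Proof. by move=> /lipb2_fst/lipb2_swap. Qed.

Lemma lipb2N u : lipb2 u -> lipb2 (fun z w => - u z w).
Proof.
move=> [C [b l]]; exists C; split=> [z w|z w z' w']; first by rewrite normrN.
by rewrite -opprD normrN.
Qed.

Lemma lipb2B u v : lipb2 u -> lipb2 v -> lipb2 (fun z w => u z w - v z w).
Proof. by move=> hu /lipb2N; exact: lipb2D. Qed.

Lemma lipb2_bump : lipb2 (bump r).
Proof.
exists (Num.max r 1); split=> [z w|z w z' w'].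
  by rewrite ger0_norm ?bump_ge0 // le_max bump_le // ltW.
have -> : bump r z w - bump r z' w' =
  (bump r z w - bump r z' w) + (bump r z' w - bump r z' w') by ring.
apply: (@le_trans _ _ (1 * (d z z' + d w w'))).
  rewrite mul1r; apply: le_trans (ler_normD _ _) _; apply: lerD.
    by rewrite ![bump r _ w]bumpC //; exact: bump_lip.
  exact: bump_lip.
by rewrite ler_wpM2r ?le_max ?lexx ?orbT // addr_ge0 // (pm_ge0 dP).
Qed.

(** Both sides are, up to the two normalising factors, iterated integrals of v times the two
    kernels, a function with totally bounded support. *)
Lemma avg_comm v z w : lipb2 v -> avg1 (avg2 v) z w = avg2 (avg1 v) z w.
Proof.
move=> hv; pose h z' w' := bump r z z' * bump r w w' * v z' w'.
have hh : lipb2 h.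
  apply: lipb2M => //; apply: lipb2M.
    by apply: lipb2_fst; exact: lipb_bump.
  by apply: lipb2_snd; exact: lipb_bump.
have sh : supp2 h.
  have tb x : totbounded d [set y | d x y < r].
    by apply: totboundedS (ball_tb x) => y /= h1; exact: lt_le_trans r_le0.
  exists [set y | d z y < r], [set y | d w y < r]; split=> // x y /= /negP;
    rewrite -leNgt => /bump_far; rewrite /h => ->; by rewrite ?(mul0r, mulr0).
have e1 z' : L (h z') = bump r z z' * L (fun w' => bump r w w' * v z' w').
  rewrite -(haarZ LP); last by apply: bump_mul_lipc; exact: (lipb2_r dP).
  by congr L; apply/funext => w'; rewrite /h mulrA.
have e2 w' : L (h^~ w') = bump r w w' * L (fun z' => bump r z z' * v z' w').
  rewrite -(haarZ LP); last by apply: bump_mul_lipc; exact: (lipb2_l dP).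
  by congr L; apply/funext => z'; rewrite /h; ring.
have x1 : avg1 (avg2 v) z w =
    (L (bump r z))^-1 * ((L (bump r w))^-1 * L (fun z' => L (h z'))).
  rewrite /avg1 /avg /avg2 /avg; congr (_ * _).
  rewrite -(haarZ LP); last exact: (lipc_haar_r dP r0_gt0 ball_tb LP).
  by congr L; apply/funext => z'; rewrite e1; ring.
have x2 : avg2 (avg1 v) z w =
    (L (bump r w))^-1 * ((L (bump r z))^-1 * L (fun w' => L (h^~ w'))).
  rewrite /avg2 /avg /avg1 /avg; congr (_ * _).
  rewrite -(haarZ LP); last exact: (lipc_haar_l dP r0_gt0 ball_tb LP).
  by congr L; apply/funext => w'; rewrite e2; ring.
by rewrite x1 x2 (haar_fubini dP r0_gt0 ball_tb LP hh sh) mulrCA.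
Qed.

End Averaging.

(** * Mass transport *)

Section GroupAverage.
Context (R : realType) (T : choiceType) (d : T -> T -> R).
Context (dP : pseudometric d) (r0 : R) (r0_gt0 : 0 < r0).
Context (ball_tb : forall x, totbounded d [set y | d x y < r0]).
Context (homog : forall x y, exists g, isometry d g /\ g x = y).
Context (L : (T -> R) -> R) (LP : haar d r0 L).
Context (r : R) (r_gt0 : 0 < r) (r_le : r + r <= r0).
Context (G : set (T -> T)) (G_iso : forall g, G g -> isometry d g).
Context (G_comp : forall g h, G g -> G h -> G (g \o h)).
Context (G_inv : forall g, G g -> exists h, [/\ G h, cancel g h & cancel h g]).

(** Finiteness of these sets for totally bounded A is the proper discontinuity of the action. *)
Definition return_set (A : set T) : set (T -> T) :=
  [set g | G g /\ exists x, A x /\ A (g x)].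

Context (G_locfin : forall A, totbounded d A -> finite_set (return_set A)).
Context (D : set T) (D_tb : totbounded d D).
Context (D_cover : forall x, exists g, G g /\ D (g x)).

Local Notation bump := (bump d).
Local Notation lipc := (lipc d).
Local Notation lipb := (lipb d).
Local Notation lipb2 := (lipb2 d).
Local Notation supp2 := (supp2 d).

Lemma return_seq A : totbounded d A -> exists s : seq (T -> T),
  uniq s /\ forall g, g \in s <-> return_set A g.
Proof.
move=> /G_locfin/finite_seqP[s sE]; exists (undup s); split.
  exact: undup_uniq.
by move=> g; rewrite mem_undup sE.
Qed.

(** For w in B a nonzero term f (g w) puts g w in A, hence in B, so g returns B to itself. This
    turns the sum over the group into one over a finite list. *)
Lemma orbit_sumE (f : T -> R) A B s w : (forall x, f x != 0 -> A x) ->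
  A `<=` B -> uniq s -> (forall g, g \in s <-> return_set B g) -> B w ->
  \sum_(g \in G) f (g w) = \sum_(g <- s) f (g w).
Proof.
move=> fA AB us sE Bw; rewrite [RHS](fsbig_seq _ (fun g : T -> T => f (g w))) //.
symmetry; apply: (fsbig_widen [set` s] G (fun g : T -> T => f (g w))).
  by move=> g /sE[].
move=> g [Gg /= ng]; apply/eqP/negP => /negP fgw; apply: ng.
by apply/sE; split=> //; exists w; split=> //; apply/AB/fA.
Qed.

Lemma orbit_sum_inv (f : T -> R) h w : G h ->
  \sum_(g \in G) f (g (h w)) = \sum_(g \in G) f (g w).
Proof.
move=> Gh; have [k [Gk hk kh]] := G_inv Gh.
rewrite [RHS](reindex_fsbig (fun g : T -> T => g \o h) G G) //; split.
- by move=> g Gg; exact: G_comp.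
- move=> g g' _ _ /= e; apply/funext => x.
  by have := congr1 (fun F : T -> T => F (k x)) e; rewrite /= kh.
- move=> g Gg; exists (g \o k); first exact: G_comp.
  by apply/funext => x /=; rewrite hk.
Qed.

Lemma lipb_orbit_sum (f : T -> R) (s : seq (T -> T)) : lipb f ->
  (forall g, g \in s -> G g) -> lipb (fun x => \sum_(g <- s) f (g x)).
Proof.
move=> hf; elim: s => [|g s IH] hs.
  by move: (lipb_cst dP 0); congr lipb; apply/funext => x; rewrite big_nil.
have hg : lipb (fun x => f (g x)).
  by apply: lipb_iso => //; apply: G_iso; apply: hs; rewrite mem_head.
have hss : lipb (fun x => \sum_(g <- s) f (g x)).
  by apply: IH => k ks; apply: hs; rewrite in_cons ks orbT.
by move: (lipbD hg hss); congr lipb; apply/funext => x; rewrite big_cons.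
Qed.

(** A soft fundamental domain: a cut-off of D divided by its orbit sum, which is at least 1 since
    every orbit meets D. The sum is stated over lists of returns, for arbitrarily large B, so that
    it can be inserted under L as a finite sum. *)
Lemma partition_exists : exists chi : T -> R, [/\ lipc chi,
  forall x, 0 <= chi x, forall x, exists g, G g /\ 0 < chi (g x) &
  exists A, [/\ totbounded d A, forall x, chi x != 0 -> A x &
    forall B s, totbounded d B -> A `<=` B -> uniq s ->
      (forall g, g \in s <-> return_set B g) ->
      forall w, B w -> \sum_(g <- s) chi (g w) = 1]].
Proof.
have [chi0 [c0 p0 _ D1]] := lipc_dominator dP r0_gt0 ball_tb D_tb.
have [b0 [A tA A0']] := c0.
have A0 x : chi0 x != 0 -> A x by apply: contraNP => /A0' ->.
have [s0 [us0 s0E]] := return_seq tA.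
pose S z := \sum_(g \in G) chi0 (g z).
have SE B s w : A `<=` B -> uniq s -> (forall g, g \in s <-> return_set B g) ->
    B w -> S w = \sum_(g <- s) chi0 (g w).
  by move=> AB us sE Bw; exact: orbit_sumE A0 AB us sE Bw.
have SG g w : G g -> S (g w) = S w by exact: orbit_sum_inv.
have S1 w : 1 <= S w.
  have [g [Gg Dg]] := D_cover w; rewrite -(SG g w Gg).
  have Ag : A (g w) by apply: A0; rewrite D1 // oner_neq0.
  rewrite (SE A s0) // (big_rem (id : T -> T)) /=; last first.
    apply/s0E; split; last by exists (g w).
    have [h [Gh gh hg]] := G_inv Gg.
    have -> : (id : T -> T) = g \o h by apply/funext => x /=; rewrite hg.
    exact: G_comp.
  by rewrite D1 // lerDl sumr_ge0.
(* The maximum of 1 and the sum over [s0]. Off A the list may miss terms of the orbit sum S, but n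
   is Lipschitz everywhere and equals S on A, outside of which chi0 vanishes. *)
pose n (x : T) : R := 1 + Num.max 0 (\sum_(g <- s0) chi0 (g x) - 1).
have n1 x : 1 <= n x by rewrite /n lerDl le_max lexx.
have n0 x : 0 < n x by exact: lt_le_trans (n1 x).
have bS : lipb (fun x => \sum_(g <- s0) chi0 (g x)).
  by apply: lipb_orbit_sum => // g /s0E[].
have bn : lipb n.
  apply: lipbD; first exact: lipb_cst.
  by apply: lipb_pos; apply: lipbB => //; exact: lipb_cst.
exists (fun x => chi0 x * (n x)^-1); split.
- by apply: lipcMr => //; exact: (lipb_inv dP ltr01).
- by move=> x; rewrite mulr_ge0 // invr_ge0 ltW.
- move=> x; have [g [Gg Dg]] := D_cover x; exists g; split=> //.
  by rewrite D1 // mul1r invr_gt0.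
exists A; split=> //.
  by move=> x; rewrite mulf_eq0 negb_or => /andP[/A0].
move=> B s tB AB us sE w Bw.
rewrite (_ : \sum_(g <- s) _ = \sum_(g <- s) chi0 (g w) * (S w)^-1).
  rewrite -mulr_suml -(SE B s w) // divff // gt_eqF //.
  exact: lt_le_trans (S1 w).
rewrite !big_seq; apply: eq_bigr => g /sE[Gg _].
have [->|nz] := eqVneq (chi0 (g w)) 0; first by rewrite !mul0r.
congr (_ * _^-1); rewrite /n -(SE A s0 (g w)) //; last exact: A0.
have h : 0 <= S w - 1 by rewrite subr_ge0.
by rewrite SG // max_r // addrC subrK.
Qed.

(** An r-net of A gives finitely many balls of radius r + r <= r0 covering the neighbourhood, each
    totally bounded. *)
Lemma totbounded_nbhd A : totbounded d A ->
  totbounded d [set w | exists z, A z /\ d z w < r].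
Proof.
move=> tA; have [s hs] := tA r r_gt0.
suff : totbounded d [set w | exists2 y, y \in s & d y w < r + r].
  apply: totboundedS => w [z [/hs[y ys yz] zw]]; exists y => //.
  by case: dP => _ _ dT; apply: le_lt_trans (dT y z w) _; exact: ltrD.
elim: s {hs} => [|y s IH]; first by move=> e _; exists [::] => w [].
apply: (@totboundedS _ _ _ _ ([set w | d y w < r0] `|`
   [set w | exists2 y, y \in s & d y w < r + r])); last exact: totboundedU.
move=> w [y']; rewrite in_cons => /orP[/eqP -> h|y's h]; last by right; exists y'.
by left; exact: lt_le_trans r_le.
Qed.

Definition G_invariant (v : T -> T -> R) :=
  forall g, G g -> forall z w, v (g z) (g w) = v z w.

Context (chi : T -> R) (chi_c : lipc chi) (chi_ge0 : forall x, 0 <= chi x).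
Context (chi_gt0 : forall x, exists g, G g /\ 0 < chi (g x)).
Context (A : set T) (A_tb : totbounded d A) (A_chi : forall x, chi x != 0 -> A x).
Context (chi_sum : forall B s, totbounded d B -> A `<=` B -> uniq s ->
      (forall g, g \in s <-> return_set B g) ->
      forall w, B w -> \sum_(g <- s) chi (g w) = 1).

(* Mass transport: insert [1 = sum_g chi(g w)] and move each [g] to the other
   argument. *)
Lemma mass_transport h : lipb2 h -> G_invariant h ->
  (forall z w, r <= d z w -> h z w = 0) ->
  L (fun z => chi z * L (h z)) = L (fun w => chi w * L (h^~ w)).
Proof.
move=> hh hG hr.
have chi_b : lipb chi by case: chi_c.
(* B is large enough to contain both arguments wherever chi z * h z w is nonzero, so one finite list
   of returns serves for all points. *)
pose B := A `|` [set w | exists z, A z /\ d z w < r].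
have tB : totbounded d B by apply: totboundedU => //; exact: totbounded_nbhd.
have AB : A `<=` B by move=> x Ax; left.
have [s [us sE]] := return_seq tB.
have sum1 w : B w -> \sum_(g <- s) chi (g w) = 1.
  by move=> Bw; exact: (chi_sum tB AB us sE Bw).
pose iv (g : T -> T) : T -> T := xget (id : T -> T) [set h | [/\ G h, cancel g h & cancel h g]].
have ivP g : G g -> [/\ G (iv g), cancel g (iv g) & cancel (iv g) g].
  move=> Gg; have [k Pk] := G_inv Gg; rewrite /iv; case: xgetP => [y _ //|/(_ k)].
  by move=> nPk; case: (nPk Pk).
have iv_uniq g k : G g -> cancel g k -> iv g = k.
  move=> /ivP[_ _ ig] gk; apply/funext => x.
  by rewrite -{2}(ig x) gk.
have us' : uniq (map iv s).
  rewrite map_inj_in_uniq // => g k /sE[Gg _] /sE[Gk _] e.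
  have [_ _ ig] := ivP _ Gg; have [_ gk _] := ivP _ Gk.
  by apply/funext => x; rewrite -(ig (k x)) e gk.
(* Returning to B is symmetric under inversion, so the inverses of the list enumerate the same
   elements. *)
have sE' g : g \in map iv s <-> return_set B g.
  split=> [/mapP[k /sE[Gk [x [Bx Bkx]]] ->]|[Gg [x [Bx Bgx]]]].
    have [Gi ki ik] := ivP _ Gk; split=> //.
    by exists (k x); split=> //; rewrite ki.
  have [Gi gi ig] := ivP _ Gg; apply/mapP; exists (iv g).
    by apply/sE; split=> //; exists (g x); split=> //; rewrite gi.
  by rewrite (iv_uniq (iv g) g).
have sum1' w : B w -> \sum_(g <- s) chi (iv g w) = 1.
  by move=> Bw; rewrite -(chi_sum tB AB us' sE' Bw) big_map.
have suppA (f : T -> T -> R) : lipb2 f -> (forall z w, r <= d z w -> f z w = 0) ->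
    supp2 (fun z w => chi z * f z w).
  move=> hf fr; exists A, B; split=> // z w.
    by move=> nA; have [->|/A_chi] := eqVneq (chi z) 0; rewrite ?mul0r.
  move=> nB; have [->|/A_chi Az] := eqVneq (chi z) 0; first by rewrite mul0r.
  rewrite fr ?mulr0 // leNgt; apply/negP => zw; apply: nB; right.
  by exists z.
have l1 f : lipb2 f -> lipb2 (fun z w => chi z * f z w).
  by move=> hf; apply: lipb2M => //; exact: lipb2_fst.
have h2 : lipb2 (fun z w => h w z) by exact: lipb2_swap.
have hr2 z w : r <= d z w -> h w z = 0.
  by case: dP => _ dC _; rewrite dC; exact: hr.
have lg g : G g -> lipb (fun x => chi (g x)).
  by move=> /G_iso ig; exact: lipb_iso.
pose t g z w := chi z * (chi (g w) * h z w).
pose t' g z w := chi w * (chi (iv g z) * h z w).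
have ht g : G g -> lipb2 (t g).
  move=> Gg; apply: l1; apply: lipb2M => //; apply: lipb2_snd => //; exact: lg.
have st g : G g -> supp2 (t g).
  move=> Gg; apply: suppA; last by move=> z w /hr ->; rewrite mulr0.
  by apply: lipb2M => //; apply: lipb2_snd => //; exact: lg.
have ht' g : G g -> lipb2 (t' g).
  move=> Gg; apply: lipb2M => //; first exact: lipb2_snd.
  apply: lipb2M => //; apply: lipb2_fst => //; apply: lg.
  by case: (ivP _ Gg).
have st' g : G g -> supp2 (t' g).
  move=> Gg; have [Gi _ _] := ivP _ Gg.
  have -> : t' g = fun z w => (fun w z => chi w * (chi (iv g z) * h z w)) w z by [].
  apply: supp2_swap; apply: suppA.
    by apply: lipb2M => //; apply: lipb2_snd => //; exact: lg.
  by move=> z w zw; rewrite hr2 // mulr0.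
(* Replace w by the inverse of g applied to w, then z likewise: L is invariant in each variable and
   h under the simultaneous move. *)
have move_g g : G g -> L (fun z => L (t g z)) = L (fun z => L (t' g z)).
  move=> Gg; have [Gi gi ig] := ivP _ Gg; have iso_i := G_iso Gi.
  have c1 z : lipc (t g z) by apply: lipc2_r => //; [exact: ht|exact: st].
  transitivity (L (fun z => L (fun w => t g z (iv g w)))).
    by congr L; apply/funext => z; rewrite (haar_iso LP).
  have c2 : lipc (fun z => L (fun w => t g z (iv g w))).
    have -> : (fun z => L (fun w => t g z (iv g w))) = fun z => L (t g z).
      by apply/funext => z; rewrite (haar_iso LP).
    by apply: (lipc_haar_r dP r0_gt0 ball_tb LP); [exact: ht|exact: st].
  rewrite -(haar_iso LP iso_i c2); congr L; apply/funext => z; congr L.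
  by apply/funext => w; rewrite /t /t' ig hG //; ring.
have lsum (F : (T -> T) -> T -> T -> R) (s' : seq (T -> T)) :
    (forall g, g \in s' -> lipb2 (F g)) -> (forall g, g \in s' -> supp2 (F g)) ->
    L (fun z => L (fun w => \sum_(g <- s') F g z w)) =
    \sum_(g <- s') L (fun z => L (F g z)).
  move=> lF sF.
  (* [haar_sum] asks for regularity at every index, so the family is set to 0 off the list. *)
  pose F' g := if g \in s' then F g else fun _ _ => 0.
  have FE z w : \sum_(g <- s') F g z w = \sum_(g <- s') F' g z w.
    by rewrite !big_seq; apply: eq_bigr => g gs; rewrite /F' gs.
  have lF' g : lipb2 (F' g).
    rewrite /F'; case: ifP => [/lF //|_].
    by exists 0; split=> [z w|z w z' w']; rewrite ?subrr normr0 ?mul0r.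
  have sF' g : supp2 (F' g).
    rewrite /F'; case: ifP => [/sF //|_].
    by exists A, A.
  transitivity (\sum_(g <- s') L (fun z => L (F' g z))); last first.
    by rewrite !big_seq; apply: eq_bigr => g gs; rewrite /F' gs.
  rewrite -(haar_sum dP LP); last first.
    by move=> g; exact: (lipc_haar_r dP r0_gt0 ball_tb LP).
  congr L; apply/funext => z; rewrite -(haar_sum dP LP); last first.
    by move=> g; exact: lipc2_r.
  by congr L; apply/funext => w.
have lhs z : chi z * L (h z) = L (fun w => \sum_(g <- s) t g z w).
  have [cz|cz] := eqVneq (chi z) 0.
    rewrite cz mul0r.
    have -> : (fun w => \sum_(g <- s) t g z w) = (fun w => 0 * chi w).
      apply/funext => w; rewrite mul0r big1 // => g _.
      by rewrite /t cz mul0r.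
    by rewrite (haarZ LP) // mul0r.
  have hz : lipc (h z).
    split; first exact: lipb2_r.
    exists B => // w nB; apply: hr; rewrite leNgt; apply/negP => zw.
    by apply: nB; right; exists z; split=> //; exact: A_chi.
  rewrite -(haarZ LP) //; congr L; apply/funext => w.
  rewrite -mulr_sumr -mulr_suml.
  have [zw|zw] := ltP (d z w) r; last by rewrite hr // !mulr0.
  rewrite sum1 ?mul1r //; right; exists z; split=> //; exact: A_chi.
have rhs w : chi w * L (h^~ w) = L (fun z => \sum_(g <- s) t' g z w).
  have [cw|cw] := eqVneq (chi w) 0.
    rewrite cw mul0r.
    have -> : (fun z => \sum_(g <- s) t' g z w) = (fun w => 0 * chi w).
      apply/funext => z; rewrite mul0r big1 // => g _.
      by rewrite /t' cw mul0r.
    by rewrite (haarZ LP) // mul0r.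
  have hw : lipc (h^~ w).
    split; first exact: lipb2_l.
    exists B => // z nB; apply: hr2; rewrite leNgt; apply/negP => zw.
    by apply: nB; right; exists w; split=> //; exact: A_chi.
  rewrite -(haarZ LP) //; congr L; apply/funext => z.
  rewrite -mulr_sumr -mulr_suml.
  have [zw|zw] := ltP (d w z) r; last by rewrite hr2 // !mulr0.
  rewrite sum1' ?mul1r //; right; exists w; split=> //; exact: A_chi.
transitivity (L (fun z => L (fun w => \sum_(g <- s) t g z w))).
  by congr L; apply/funext => z; exact: lhs.
transitivity (L (fun w => L (fun z => \sum_(g <- s) t' g z w))); last first.
  by congr L; apply/funext => w; rewrite rhs.
have Gs g : g \in s -> G g by move=> /sE[].
rewrite lsum; [|by move=> g /Gs/ht|by move=> g /Gs/st].
rewrite (lsum (fun g w z => t' g z w)); last 2 first.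
- by move=> g /Gs/ht'/lipb2_swap.
- by move=> g /Gs/st'/supp2_swap.
rewrite !big_seq; apply: eq_bigr => g /Gs Gg; rewrite move_g //.
by apply: (haar_fubini dP r0_gt0 ball_tb LP); [exact: ht'|exact: st'].
Qed.

End GroupAverage.

(** * Invariant biharmonic functions *)

(** Exactly n steps, to match the n-th iterate of an averaging operator with kernel of radius r. *)
Fixpoint chain (R : realType) (T : Type) (d : T -> T -> R) (r : R) (n : nat)
    (x y : T) : Prop :=
  if n is m.+1 then exists2 z, d x z < r & chain d r m z y else x = y.

Section Biharmonic.
Context (R : realType) (T : choiceType) (d : T -> T -> R).
Context (dP : pseudometric d) (r0 : R) (r0_gt0 : 0 < r0).
Context (ball_tb : forall x, totbounded d [set y | d x y < r0]).
Context (homog : forall x y, exists g, isometry d g /\ g x = y).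
Context (L : (T -> R) -> R) (LP : haar d r0 L).
Context (r : R) (r_gt0 : 0 < r) (r_le : r + r <= r0).
Context (G : set (T -> T)) (G_iso : forall g, G g -> isometry d g).
Context (G_comp : forall g h, G g -> G h -> G (g \o h)).
Context (G_inv : forall g, G g -> exists h, [/\ G h, cancel g h & cancel h g]).
Context (G_locfin : forall A, totbounded d A -> finite_set (return_set G A)).
Context (D : set T) (D_tb : totbounded d D).
Context (D_cover : forall x, exists g, G g /\ D (g x)).
Context (chainP : forall x y, exists n, chain d r n x y).

Local Notation bump := (bump d).
Local Notation lipc := (lipc d).
Local Notation lipb := (lipb d).
Local Notation lipb2 := (lipb2 d).
Local Notation avg := (avg d L r).
Local Notation avg1 := (avg1 d L r).
Local Notation avg2 := (avg2 d L r).

Let avg_lipb2 v : lipb2 v -> lipb2 (avg2 v).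
Proof. exact: lipb2_avg2. Qed.

Lemma iter_avg2_lipb2 m v : lipb2 v -> lipb2 (iter m avg2 v).
Proof. by move=> hv; elim: m => //= m; exact: avg_lipb2. Qed.

Lemma avg2_inv v : lipb2 v -> G_invariant G v -> G_invariant G (avg2 v).
Proof.
move=> hv iv g Gg z w; rewrite /avg2 -(avg_iso dP ball_tb homog LP r_gt0 r_le w (G_iso Gg)).
  by congr (avg _ w); apply/funext => x; exact: iv.
exact: (lipb2_r dP).
Qed.

Lemma iter_avg2_inv m v : lipb2 v -> G_invariant G v -> G_invariant G (iter m avg2 v).
Proof.
move=> hv iv; elim: m => //= m IH; apply: avg2_inv => //.
exact: iter_avg2_lipb2.
Qed.

Lemma avg2_le u v : lipb2 u -> lipb2 v -> (forall z w, u z w <= v z w) ->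
  forall z w, avg2 u z w <= avg2 v z w.
Proof.
move=> hu hv uv z w; rewrite /avg2; apply: (avg_le dP ball_tb LP r_gt0 r_le) => //; exact: (lipb2_r dP).
Qed.

Lemma avg1_iter_comm m v z w : lipb2 v ->
  avg1 (iter m avg2 v) z w = iter m avg2 (avg1 v) z w.
Proof.
move=> hv; elim: m z w => //= m IH z w.
rewrite (avg_comm dP r0_gt0 ball_tb LP r_gt0 r_le); last exact: iter_avg2_lipb2.
by congr (avg2 _ z w); apply/funext => a; apply/funext => b.
Qed.

Lemma avg2B u v z w : lipb2 u -> lipb2 v ->
  avg2 (fun z w => u z w - v z w) z w = avg2 u z w - avg2 v z w.
Proof.
move=> hu hv; rewrite /avg2 (avgB dP ball_tb LP r_gt0 r_le) //; exact: (lipb2_r dP).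
Qed.

Lemma iter_avg2B m u v z w : lipb2 u -> lipb2 v ->
  iter m avg2 (fun z w => u z w - v z w) z w = iter m avg2 u z w - iter m avg2 v z w.
Proof.
move=> hu hv; elim: m z w => //= m IH z w.
rewrite -avg2B; try exact: iter_avg2_lipb2.
by congr (avg2 _ z w); apply/funext => a; apply/funext => b.
Qed.

(** A vanishing average of a nonnegative function forces zeros on a ball of radius r; each iterate
    undone moves the zero one step along the chain. *)
Lemma iter_avg2_zero m v z w : lipb2 v -> (forall z w, 0 <= v z w) ->
  iter m avg2 v z z = 0 -> chain d r m z w -> v z w = 0.
Proof.
move=> hv v0.
have p0 k x y : 0 <= iter k avg2 v x y.
  elim: k x y => //= k IH x y.
  rewrite -[leLHS](avg_cst dP ball_tb LP r_gt0 r_le 0 y) /avg2.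
  apply: (avg_le dP ball_tb LP r_gt0 r_le) => //.
    exact: lipb_cst.
  by apply: (lipb2_r dP); exact: iter_avg2_lipb2.
suff H y : iter m avg2 v z y = 0 -> chain d r m y w -> v z w = 0 by exact: H.
elim: m y => [|m IH] y /=; first by move=> h <-.
move=> h [x yx xw]; apply: (IH x) => //.
apply: (avg_eq0 dP r0_gt0 ball_tb LP r_gt0 r_le _ _ h) => //.
by apply: (lipb2_r dP); exact: iter_avg2_lipb2.
Qed.

Section Function.
Context (u : T -> T -> R) (hu : lipb2 u) (u_inv : G_invariant G u).
Context (u1 : forall z w, avg1 u z w = u z w) (u2 : forall z w, avg2 u z w = u z w).

Let sq z w := u z w * u z w.
Let q z w := avg1 sq z w - sq z w.

Let sq_l : lipb2 sq.
Proof. exact: lipb2M. Qed.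

Let asq_l : lipb2 (avg1 sq).
Proof. exact: lipb2_avg1. Qed.

Let q_l : lipb2 q.
Proof. exact: lipb2B. Qed.

Let sq_inv : G_invariant G sq.
Proof. by move=> g Gg z w; rewrite /sq u_inv. Qed.

Let q_inv : G_invariant G q.
Proof.
move=> g Gg z w; rewrite /q sq_inv //; congr (_ - _).
rewrite /avg1 -(avg_iso dP ball_tb homog LP r_gt0 r_le z (G_iso Gg)).
  by congr (avg _ z); apply/funext => x; exact: sq_inv.
exact: (lipb2_l dP).
Qed.

Let dev z0 z w := (u z w - u z0 w) * (u z w - u z0 w).

Let dev_l z0 : lipb2 (dev z0).
Proof.
have h : lipb2 (fun z w => u z w - u z0 w).
  apply: lipb2B => //; apply: lipb2_snd => //; exact: (lipb2_r dP).
exact: lipb2M.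
Qed.

(** The variance formula, valid as u is its own average: q is the mean squared deviation from u z w.
    Nonnegativity and subharmonicity of q are read off from this form. *)
Let qE z w : q z w = avg1 (dev z) z w.
Proof.
have hl : lipb (u^~ w) by exact: (lipb2_l dP).
have hs : lipb (sq^~ w) by exact: (lipb2_l dP).
have h2 : lipb (fun x => (2 * u z w) * u x w) by exact: lipbZ.
rewrite /avg1 /dev.
have -> : avg (fun x => (u x w - u z w) * (u x w - u z w)) z =
    avg (fun x => (sq x w - (2 * u z w) * u x w) + u z w * u z w) z.
  by congr (avg _ z); apply/funext => x; rewrite /sq; ring.
rewrite (avgD dP ball_tb LP r_gt0 r_le); [|exact: lipbB|exact: lipb_cst].
rewrite (avgB dP ball_tb LP r_gt0 r_le) // (avgZ dP ball_tb LP r_gt0 r_le) //.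
rewrite (avg_cst dP ball_tb LP r_gt0 r_le).
have := u1 z w; rewrite /avg1 => ->.
by rewrite /q /avg1 /sq; ring.
Qed.

Let q_ge0 z w : 0 <= q z w.
Proof.
rewrite qE -(avg_cst dP ball_tb LP r_gt0 r_le 0 z).
apply: (avg_le dP ball_tb LP r_gt0 r_le).
- exact: lipb_cst.
- exact: (lipb2_l dP).
- by move=> x; rewrite /dev -expr2 sqr_ge0.
Qed.

(* Jensen's inequality for the harmonic function [u z - u z0]. *)
Let dev_sub z0 z w : dev z0 z w <= avg2 (dev z0) z w.
Proof.
pose f x := u z x - u z0 x.
have hf : lipb f by apply: lipbB => //; exact: (lipb2_r dP).
have ff : avg f w = f w.
  rewrite /f (avgB dP ball_tb LP r_gt0 r_le); try exact: (lipb2_r dP).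
  by have := u2 z w; have := u2 z0 w; rewrite /avg2 => -> ->.
have hff : lipb (fun x => f x * f x) by exact: lipbM.
have : 0 <= avg (fun x => (f x - f w) * (f x - f w)) w.
  rewrite -[leLHS](avg_cst dP ball_tb LP r_gt0 r_le 0 w).
  apply: (avg_le dP ball_tb LP r_gt0 r_le).
  - exact: lipb_cst.
  - by apply: lipbM => //; apply: lipbB => //; exact: lipb_cst.
  - by move=> x; rewrite -expr2 sqr_ge0.
have -> : avg (fun x => (f x - f w) * (f x - f w)) w =
    avg (fun x => (f x * f x - (2 * f w) * f x) + f w * f w) w.
  by congr (avg _ w); apply/funext => x; ring.
have h2 : lipb (fun x => (2 * f w) * f x) by exact: lipbZ.
rewrite (avgD dP ball_tb LP r_gt0 r_le); [|exact: lipbB|exact: lipb_cst].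
rewrite (avgB dP ball_tb LP r_gt0 r_le) // (avgZ dP ball_tb LP r_gt0 r_le) //.
rewrite (avg_cst dP ball_tb LP r_gt0 r_le) ff /avg2 /dev -/(f w).
rewrite -/(f w).
by move: (avg _ w) => X; lra.
Qed.

(** For a fixed reference point z the deviations are subharmonic in w, and averaging in the first
    variable commutes with averaging in the second. *)
Let q_sub z w : q z w <= avg2 q z w.
Proof.
rewrite qE.
apply: (@le_trans _ _ (avg1 (avg2 (dev z)) z w)).
  rewrite /avg1.
  apply: (avg_le dP ball_tb LP r_gt0 r_le).
  - exact: (lipb2_l dP).
  - by apply: (lipb2_l dP); exact: avg_lipb2.
  - by move=> x; exact: dev_sub.
rewrite (avg_comm dP r0_gt0 ball_tb LP r_gt0 r_le) //.
rewrite le_eqVlt; apply/orP; left; apply/eqP; rewrite /avg2.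
by congr (avg _ w); apply/funext => x; rewrite qE.
Qed.

Let iter_q_mono m n z w : (m <= n)%N -> iter m avg2 q z w <= iter n avg2 q z w.
Proof.
move=> mn; rewrite -(subnK mn) addnC; elim: (n - m)%N => [|k IH]; first by rewrite addn0.
apply: le_trans IH _; rewrite addnS.
elim: (m + k)%N z w => [|j IH] z w /=; first exact: q_sub.
apply: avg2_le => //; [exact: iter_avg2_lipb2|exact: (@iter_avg2_lipb2 j.+1)].
Qed.

Lemma biharmonic_fst z z' w : u z w = u z' w.
Proof.
have [chi [chi_c chi_ge0 chi_gt0 [A [A_tb A_chi chi_sum]]]] :=
  partition_exists dP r0_gt0 ball_tb G_iso G_comp G_inv G_locfin D_tb D_cover.
pose tau v := L (fun z => chi z * v z z).
have diag_l v : lipb2 v -> lipb (fun z => v z z).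
  move=> [C [b l]]; exists (C + C); split=> [x|x y].
    have := b x x; have : 0 <= C by exact: le_trans (b x x).
    lra.
  by apply: le_trans (l _ _ _ _) _; rewrite mulrDr mulrDl.
have tau_c v : lipb2 v -> lipc (fun z => chi z * v z z).
  by move=> hv; apply: lipcMr => //; exact: diag_l.
have tauB v v' : lipb2 v -> lipb2 v' ->
    tau (fun z w => v z w - v' z w) = tau v - tau v'.
  move=> hv hv'; rewrite /tau -(haarB dP LP); try exact: tau_c.
  by congr L; apply/funext => x; rewrite mulrBr.
have tau_le v v' : lipb2 v -> lipb2 v' -> (forall z w, v z w <= v' z w) ->
    tau v <= tau v'.
  move=> hv hv' vv; apply: (haar_le dP LP); try exact: tau_c.
  by move=> x; rewrite ler_wpM2l.
have transport v : lipb2 v -> G_invariant G v -> tau (avg1 v) = tau (avg2 v).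
  (* With this transposition, integrating h over its second argument yields the first-variable
     average of v on the diagonal, and over its first argument the second-variable average. *)
  move=> hv iv; pose h x y := bump r x y * v y x.
  have hh : lipb2 h.
    by apply: lipb2M => //; [exact: lipb2_bump|exact: lipb2_swap].
  have ih : G_invariant G h.
    by move=> g Gg x y; rewrite /h iv // bump_iso //; exact: G_iso.
  have h0 x y : r <= d x y -> h x y = 0 by move=> /bump_far; rewrite /h => ->; rewrite mul0r.
  have := mass_transport dP r0_gt0 ball_tb LP r_gt0 r_le G_iso G_inv G_locfin
    chi_c A_tb A_chi chi_sum hh ih h0.
  pose c := L (bump r z).
  have cE x : L (bump r x) = c.
    by apply: (haar_bump_cst dP ball_tb homog LP); apply: le_trans r_le; rewrite lerDl ltW.
  have cL f : (forall x, lipb (f x)) -> lipc (fun x => chi x * avg (f x) x) ->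
    L (fun x => chi x * avg (f x) x) = c^-1 * L (fun x => chi x * L (fun y => bump r x y * f x y)).
    move=> hf hc.
    have c0 : c != 0 by rewrite gt_eqF // /c (haar_r_gt0 LP r_gt0 r_le).
    apply: (@mulfI _ c) => //; rewrite mulrA divff // mul1r -(haarZ LP) //.
    congr L; apply/funext => x; rewrite mulrCA /avg cE; congr (_ * _).
    by rewrite mulrA divff // mul1r.
  move=> e; rewrite /tau /avg1 /avg2.
  rewrite (cL (fun x => v^~ x)); [|by move=> x; exact: (lipb2_l dP)|]; last first.
    by apply: (tau_c (avg1 v)); exact: lipb2_avg1.
  rewrite (cL v); [|by move=> x; exact: (lipb2_r dP)|]; last first.
    by apply: (tau_c (avg2 v)); exact: avg_lipb2.
  rewrite e; congr (_ * L _); apply/funext => x; congr (_ * L _).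
  by apply/funext => y; rewrite /h bumpC.
(* With v the m-th average of sq, commutation writes the m-th average of q as avg1 v - v, and
   transport replaces [avg1] by [avg2]. *)
have e_step m : tau (iter m avg2 q) = tau (iter m.+1 avg2 sq) - tau (iter m avg2 sq).
  have -> : iter m avg2 q = fun z w => avg1 (iter m avg2 sq) z w - iter m avg2 sq z w.
    apply/funext => x; apply/funext => y; rewrite avg1_iter_comm //.
    exact: iter_avg2B.
  rewrite tauB; [|apply: lipb2_avg1 => //; exact: iter_avg2_lipb2|exact: iter_avg2_lipb2].
  by rewrite transport //; [exact: iter_avg2_lipb2|exact: iter_avg2_inv].
have e_ge0 m : 0 <= tau (iter m avg2 q).
  apply: (haar_ge0 LP); first by apply: tau_c; exact: iter_avg2_lipb2.
  move=> x; rewrite mulr_ge0 //; apply: le_trans (q_ge0 x x) _.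
  exact: (@iter_q_mono 0%N).
have [C [sqC _]] := sq_l.
have sq_bd m x y : `|iter m avg2 sq x y| <= C.
  elim: m x y => //= m IH x y.
  apply: (avg_norm dP ball_tb LP r_gt0 r_le) => //.
  by apply: (lipb2_r dP); exact: iter_avg2_lipb2.
have e0 j : tau (iter j avg2 q) = 0.
  apply/eqP; rewrite eq_le e_ge0 andbT leNgt; apply/negP => ej.
  (* The increments from index j on are at least the j-th one, so a positive one would force linear
     growth, against the bound K. *)
  have grow N : N%:R * tau (iter j avg2 q) + tau (iter j avg2 sq) <= tau (iter (j + N) avg2 sq).
    elim: N => [|N IH]; first by rewrite mul0r add0r addn0.
    rewrite addnS; have := e_step (j + N)%N.
    have : tau (iter j avg2 q) <= tau (iter (j + N) avg2 q).
      apply: tau_le; try exact: iter_avg2_lipb2.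
      by move=> x y; apply: iter_q_mono; rewrite leq_addr.
    by rewrite -natr1 mulrDl mul1r; lra.
  pose K := tau (fun _ _ => C).
  have hC : lipb2 (fun _ _ => C).
    by apply: lipb2_snd => //; exact: lipb_cst.
  have up N : tau (iter (j + N) avg2 sq) <= K.
    apply: tau_le => //; first exact: iter_avg2_lipb2.
    by move=> x y; apply: le_trans (ler_norm _) _.
  pose N := Num.bound (`|K - tau (iter j avg2 sq)| / tau (iter j avg2 q)).
  have := le_trans (grow N) (up N); apply/negP; rewrite -ltNge.
  rewrite -ltrBlDr; apply: le_lt_trans (ler_norm _) _.
  rewrite -ltr_pdivrMr // archi_boundP // divr_ge0 // ltW //.
(* Vanishing of tau gives zeros only where chi is positive; every orbit meets that set, and
   invariance does the rest. *)
have q0 j x : iter j avg2 q x x = 0.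
  have hj : lipb2 (iter j avg2 q) by exact: iter_avg2_lipb2.
  have [g [Gg cg]] := chi_gt0 x.
  have ij : G_invariant G (iter j avg2 q) by exact: iter_avg2_inv.
  rewrite -(ij g Gg).
  have := haar_faithful dP r0_gt0 ball_tb LP (tau_c _ hj) _ (e0 j) (g x).
  move=> /(_ _)/eqP; rewrite mulf_eq0 (gt_eqF cg) /= => H; apply/eqP/H => y.
  rewrite mulr_ge0 //; apply: le_trans (q_ge0 y y) _.
  exact: (@iter_q_mono 0%N).
have qz x y : q x y = 0.
  have [n xy] := chainP x y.
  exact: (iter_avg2_zero q_l q_ge0 (q0 n x) xy).
have step x y : d x y < r -> u x w = u y w.
  move=> xy; have := qz x w; rewrite qE /avg1 => h.
  have hl : lipb ((dev x)^~ w) by exact: (lipb2_l dP).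
  have h0 t : 0 <= dev x t w by rewrite /dev -expr2 sqr_ge0.
  have /eqP := avg_eq0 dP r0_gt0 ball_tb LP r_gt0 r_le hl h0 h xy.
  by rewrite /dev mulf_eq0 orbb subr_eq0 => /eqP ->.
have [n] := chainP z z'; elim: n z => [|n IH] x /=; first by move=> ->.
by move=> [y xy] /IH <-; exact: step.
Qed.

End Function.

Lemma biharmonic_cst u : lipb2 u -> G_invariant G u ->
  (forall z w, avg (u^~ w) z = u z w) -> (forall z w, avg (u z) w = u z w) ->
  forall z w z' w', u z w = u z' w'.
Proof.
move=> hu iu u1 u2 z w z' w'.
rewrite (biharmonic_fst hu iu u1 u2 z z' w).
have iu' : G_invariant G (fun z w => u w z) by move=> g Gg x y; exact: iu.
exact: (biharmonic_fst (lipb2_swap hu) iu' (fun x y => u2 y x) (fun x y => u1 y x)).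
Qed.

End Biharmonic.

(** * Discreteness *)

Section LocallyFinite.
Context (R : realType) (T : choiceType) (d : T -> T -> R).
Context (dP : pseudometric d) (r0 : R).
Context (ball_tb : forall x, totbounded d [set y | d x y < r0]).
Context (r : R) (r_gt0 : 0 < r) (r_le : r + r <= r0).
Context (chainP : forall x y, exists n, chain d r n x y).
Context (G : set (T -> T)) (G_iso : forall g, G g -> isometry d g).
Context (G_comp : forall g h, G g -> G h -> G (g \o h)).
Context (G_inv : forall g, G g -> exists h, [/\ G h, cancel g h & cancel h g]).
Context (K : set T) (K_tb : totbounded d K) (eta : R) (eta_gt0 : 0 < eta).
Context (G_discrete : forall g, G g -> (forall x, K x -> d (g x) x < eta) -> g = id).

(** Take an e / 2-net, drop the balls that miss A and recentre the others at a point of A, which at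
    most doubles the radius. *)
Lemma totbounded_in A e : 0 < e -> totbounded d A -> exists s : seq T,
  (forall y, y \in s -> A y) /\ forall x, A x -> exists2 y, y \in s & d y x < e.
Proof.
move=> e0 tA; have [_ dC dT] := dP.
have e2 : 0 < e / 2 by rewrite divr_gt0.
have [s hs] := tA _ e2.
suff [s' [s'A h]] : exists s' : seq T, (forall y, y \in s' -> A y) /\
    forall x, A x -> (exists2 y, y \in s & d y x < e / 2) ->
    exists2 y, y \in s' & d y x < e.
  by exists s'; split=> // x Ax; apply: h => //; exact: hs.
elim: s {hs} => [|y s [s' [s'A h]]]; first by exists [::]; split=> // x _ [].
have [[z [Az yz]]|no] := pselect (exists z, A z /\ d y z < e / 2).
  exists (z :: s'); split.
    by move=> w; rewrite in_cons => /orP[/eqP -> //|/s'A].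
  move=> x Ax [w]; rewrite in_cons => /orP[/eqP ->|ws] wx.
    exists z; first by rewrite mem_head.
    by apply: le_lt_trans (dT z y x) _; rewrite (dC z y); lra.
  have [v vs vx] : exists2 v, v \in s' & d v x < e by apply: h => //; exists w.
  by exists v => //; rewrite in_cons vs orbT.
exists s'; split=> // x Ax [w]; rewrite in_cons => /orP[/eqP ->|ws] wx.
  by exfalso; apply: no; exists x.
by apply: h => //; exists w.
Qed.

Lemma chain_cat m n x y z : chain d r m x y -> chain d r n y z ->
  chain d r (m + n) x z.
Proof.
elim: m x => [|m IH] x /=; first by move=> ->.
by move=> [w xw wy] yz; exists w => //; exact: IH.
Qed.

Lemma chain_mono m n x y : (m <= n)%N -> chain d r m x y -> chain d r n x y.
Proof.
move=> mn xy; rewrite -(subnK mn) addnC; apply: chain_cat xy _.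
elim: (n - m)%N => //= k IH; exists y => //.
by case: dP => -> _ _.
Qed.

Lemma chain_iso g n x y : isometry d g -> chain d r n x y -> chain d r n (g x) (g y).
Proof.
move=> [_ ig]; elim: n x => [|n IH] x /=; first by move=> ->.
by move=> [z xz /IH zy]; exists (g z) => //; rewrite ig.
Qed.

(** Nets reduce the claim to finitely many pairs of centres, with one step more at each end; chains
    may be lengthened by repeating a point. *)
Lemma chain_uniform A B : totbounded d A -> totbounded d B ->
  exists N, forall x y, A x -> B y -> chain d r N x y.
Proof.
have [_ dC _] := dP.
move=> /(_ r r_gt0)[s hs] /(_ r r_gt0)[t ht].
have [N hN] : exists N, forall a b, a \in s -> b \in t -> chain d r N a b.
  elim: s {hs} => [|a s [N IH]]; first by exists 0%N => a b; rewrite in_nil.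
  have [M hM] : exists M, forall b, b \in t -> chain d r M a b.
    elim: t {ht IH} => [|b t [M hM]]; first by exists 0%N => b; rewrite in_nil.
    have [k ab] := chainP a b; exists (maxn M k) => c.
    rewrite in_cons => /orP[/eqP ->|/hM ac].
      exact: (chain_mono (leq_maxr M k)).
    exact: (chain_mono (leq_maxl M k)).
  exists (maxn M N) => c b; rewrite in_cons => /orP[/eqP -> /hM ab|cs bt].
    exact: (chain_mono (leq_maxl M N)).
  by apply: (chain_mono (leq_maxr M N)); exact: IH.
exists (1 + (N + 1))%N => x y /hs[a sa ax] /ht[b tb bY].
apply: (@chain_cat 1 _ x a); first by exists a; rewrite // dC.
apply: (@chain_cat N 1 a b); first exact: hN.
by exists y.
Qed.

Lemma totbounded_chain n A : totbounded d A ->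
  totbounded d [set w | exists z, A z /\ chain d r n z w].
Proof.
elim: n A => [|n IH] A tA.
  by apply: totboundedS tA => w [z [Az <-]].
apply: totboundedS (IH _ (totbounded_nbhd dP ball_tb r_gt0 r_le tA)).
by move=> w [z [Az [y zy yw]]]; exists y; split=> //; exists z.
Qed.

(** A pigeonhole argument: the elements of S are told apart by the cells in which they put the
    finitely many points of t, and there are finitely many cells. *)
Lemma finite_cells (S : set (T -> T)) (t p : seq T) (e : R) :
  (forall g x, S g -> x \in t -> exists2 y, y \in p & d y (g x) < e) ->
  (forall g h, S g -> S h -> (forall x, x \in t -> exists y, d y (g x) < e /\ d y (h x) < e) -> g = h) ->
  finite_set S.
Proof.
elim: t S => [|x t IH] S hS hinj.
  have [[g Sg]|noS] := pselect (S !=set0).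
    apply: (@sub_finite_set _ _ [set g]); last exact: finite_set1.
    by move=> h Sh /=; apply: hinj => // y; rewrite in_nil.
  by have -> : S = set0 by apply/seteqP; split=> // g Sg; apply: noS; exists g.
apply: (@sub_finite_set _ _ (\bigcup_(y in [set` p]) [set g | S g /\ d y (g x) < e])).
  move=> g Sg; have [y yp yg] := hS g x Sg (mem_head _ _).
  by exists y.
apply: bigcup_finite; first exact: finite_seq.
move=> y _; apply: IH => [g z [Sg _] zt|g h [Sg gx] [Sh hx] agree].
  by apply: hS => //; rewrite in_cons zt orbT.
apply: hinj => // z; rewrite in_cons => /orP[/eqP ->|/agree //].
by exists y.
Qed.

(** Isometries returning A to itself move K by boundedly many steps away from A, hence into one
    totally bounded set. Two of them with the same cells on a net of K differ by an element that
    barely moves K, which is the identity. *)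
Lemma locally_finite A : totbounded d A -> finite_set (return_set G A).
Proof.
have [_ dC dT] := dP.
move=> tA; have [N hN] := chain_uniform tA K_tb.
have tB := totbounded_chain N tA.
(* The path from g x to h x goes through g y, the cell centre q and h y: four pieces shorter than
   eta / 4. *)
have e0 : 0 < eta / 4 by rewrite divr_gt0.
have [t [tK ht]] := totbounded_in e0 K_tb.
have [p hp] := tB _ e0.
apply: (@finite_cells _ t p (eta / 4)).
  move=> g x [Gg [y [Ay Agy]]] /tK Kx; apply: hp; exists (g y); split=> //.
  by apply: chain_iso; [exact: G_iso|exact: hN].
move=> g h [Gg _] [Gh _] agree.
have [k [Gk hk kh]] := G_inv Gh.
have kg : k \o g = id.
  apply: G_discrete; first exact: G_comp.
  move=> x /ht[y yt yx] /=; have [_ ih] := G_iso Gh; have [_ ig] := G_iso Gg.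
  rewrite -ih kh.
  have [q [qg qh]] := agree _ yt.
  have := dT (g x) (g y) (h x); have := dT (g y) q (h x); have := dT q (h y) (h x).
  rewrite (ig x y) (ih y x) (dC (g y) q) (dC x y).
  lra.
by apply/funext => x; rewrite -(kh (g x)) -[k (g x)]/((k \o g) x) kg.
Qed.

End LocallyFinite.

(** * The mean value property on a circle *)

Section SegmentIntegral.
Context (R : realType).
Implicit Types (f g : R -> R) (a b c e : R).

Definition contin f a b := forall x : R, a <= x <= b -> forall e : R, 0 < e ->
  exists2 del : R, 0 < del &
    forall y : R, a <= y <= b -> `|y - x| < del -> `|f y - f x| <= e.

Definition itg f a b : R := \int[@lebesgue_measure R]_(x in `[a, b]) f x.

Lemma contin_within f a b : contin f a b -> {within `[a, b], continuous (f : R -> R^o)}.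
Proof.
move=> cf; apply/subspace_continuousP => x /=; rewrite in_itv /= => xab.
apply/cvgrPdist_le => e e0; have [del del0 h] := cf x xab e e0.
rewrite near_withinE; near=> y => yab; rewrite distrC; apply: h.
  by move: yab; rewrite /= in_itv.
rewrite distrC; near: y; exact: (nbhsx_ballx x del).
Unshelve. all: by end_near. Qed.

Lemma contin_integrable f a b : contin f a b ->
  (@lebesgue_measure R).-integrable `[a, b] (EFin \o f).
Proof.
move=> /contin_within cf; apply: continuous_compact_integrable => //.
exact: segment_compact.
Qed.

Lemma contin_sub f a b a' b' : a <= a' -> b' <= b -> contin f a b -> contin f a' b'.
Proof.
move=> aa bb cf x /andP[ax xb] e e0.
have [|del del0 h] := cf x _ e e0.
  by rewrite (le_trans aa ax) (le_trans xb bb).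
exists del => // y /andP[ay yb]; apply: h.
by rewrite (le_trans aa ay) (le_trans yb bb).
Qed.

Lemma itg_split f a b c : contin f a c -> a <= b -> b <= c ->
  itg f a b + itg f b c = itg f a c.
Proof.
move=> cf ab bc; have i1 := contin_integrable cf.
have i2 : (@lebesgue_measure R).-integrable `]b, c] (EFin \o f).
  by apply: integrableS i1 => //; apply: subset_itvr; rewrite bnd_simp.
rewrite /itg -[X in _ + X](Rintegral_itv_obnd_cbnd i2).
by rewrite -(Rintegral_itvB i1) ?bnd_simp //; lra.
Qed.

Lemma itgB f g a b : contin f a b -> contin g a b ->
  itg (fun x => f x - g x) a b = itg f a b - itg g a b.
Proof. by move=> cf cg; apply: RintegralB => //; exact: contin_integrable. Qed.

Lemma itg_cst c a b : a <= b -> itg (fun=> c) a b = c * (b - a).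
Proof.
move=> ab; rewrite /itg Rintegral_cst //= lebesgue_measure_itv /= lte_fin.
case: ltP => h /=; first by [].
have -> : b = a by apply/le_anti; rewrite ab h.
by rewrite subrr.
Qed.

Lemma contin_cst c a b : contin (fun=> c) a b.
Proof. by move=> x _ e e0; exists 1 => // y _ _; rewrite subrr normr0 ltW. Qed.

Lemma continB f g a b : contin f a b -> contin g a b -> contin (fun x => f x - g x) a b.
Proof.
move=> cf cg x xab e e0; have e2 : 0 < e / 2 by lra.
have [d1 d10 h1] := cf x xab _ e2; have [d2 d20 h2] := cg x xab _ e2.
exists (Num.min d1 d2); first by rewrite lt_min d10.
move=> y yab; rewrite lt_min => /andP[y1 y2].
have := h1 y yab y1; have := h2 y yab y2; rewrite !ler_norml => /andP[? ?] /andP[? ?].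
by apply/andP; split; lra.
Qed.

Lemma itg_le f g a b : contin f a b -> contin g a b ->
  (forall x, a <= x <= b -> f x <= g x) -> itg f a b <= itg g a b.
Proof.
move=> cf cg fg; apply: le_Rintegral => //; try exact: contin_integrable.
Qed.

Lemma itg_near f a b c e : a <= b -> contin f a b ->
  (forall x, a <= x <= b -> `|f x - c| <= e) -> `|itg f a b - c * (b - a)| <= e * (b - a).
Proof.
move=> ab cf h; have c1 : contin (fun=> c + e) a b by exact: contin_cst.
have c2 : contin (fun=> c - e) a b by exact: contin_cst.
have h1 : itg f a b <= (c + e) * (b - a).
  by rewrite -itg_cst //; apply: itg_le => // x /h; rewrite ler_norml => /andP[]; lra.
have h2 : (c - e) * (b - a) <= itg f a b.
  by rewrite -itg_cst //; apply: itg_le => // x /h; rewrite ler_norml => /andP[]; lra.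
by rewrite ler_norml; apply/andP; split; lra.
Qed.

End SegmentIntegral.

(** * Goursat's theorem for closed 1-forms on a rectangle *)

Section Goursat.
Context (R : realType).

(* The 1-form [P ds + Q dt] has the symmetric Jacobian matrix ((a, b), (b, c)). *)
Definition closed_form (P Q : R -> R -> R) (s1 s2 t1 t2 : R) :=
  forall s t : R, s1 <= s <= s2 -> t1 <= t <= t2 -> exists a b c : R,
  forall e : R, 0 < e -> exists2 del : R, 0 < del & forall s' t' : R,
    s1 <= s' <= s2 -> t1 <= t' <= t2 -> `|s' - s| < del -> `|t' - t| < del ->
    `|P s' t' - P s t - (a * (s' - s) + b * (t' - t))| <= e * (`|s' - s| + `|t' - t|) /\
    `|Q s' t' - Q s t - (b * (s' - s) + c * (t' - t))| <= e * (`|s' - s| + `|t' - t|).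

(** The integral of P ds + Q dt along the boundary, counterclockwise: bottom minus top, then right
    minus left. *)
Definition circ (P Q : R -> R -> R) (s1 s2 t1 t2 : R) : R :=
  itg (P^~ t1) s1 s2 - itg (P^~ t2) s1 s2 + (itg (Q s2) t1 t2 - itg (Q s1) t1 t2).

Lemma closed_form_sub P Q s1 s2 t1 t2 s1' s2' t1' t2' :
  s1 <= s1' -> s2' <= s2 -> t1 <= t1' -> t2' <= t2 ->
  closed_form P Q s1 s2 t1 t2 -> closed_form P Q s1' s2' t1' t2'.
Proof.
move=> a1 a2 b1 b2 h.
have cs x : s1' <= x <= s2' -> s1 <= x <= s2.
  by move=> /andP[u v]; rewrite (le_trans a1 u) (le_trans v a2).
have ct x : t1' <= x <= t2' -> t1 <= x <= t2.
  by move=> /andP[u v]; rewrite (le_trans b1 u) (le_trans v b2).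
move=> s t /cs hs /ct ht; have [a [b [c H]]] := h s t hs ht.
exists a, b, c => e e0; have [del del0 k] := H e e0; exists del => // s' t' /cs ? /ct ?.
exact: k.
Qed.

Lemma closed_form_contin P Q s1 s2 t1 t2 : closed_form P Q s1 s2 t1 t2 ->
  (forall t, t1 <= t <= t2 -> contin (P^~ t) s1 s2) /\
  (forall s, s1 <= s <= s2 -> contin (Q s) t1 t2).
Proof.
move=> h.
have bound (X l del e : R) : 0 < e -> `|X| < Num.min del (e / (`|l| + 1)) ->
    forall Y : R, `|Y - l * X| <= 1 * `|X| -> `|Y| <= e.
  move=> e0; rewrite lt_min => /andP[_ hX] Y hY.
  have l1 : 0 < `|l| + 1 by rewrite ltr_wpDl.
  have -> : Y = (Y - l * X) + l * X by ring.
  apply: le_trans (ler_normD _ _) _; rewrite normrM.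
  apply: (@le_trans _ _ ((`|l| + 1) * `|X|)); first by lra.
  by rewrite mulrC -ler_pdivlMr // ltW.
split=> [t ht s hs|s hs t ht] e e0; have [a [b [c H]]] := h s t hs ht;
  have [del del0 k] := H 1 ltr01.
  exists (Num.min del (e / (`|a| + 1))).
    by rewrite lt_min del0 divr_gt0 // ltr_wpDl.
  move=> s' hs' ss; have sd : `|s' - s| < del by move: ss; rewrite lt_min => /andP[].
  have [|k1 _] := k s' t hs' ht sd; first by rewrite subrr normr0.
  apply: (bound _ _ _ _ e0 ss).
  by move: k1; rewrite subrr normr0 mulr0 !addr0.
exists (Num.min del (e / (`|c| + 1))).
  by rewrite lt_min del0 divr_gt0 // ltr_wpDl.
move=> t' ht' tt; have td : `|t' - t| < del by move: tt; rewrite lt_min => /andP[].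
have [|_ k2] := k s t' hs ht' _ td; first by rewrite subrr normr0.
apply: (bound _ _ _ _ e0 tt).
by move: k2; rewrite subrr normr0 mulr0 !add0r.
Qed.

Lemma circ_split P Q s1 s2 t1 t2 s t : closed_form P Q s1 s2 t1 t2 ->
  s1 <= s <= s2 -> t1 <= t <= t2 ->
  circ P Q s1 s2 t1 t2 = circ P Q s1 s t1 t + circ P Q s1 s t t2 +
    (circ P Q s s2 t1 t + circ P Q s s2 t t2).
Proof.
move=> /closed_form_contin[cP cQ] hs ht; have /andP[a1 a2] := hs; have /andP[b1 b2] := ht.
have s12 := le_trans a1 a2; have t12 := le_trans b1 b2.
rewrite /circ -(itg_split (cP t1 _) a1 a2) ?lexx // -(itg_split (cP t2 _) a1 a2) ?lexx ?andbT //.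
rewrite -(itg_split (cQ s1 _) b1 b2) ?lexx // -(itg_split (cQ s2 _) b1 b2) ?lexx ?andbT //.
ring.
Qed.

(** Only the off-diagonal entries of the Jacobian survive in the differences of opposite sides, and
    by symmetry these two contributions cancel; the error of the linear approximation remains. *)
Lemma circ_local P Q s1 s2 t1 t2 (s t : R) (e : R) : closed_form P Q s1 s2 t1 t2 ->
  s1 <= s <= s2 -> t1 <= t <= t2 -> 0 < e -> exists2 del : R, 0 < del &
  forall s1' s2' t1' t2' : R, s1 <= s1' -> s2' <= s2 -> t1 <= t1' -> t2' <= t2 ->
    s1' <= s <= s2' -> t1' <= t <= t2' -> s2' - s1' < del -> t2' - t1' < del ->
    `|circ P Q s1' s2' t1' t2'| <= e * ((s2' - s1') + (t2' - t1')) ^+ 2.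
Proof.
move=> cf hs ht e0; have [a [b [c H]]] := cf s t hs ht.
(* Halved because each integrand is a difference of two approximated values. *)
have e2 : 0 < e / 2 by lra.
have [del del0 k] := H _ e2; exists del => // x1 x2 y1 y2 l1 l2 l3 l4 /andP[sx1 sx2] /andP[ty1 ty2] wx wy.
have [cP cQ] := closed_form_contin (closed_form_sub l1 l2 l3 l4 cf).
have x12 := le_trans sx1 sx2; have y12 := le_trans ty1 ty2.
have near x y : x1 <= x <= x2 -> y1 <= y <= y2 ->
    `|P x y - P s t - (a * (x - s) + b * (y - t))| <= e / 2 * ((x2 - x1) + (y2 - y1)) /\
    `|Q x y - Q s t - (b * (x - s) + c * (y - t))| <= e / 2 * ((x2 - x1) + (y2 - y1)).
  move=> /andP[u1 u2] /andP[v1 v2].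
  have xs : `|x - s| <= x2 - x1 by rewrite ler_norml; apply/andP; split; lra.
  have yt : `|y - t| <= y2 - y1 by rewrite ler_norml; apply/andP; split; lra.
  have [||||k1 k2] := k x y.
  - by rewrite (le_trans l1 u1) (le_trans u2 l2).
  - by rewrite (le_trans l3 v1) (le_trans v2 l4).
  - exact: le_lt_trans xs wx.
  - exact: le_lt_trans yt wy.
  have le2 : e / 2 * (`|x - s| + `|y - t|) <= e / 2 * ((x2 - x1) + (y2 - y1)).
    by rewrite ler_wpM2l ?(ltW e2) // lerD.
  by split; [exact: le_trans k1 le2|exact: le_trans k2 le2].
set W := (x2 - x1) + (y2 - y1) in near *.
have y1in : y1 <= y1 <= y2 by rewrite lexx.
have y2in : y1 <= y2 <= y2 by rewrite lexx y12.
have x1in : x1 <= x1 <= x2 by rewrite lexx.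
have x2in : x1 <= x2 <= x2 by rewrite lexx x12.
have hP : `|itg (P^~ y1) x1 x2 - itg (P^~ y2) x1 x2 - (b * (y1 - y2)) * (x2 - x1)| <=
    (e * W) * (x2 - x1).
  rewrite -itgB; [|exact: cP|exact: cP].
  apply: itg_near => //; first by apply: continB; exact: cP.
  move=> x hx; have [p1 _] := near x y1 hx y1in; have [p2 _] := near x y2 hx y2in.
  move: p1 p2; rewrite !ler_norml => /andP[? ?] /andP[? ?].
  by apply/andP; split; lra.
have hQ : `|itg (Q x2) y1 y2 - itg (Q x1) y1 y2 - (b * (x2 - x1)) * (y2 - y1)| <=
    (e * W) * (y2 - y1).
  rewrite -itgB; [|exact: cQ|exact: cQ].
  apply: itg_near => //; first by apply: continB; exact: cQ.
  move=> y hy; have [_ p1] := near x1 y x1in hy; have [_ p2] := near x2 y x2in hy.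
  move: p1 p2; rewrite !ler_norml => /andP[? ?] /andP[? ?].
  by apply/andP; split; lra.
have -> : e * W ^+ 2 = (e * W) * (x2 - x1) + (e * W) * (y2 - y1) by rewrite /W; ring.
apply: le_trans (lerD hP hQ); apply: le_trans (ler_normD _ _).
rewrite le_eqVlt; apply/orP; left; apply/eqP; congr `|_|; rewrite /circ; ring.
Qed.

End Goursat.

Lemma nested_point (R : realType) (a b : nat -> R) : (forall n, a n <= a n.+1) ->
  (forall n, b n.+1 <= b n) -> (forall n, a n <= b n) -> exists s, forall n, a n <= s <= b n.
Proof.
move=> am bm ab.
have amono m n : (m <= n)%N -> a m <= a n.
  move=> mn; rewrite -(subnK mn); elim: (n - m)%N => // k IH.
  by apply: le_trans IH _; rewrite addSn.
have bmono m n : (m <= n)%N -> b n <= b m.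
  move=> mn; rewrite -(subnK mn); elim: (n - m)%N => // k IH.
  by apply: le_trans _ IH; rewrite addSn.
have anbm n m : a n <= b m.
  apply: le_trans (amono n (maxn n m) (leq_maxl _ _)) _.
  by apply: le_trans (ab _) _; apply: bmono; exact: leq_maxr.
exists (sup (range a)) => n; apply/andP; split.
  apply: ub_le_sup; last by exists n.
  by exists (b 0%N) => _ [m _ <-].
apply: ge_sup; first by exists (a 0%N), 0%N.
by move=> _ [m _ <-].
Qed.

(** Quartering: a part with at least a quarter of the excess circulation persists at every scale,
    against the quadratic smallness of [circ_local] at the limit point. The partial derivatives are
    not assumed continuous. *)
Lemma goursat (R : realType) (P Q : R -> R -> R) (s1 s2 t1 t2 : R) :
  s1 <= s2 -> t1 <= t2 -> closed_form P Q s1 s2 t1 t2 -> circ P Q s1 s2 t1 t2 = 0.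
Proof.
move=> s12 t12 cf; apply/eqP/negPn/negP => nz.
pose W := (s2 - s1) + (t2 - t1).
have W0 : 0 <= W by rewrite /W; lra.
have W21 : 0 < W ^+ 2 + 1 by rewrite ltr_wpDl // sqr_ge0.
(* Chosen so that the circulation of the whole rectangle exceeds k W ^+ 2; the [+ 1] gives
   strictness and covers W = 0. *)
pose k : R := `|circ P Q s1 s2 t1 t2| / (W ^+ 2 + 1).
have k0 : 0 < k by rewrite divr_gt0 // normr_gt0.
pose bad (r : (R * R) * (R * R)) :=
  [/\ s1 <= r.1.1, r.1.2 <= s2, t1 <= r.2.1, r.2.2 <= t2 &
   [/\ r.1.1 <= r.1.2, r.2.1 <= r.2.2 &
   k * ((r.1.2 - r.1.1) + (r.2.2 - r.2.1)) ^+ 2 < `|circ P Q r.1.1 r.1.2 r.2.1 r.2.2| ]].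
pose quarter (r r' : (R * R) * (R * R)) :=
  [/\ r.1.1 <= r'.1.1, r'.1.2 <= r.1.2, r.2.1 <= r'.2.1, r'.2.2 <= r.2.2 &
   r'.1.2 - r'.1.1 = (r.1.2 - r.1.1) / 2 /\ r'.2.2 - r'.2.1 = (r.2.2 - r.2.1) / 2].
(* The implication under the existential makes the step total, so that [choice] yields a function to
   iterate. *)
have step r : exists r', bad r -> bad r' /\ quarter r r'.
  case: r => [[x1 x2] [y1 y2]].
  have [[/= a1 a2 b1 b2 [x12 y12 big]]|nb] := pselect (bad ((x1, x2), (y1, y2))); last first.
    by exists ((x1, x2), (y1, y2)) => /nb.
  pose x := (x1 + x2) / 2; pose y := (y1 + y2) / 2.
  have hx : x1 <= x <= x2 by rewrite /x; apply/andP; split; lra.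
  have hy : y1 <= y <= y2 by rewrite /y; apply/andP; split; lra.
  have ex1 : x - x1 = (x2 - x1) / 2 by rewrite /x; field.
  have ex2 : x2 - x = (x2 - x1) / 2 by rewrite /x; field.
  have ey1 : y - y1 = (y2 - y1) / 2 by rewrite /y; field.
  have ey2 : y2 - y = (y2 - y1) / 2 by rewrite /y; field.
  have sp := circ_split (closed_form_sub a1 a2 b1 b2 cf) hx hy.
  have /andP[hx1 hx2] := hx; have /andP[hy1 hy2] := hy.
  pose V := k * (((x2 - x1) + (y2 - y1)) / 2) ^+ 2.
  have V4 : 4 * V < `|circ P Q x1 x2 y1 y2|.
    by have -> : 4 * V = k * ((x2 - x1) + (y2 - y1)) ^+ 2 by rewrite /V; field.
  have mk u1 u2 v1 v2 : x1 <= u1 -> u2 <= x2 -> y1 <= v1 -> v2 <= y2 ->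
     u2 - u1 = (x2 - x1) / 2 -> v2 - v1 = (y2 - y1) / 2 ->
     V < `|circ P Q u1 u2 v1 v2| ->
     exists r', bad ((x1, x2), (y1, y2)) -> bad r' /\ quarter ((x1, x2), (y1, y2)) r'.
    move=> l1 l2 l3 l4 eu ev VV; exists ((u1, u2), (v1, v2)) => _; split; last by split.
    split=> /=; [exact: le_trans l1|exact: le_trans a2|exact: le_trans l3|exact: le_trans b2|].
    split; [by lra|by lra|].
    by rewrite eu ev -mulrDl.
  have [h1|h1] := ltP V `|circ P Q x1 x y1 y|; first by apply: (mk _ _ _ _ _ _ _ _ _ _ h1).
  have [h2|h2] := ltP V `|circ P Q x1 x y y2|; first by apply: (mk _ _ _ _ _ _ _ _ _ _ h2).
  have [h3|h3] := ltP V `|circ P Q x x2 y1 y|; first by apply: (mk _ _ _ _ _ _ _ _ _ _ h3).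
  have [h4|h4] := ltP V `|circ P Q x x2 y y2|; first by apply: (mk _ _ _ _ _ _ _ _ _ _ h4).
  exfalso; move: V4; rewrite ltNge sp => /negP; apply.
  apply: le_trans (ler_normD _ _) _.
  apply: (@le_trans _ _ ((V + V) + (V + V))); last by lra.
  by apply: lerD; apply: le_trans (ler_normD _ _) _; exact: lerD.
have [f fP] := choice step.
pose r n := iter n f ((s1, s2), (t1, t2)).
have bad0 : bad (r 0%N).
  split=> //=; split=> //; rewrite -/W /k.
  rewrite mulrAC ltr_pdivrMr // ltr_pM2l ?normr_gt0 // ltrDl //.
have badn n : bad (r n) by elim: n => // n /fP[].
have qn n : quarter (r n) (r n.+1) by have /fP[] := badn n.
have [s hs] := @nested_point R (fun n => (r n).1.1) (fun n => (r n).1.2)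
  (fun n => let: And5 h _ _ _ _ := qn n in h) (fun n => let: And5 _ h _ _ _ := qn n in h)
  (fun n => let: And5 _ _ _ _ (And3 h _ _) := badn n in h).
have [t ht] := @nested_point R (fun n => (r n).2.1) (fun n => (r n).2.2)
  (fun n => let: And5 _ _ h _ _ := qn n in h) (fun n => let: And5 _ _ _ h _ := qn n in h)
  (fun n => let: And5 _ _ _ _ (And3 _ h _) := badn n in h).
have wn n : (r n).1.2 - (r n).1.1 = (s2 - s1) / 2 ^+ n /\
            (r n).2.2 - (r n).2.1 = (t2 - t1) / 2 ^+ n.
  elim: n => [|n [IH1 IH2]]; first by rewrite expr0 !divr1.
  have [_ _ _ _ [-> ->]] := qn n; rewrite IH1 IH2 !exprSr !invfM.
  by split; rewrite mulrA.
have [del del0 H] := circ_local cf (hs 0%N) (ht 0%N) k0.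
pose n := Num.bound (W / del).
have small : W / 2 ^+ n < del.
  rewrite ltr_pdivrMr ?exprn_gt0 // mulrC -ltr_pdivrMr //.
  apply: (@lt_trans _ _ n%:R); first by rewrite archi_boundP // divr_ge0 // ltW.
  by rewrite -natrX ltr_nat ltn_expl.
have [a1 a2 b1 b2 [x12 y12]] := badn n; apply/negP; rewrite -leNgt.
have [w1 w2] := wn n.
apply: H => //.
- rewrite w1; apply: le_lt_trans small; rewrite ler_wpM2r ?invr_ge0 ?exprn_ge0 // /W; lra.
- rewrite w2; apply: le_lt_trans small; rewrite ler_wpM2r ?invr_ge0 ?exprn_ge0 // /W; lra.
Qed.

Local Open Scope complex_scope.
Local Notation normc := ComplexField.Normc.normc.

Section ComplexNorm.
Context (R : realType).
Implicit Types z w : R[i].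

Lemma normc_ge0 z : 0 <= normc z.
Proof. by case: z => a b; rewrite sqrtr_ge0. Qed.

Lemma norm_Re_le z : `|complex.Re z| <= normc z.
Proof. by have := normc_ge_Re z; rewrite lecR. Qed.

Lemma normc_i : normc ('i : R[i]) = 1.
Proof. by rewrite /= expr0n add0r expr1n sqrtr1. Qed.

Lemma norm_Im_le z : `|complex.Im z| <= normc z.
Proof.
have := norm_Re_le (z * 'i); rewrite ReiNIm normrN ComplexField.Normc.normcM.
by rewrite normc_i mulr1.
Qed.

Lemma normc_real (a : R) : normc a%:C = `|a|.
Proof. by rewrite /= expr0n addr0 sqrtr_sqr. Qed.

Lemma normc_le z : normc z <= `|complex.Re z| + `|complex.Im z|.
Proof.
case: z => a b /=; rewrite -(ger0_norm (addr_ge0 (normr_ge0 a) (normr_ge0 b))).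
rewrite -sqrtr_sqr ler_wsqrtr // sqrrD -[in leLHS](real_normK (num_real a)).
rewrite -[in leLHS](real_normK (num_real b)).
have := mulr_ge0 (normr_ge0 a) (normr_ge0 b); rewrite mulr2n; lra.
Qed.

Lemma normcD_le z w : normc (z + w) <= normc z + normc w.
Proof. exact: le_normcD. Qed.

End ComplexNorm.

Section CirclePoint.
Context (R : realType).

Lemma is_derive_approx (f : R -> R) (x l : R) : is_derive x 1 f l ->
  forall e : R, 0 < e -> exists2 del : R, 0 < del &
  forall h : R, `|h| < del -> `|f (x + h) - f x - l * h| <= e * `|h|.
Proof.
move=> [dv lv] e e0; move: dv; rewrite /derivable => dv.
have cv : h^-1 *: ((f \o shift x) (h *: 1) - f x) @[h --> 0^'] --> l.
  by rewrite -lv; exact: dv.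
move/cvgrPdist_le: cv => /(_ e e0); rewrite near_withinE => /nbhs_ballP[del /= del0 H].
exists del => // h hd; have [->|h0] := eqVneq h 0.
  by rewrite addr0 subrr mulr0 subr0 normr0 mulr0.
have := H h; rewrite /ball /= sub0r normrN => /(_ hd h0).
rewrite /shift /= [h *: 1]mulr1 [h + x]addrC => hh.
have -> : f (x + h) - f x - l * h = - ((l - h^-1 *: (f (x + h) - f x)) * h).
  by rewrite /GRing.scale /=; field.
by rewrite normrN normrM ler_wpM2r.
Qed.

Definition cis (x : R) : R[i] := cos x +i* sin x.

(** This is exp(s + i x). Rectangles in (s, x) become annuli, which reduces the circle to Goursat's
    theorem on a rectangle. *)
Definition cpolar (s x : R) : R[i] := (expR s * cos x) +i* (expR s * sin x).

Lemma cpolarE s x : cpolar s x = (expR s)%:C * cis x.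
Proof. by rewrite /cpolar /cis /=; simpc. Qed.

Lemma cpolarD s x s' x' : cpolar (s + s') (x + x') = cpolar s x * cpolar s' x'.
Proof.
by rewrite /cpolar; simpc; rewrite expRD cosD sinD; congr (_ +i* _); ring.
Qed.

Lemma normc_cis x : normc (cis x) = 1.
Proof. by rewrite /= cos2Dsin2 sqrtr1. Qed.

Lemma normc_cpolar s x : normc (cpolar s x) = expR s.
Proof.
rewrite cpolarE ComplexField.Normc.normcM normc_cis mulr1 normc_real.
by rewrite ger0_norm // expR_ge0.
Qed.

Lemma cpolar_near0 (e : R) : 0 < e -> exists2 del : R, 0 < del & forall s x : R,
  `|s| < del -> `|x| < del -> normc (cpolar s x - 1 - (s +i* x)) <= e * (`|s| + `|x|).
Proof.
(* The four error terms below add up to at most ep |s| + 5 ep |x|, whence e / 5; the bound 1 keeps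
   expR s below 2. *)
move=> e0; have e4 : 0 < Num.min (e / 5) 1 by rewrite lt_min ltr01 divr_gt0.
set ep := Num.min (e / 5) 1 in e4.
have epe : ep <= e / 5 by rewrite ge_min lexx.
have ep1 : ep <= 1 by rewrite ge_min lexx orbT.
have [d1 d10 h1] := is_derive_approx (is_derive_expR 0) e4.
have [d2 d20 h2] := is_derive_approx (is_derive_cos (0 : R)) e4.
have [d3 d30 h3] := is_derive_approx (is_derive_sin (0 : R)) e4.
exists (Num.min (Num.min d1 d2) (Num.min d3 (Num.min (ep / 2) (1 / 2)))).
  by rewrite !lt_min d10 d20 d30 !divr_gt0.
move=> s x; rewrite !lt_min => /and3P[/andP[s1 _] _ /andP[s4 s5]] /and3P[/andP[_ x2] x3 _].
have := h1 s s1; rewrite add0r expR0 mul1r => k1.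
have := h2 x x2; rewrite add0r cos0 sin0 oppr0 mul0r subr0 => k2.
have := h3 x x3; rewrite add0r sin0 cos0 mul1r subr0 => k3.
have ns := normr_ge0 s; have nx := normr_ge0 x.
have k4 : `|expR s - 1| <= ep.
  have -> : expR s - 1 = (expR s - 1 - s) + s by ring.
  apply: le_trans (ler_normD _ _) _; apply: (@le_trans _ _ (1 * `|s| + `|s|)); last by lra.
  by rewrite lerD2r; apply: le_trans k1 _; rewrite ler_wpM2r.
have k5 : `|expR s| <= 2.
  have -> : expR s = (expR s - 1) + 1 by ring.
  apply: le_trans (ler_normD _ _) _; rewrite normr1; lra.
apply: le_trans (normc_le _) _.
have -> : complex.Re (cpolar s x - 1 - (s +i* x)) = (expR s - 1 - s) + expR s * (cos x - 1).
  by rewrite /=; ring.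
have -> : complex.Im (cpolar s x - 1 - (s +i* x)) = expR s * (sin x - x) + (expR s - 1) * x.
  by rewrite /=; ring.
have b1 : `|expR s * (cos x - 1)| <= 2 * (ep * `|x|) by rewrite normrM ler_pM.
have b2 : `|expR s * (sin x - x)| <= 2 * (ep * `|x|) by rewrite normrM ler_pM.
have b3 : `|(expR s - 1) * x| <= ep * `|x| by rewrite normrM ler_wpM2r.
apply: (@le_trans _ _ ((ep * `|s| + 2 * (ep * `|x|)) + (2 * (ep * `|x|) + ep * `|x|))).
  by apply: lerD; apply: le_trans (ler_normD _ _) _; apply: lerD.
have c1 : ep * `|s| <= e / 5 * `|s| by rewrite ler_wpM2r.
have c2 : ep * `|x| <= e / 5 * `|x| by rewrite ler_wpM2r.
have c3 : 0 <= e / 5 * `|s| by rewrite mulr_ge0 // divr_ge0 // ltW.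
lra.
Qed.

End CirclePoint.

(** * Means of holomorphic functions over circles *)

Section CircleMean.
Context (R : realType).

(** Complex differentiability with derivative a, in terms of the real-valued modulus, since the norm
    of R[i] takes its values in R[i]. *)
Definition cdiff (q : R[i] -> R[i]) (z a : R[i]) := forall e : R, 0 < e ->
  exists2 del : R, 0 < del & forall h : R[i], normc h < del ->
    normc (q (z + h) - q z - a * h) <= e * normc h.

Local Notation circle_len := (pi *+ 2 : R).

(** With z = t exp(s + i x) one has q dz / z = q (ds + i dx), whose imaginary part is Im q ds + Re q
    dx. It is closed by the Cauchy-Riemann equations, and nothing is asked of q at 0. *)
Lemma polar_closed_form (q : R[i] -> R[i]) (t s1 : R) : 0 < t ->
  (forall z, 0 < normc z <= t -> exists a, cdiff q z a) ->
  closed_form (fun s x => complex.Im (q (t%:C * cpolar s x)))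
    (fun s x => complex.Re (q (t%:C * cpolar s x))) s1 0 0 circle_len.
Proof.
move=> t0 dq s x /andP[_ s0] _.
set z0 := t%:C * cpolar s x.
have rE : normc z0 = t * expR s.
  by rewrite ComplexField.Normc.normcM normc_real gtr0_norm // normc_cpolar.
set rho := normc z0 in rE.
have r0 : 0 < rho by rewrite rE mulr_gt0 // expR_gt0.
have rt : rho <= t by rewrite rE ler_piMr ?(ltW t0) // expR_le1.
have [a da] : exists a, cdiff q z0 a by apply: dq; rewrite -/rho r0 rt.
have aE : exists al be, a * z0 = al +i* be.
  by case: (a * z0) => al be; exists al, be.
have [al [be {}aE]] := aE.
(* The differential of q is (al + i be)(ds + i dx): its imaginary part is be ds + al dx and its real
   part al ds - be dx. *)
exists be, al, (- be) => e e0.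
have na0 : 0 <= normc a by exact: normc_ge0.
have m0 : 0 < normc a * rho + 1 by rewrite ltr_wpDl // mulr_ge0 // ltW.
have e1 : 0 < e / (4 * rho) by rewrite divr_gt0 // mulr_gt0.
have e2 : 0 < Num.min 1 (e / 2 / (normc a * rho + 1)).
  by rewrite lt_min ltr01 !divr_gt0.
set ep := Num.min 1 _ in e2.
have [d1 d10 h1] := da _ e1; have [d2 d20 h2] := cpolar_near0 e2.
exists (Num.min d2 (d1 / (4 * rho))).
  by rewrite lt_min d20 divr_gt0 // mulr_gt0.
move=> s' x' _ _; rewrite !lt_min => /andP[sd2 sd1] /andP[xd2 xd1].
set S := `|s' - s| + `|x' - x|.
have S0 : 0 <= S by exact: addr_ge0.
set o := cpolar (s' - s) (x' - x) - 1 - ((s' - s) +i* (x' - x)).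
have oS : normc o <= ep * S by exact: h2.
have oS1 : normc o <= S.
  by apply: le_trans oS _; rewrite ler_piMl // ge_min lexx.
pose h := z0 * (cpolar (s' - s) (x' - x) - 1).
have hE : h = z0 * (((s' - s) +i* (x' - x)) + o) by rewrite /h /o; ring.
have zE : t%:C * cpolar s' x' = z0 + h.
  have -> : cpolar s' x' = cpolar s x * cpolar (s' - s) (x' - x).
    by rewrite -cpolarD; congr cpolar; ring.
  by rewrite /h /z0; ring.
have DS : normc ((s' - s) +i* (x' - x)) <= S by exact: normc_le.
have hS : normc h <= rho * (S + S).
  rewrite hE ComplexField.Normc.normcM -/rho ler_wpM2l ?(ltW r0) //.
  by apply: le_trans (normcD_le _ _) _; exact: lerD.
have hd : normc h < d1.
  apply: le_lt_trans hS _.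
  move: sd1 xd1; rewrite !ltr_pdivlMr ?mulr_gt0 // => k1 k2.
  by rewrite /S; lra.
have k1 := h1 h hd.
have k2 : normc (a * z0 * o) <= e / 2 * S.
  rewrite (ComplexField.Normc.normcM (a * z0)) (ComplexField.Normc.normcM a z0) -/rho.
  apply: (@le_trans _ _ ((normc a * rho + 1) * (ep * S))).
    by apply: ler_pM => //; [rewrite mulr_ge0 // ltW|exact: normc_ge0|rewrite lerDl].
  rewrite mulrA ler_wpM2r // mulrC -ler_pdivlMr //.
  by rewrite ge_min lexx orbT.
have k3 : normc (q (t%:C * cpolar s' x') - q z0 - (al +i* be) * ((s' - s) +i* (x' - x))) <= e * S.
  rewrite zE -aE.
  have -> : q (z0 + h) - q z0 - a * z0 * ((s' - s) +i* (x' - x)) =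
    (q (z0 + h) - q z0 - a * h) + a * z0 * o by rewrite hE; ring.
  apply: le_trans (normcD_le _ _) _.
  have -> : e * S = e / 2 * S + e / 2 * S by field.
  apply: lerD => //; apply: le_trans k1 _.
  apply: (@le_trans _ _ (e / (4 * rho) * (rho * (S + S)))).
    by rewrite ler_wpM2l // ltW.
  rewrite le_eqVlt; apply/orP; left; apply/eqP; field; exact: lt0r_neq0.
split.
- apply: le_trans k3; apply: le_trans (norm_Im_le _).
  case: (q (t%:C * _)) => u' v'; case: (q z0) => u v /=.
  rewrite le_eqVlt; apply/orP; left; apply/eqP; congr `|_|; ring.
- apply: le_trans k3; apply: le_trans (norm_Re_le _).
  case: (q (t%:C * _)) => u' v'; case: (q z0) => u v /=.
  rewrite le_eqVlt; apply/orP; left; apply/eqP; congr `|_|; ring.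
Qed.

Lemma cpolar_period s x : cpolar s (x + circle_len) = cpolar s x :> R[i].
Proof. by rewrite /cpolar cosD2pi sinD2pi. Qed.

Lemma circle_len_gt0 : 0 < circle_len.
Proof. by rewrite mulrn_wgt0 // pi_gt0. Qed.

Section MeanValue.
Context (q : R[i] -> R[i]) (t : R) (t_gt0 : 0 < t).
Context (q_diff : forall z, 0 < normc z <= t -> exists a, cdiff q z a).
Context (q_cont : forall e : R, 0 < e -> exists2 del : R, 0 < del &
  forall z, normc z < del -> normc (q z - q 0) <= e).

Local Notation rq := (fun x => complex.Re (q (t%:C * cis x))).

Lemma cpolar0 (x : R) : cpolar 0 x = cis x.
Proof. by rewrite cpolarE expR0 mul1r. Qed.

Lemma circle_contin : contin rq 0 circle_len.
Proof.
have [_ c] := closed_form_contin (@polar_closed_form q t 0 t_gt0 q_diff).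
have := c 0; rewrite lexx => /(_ isT); congr contin.
by apply/funext => x; rewrite cpolar0.
Qed.

(** The sides x = 0 and x = 2 pi of the rectangle cancel by periodicity, so the mean does not depend
    on the radius. Shrinking the circle then needs only continuity at 0, which admits a removable
    singularity there. *)
Lemma circle_mean : itg rq 0 circle_len = complex.Re (q 0) * circle_len.
Proof.
have l0 := circle_len_gt0.
apply/eqP; rewrite -subr_eq0 -normr_eq0 eq_le normr_ge0 andbT.
apply/ler_addgt0Pr => eps eps0; rewrite add0r.
have e0 : 0 < eps / circle_len by rewrite divr_gt0.
have [del del0 hd] := q_cont e0.
(* This makes the inner radius t exp(s1) at most del / 2; the minimum with 0 keeps the inner circle
   inside the outer one. *)
pose s1 : R := Num.min 0 (ln (del / 2 / t)).
have s10 : s1 <= 0 by rewrite ge_min lexx.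
have small x : normc (t%:C * cpolar s1 x) < del.
  rewrite ComplexField.Normc.normcM normc_real gtr0_norm // normc_cpolar.
  apply: (@le_lt_trans _ _ (t * (del / 2 / t))).
    rewrite ler_wpM2l ?(ltW t_gt0) // -[leRHS]lnK ?posrE ?divr_gt0 //.
    by rewrite ler_expR ge_min lexx orbT.
  by rewrite mulrC divfK ?gt_eqF //; lra.
have cf := @polar_closed_form q t s1 t_gt0 q_diff.
have := goursat s10 (ltW l0) cf; rewrite /circ.
have -> : itg (fun s => complex.Im (q (t%:C * cpolar s circle_len))) s1 0 =
   itg (fun s => complex.Im (q (t%:C * cpolar s 0))) s1 0.
  by congr itg; apply/funext => s; rewrite -[circle_len]add0r cpolar_period.
rewrite subrr add0r => /eqP; rewrite subr_eq0 => /eqP e1.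
have -> : itg rq 0 circle_len = itg (fun x => complex.Re (q (t%:C * cpolar s1 x))) 0 circle_len.
  by rewrite -e1; congr itg; apply/funext => x; rewrite cpolar0.
have [_ c] := closed_form_contin cf.
have cc := c s1; rewrite lexx s10 in cc.
have := itg_near (ltW l0) (cc isT) (c := complex.Re (q 0)) (e := eps / circle_len).
rewrite !subr0 divfK ?gt_eqF //; apply => x _.
have := hd _ (small x); apply: le_trans; apply: le_trans (norm_Re_le _).
by case: (q (t%:C * _)) => u v; case: (q 0) => u' v' /=.
Qed.

Lemma circle_max (M : R) : (forall x, rq x <= M) -> complex.Re (q 0) <= M.
Proof.
move=> h; have l0 := circle_len_gt0.
have : itg rq 0 circle_len <= M * circle_len.
  rewrite -[circle_len in leRHS]subr0 -itg_cst ?(ltW l0) //; apply: itg_le => //.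
    exact: circle_contin.
  exact: contin_cst.
by rewrite circle_mean ler_pM2r.
Qed.

(** The functional L commutes with finite sums only, so the mean value property is needed for
    Riemann sums, with an explicit error. *)
Lemma circle_riemann (C : R) (N : nat) : (0 < N)%N ->
  (forall x y, `|rq x - rq y| <= C * `|x - y|) ->
  `|complex.Re (q 0) - N%:R^-1 * \sum_(j < N) rq (j%:R * (circle_len / N%:R))| <=
    C * (circle_len / N%:R).
Proof.
move=> N0 lip; have l0 := circle_len_gt0.
have NR : 0 < N%:R :> R by rewrite ltr0n.
set h := circle_len / N%:R; have h0 : 0 < h by rewrite divr_gt0.
have hN : N%:R * h = circle_len by rewrite mulrC divfK // gt_eqF.
have step k : (k <= N)%N ->
    `|itg rq 0 (k%:R * h) - h * \sum_(j < k) rq (j%:R * h)| <= k%:R * (C * h * h).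
  elim: k => [|k IH] kN.
    rewrite big_ord0 !mul0r mulr0 subr0.
    have := itg_near (lexx (0 : R)) (contin_sub (lexx 0) (ltW l0) circle_contin)
      (c := 0) (e := `|rq 0|).
    rewrite mul0r !subr0 !mulr0; apply => x; rewrite -eq_le => /eqP <-.
    by rewrite subr0.
  have kh : k%:R * h <= k.+1%:R * h by rewrite ler_wpM2r ?(ltW h0) // ler_nat.
  have k0 : 0 <= k%:R * h by rewrite mulr_ge0 // ltW.
  have kl : k.+1%:R * h <= circle_len by rewrite -hN ler_wpM2r ?(ltW h0) // ler_nat.
  have ct := contin_sub (lexx 0) kl circle_contin.
  rewrite -(itg_split ct k0 kh) big_ord_recr /=.
  have dk : k.+1%:R * h - k%:R * h = h by rewrite -natr1; ring.
  have n1 := itg_near kh (contin_sub k0 (lexx _) ct) (c := rq (k%:R * h)) (e := C * h).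
  rewrite dk in n1.
  have C0 : 0 <= C.
    by have := le_trans (normr_ge0 _) (lip 1 0); rewrite subr0 normr1 mulr1.
  have : `|itg rq (k%:R * h) (k.+1%:R * h) - rq (k%:R * h) * h| <= C * h * h.
    apply: n1 => x /andP[x1 x2]; apply: le_trans (lip _ _) _.
    rewrite ler_wpM2l // ger0_norm ?subr_ge0 //; move: x2; rewrite -natr1; lra.
  have := IH (ltnW kN); set A := itg _ _ _; set B := itg _ _ _.
  set X := \sum_(j < k) _; set Y := rq _; set W := C * h * h.
  rewrite -natr1 !ler_norml => /andP[? ?] /andP[? ?].
  by apply/andP; split; lra.
have := step N (leqnn N); rewrite hN circle_mean -hN.
set X := \sum_(j < N) _ => H.
have e1 : complex.Re (q 0) * (N%:R * h) - h * X = (N%:R * h) * (complex.Re (q 0) - N%:R^-1 * X).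
  by field; exact: lt0r_neq0.
move: H; rewrite e1 normrM (gtr0_norm (mulr_gt0 NR h0)).
have -> : N%:R * (C * h * h) = N%:R * h * (C * h) by ring.
by rewrite ler_pM2l // mulr_gt0.
Qed.

End MeanValue.
End CircleMean.

(** * Holomorphic functions on the ball and the invariant metric *)

Lemma near_differentiable (K : numFieldType) (V W : normedModType K) (f g : V -> W) x :
  (\forall y \near x, f y = g y) -> differentiable f x -> differentiable g x.
Proof.
move=> fg df; have [cdf] := (diff_locallyP x f).1 df => /eqaddoP dfx.
have gx : f x = g x by exact: nbhs_singleton fg.
have dg : g \o shift x = cst (g x) + 'd f x +o_ 0 id.
  apply/eqaddoP => _/posnumP[e].
  have fg0 : \forall h \near (0 : V), f (h + x) = g (h + x).
    by have := fg; rewrite (near_shift 0) subr0.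
  near=> h; have e1 : f (h + x) = g (h + x) by near: h.
  suff : `|(f \o shift x - (cst (f x) + 'd f x)) h| <= e%:num * `|h|.
    by rewrite !fctE /= e1 gx.
  by near: h; exact: dfx.
apply/diff_locallyP; by rewrite (diff_unique cdf dg).
Unshelve. all: by end_near. Qed.

Section ComplexDiff.
Context (R : realType).

Lemma complex_normE (z : R[i]) : `|z| = (normc z)%:C.
Proof. by rewrite normc_def; case: z. Qed.

Lemma near0_complex (P : set R[i]) : nbhs (0 : R[i]) P ->
  exists2 del : R, 0 < del & forall h : R[i], normc h < del -> P h.
Proof.
move=> /nbhs_ballP[e /= e0 H].
(* A positive element of R[i] is real, so the radius of a ball is the image of a real number. *)
have [eR Re0] : e = (complex.Re e)%:C /\ 0 < complex.Re e.
  have := e0; rewrite ltcE => /andP[/eqP h ?]; split=> //.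
    by apply/eqP; rewrite eq_complex /= h /= !eqxx.
exists (complex.Re e) => // h hd; apply: H.
by rewrite /ball /= sub0r normrN complex_normE eR ltcR.
Qed.

Lemma differentiable_cdiff (h : R[i] -> R[i]) (z : R[i]) : differentiable h z ->
  exists a, cdiff h z a.
Proof.
move=> dh; exists ('d h z 1) => e e0.
have [cdf] := (diff_locallyP z h).1 dh => /eqaddoP dfx.
have e0' : 0 < e%:C by rewrite ltcR.
have [del del0 H] := near0_complex (dfx _ e0').
exists del => // k kd; have : `|h (k + z) - (h z + 'd h z k)| <= e%:C * `|k| by exact: H.
rewrite !complex_normE -rmorphM /= lecR [z + k]addrC.
have -> : 'd h z k = 'd h z 1 * k.
  by rewrite -[k in LHS]mulr1 -[k * 1]/(k *: (1 : R[i])) linearZ mulrC.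
by rewrite opprD addrA.
Qed.

End ComplexDiff.

Section Nsq.
Context (R : realType) (n : nat).
Implicit Types (v w p b : 'rV[R[i]]_n).

Definition nsq v : R := \sum_(j < n) normc (v ord0 j) ^+ 2.

Lemma unit_ballE v : unit_ball v <-> nsq v < 1.
Proof.
rewrite /unit_ball /=.
have -> : \sum_(j < n) `|v ord0 j| ^+ 2 = (nsq v)%:C.
  by rewrite rmorph_sum; apply: eq_bigr => j _; rewrite complex_normE -rmorphXn.
by rewrite -(rmorph1 (real_complex R)) ltcR.
Qed.

Lemma nsq_ge0 v : 0 <= nsq v.
Proof. by apply: sumr_ge0 => j _; exact: sqr_ge0. Qed.

Lemma nsqZ c v : nsq (c *: v) = normc c ^+ 2 * nsq v.
Proof.
rewrite /nsq mulr_sumr; apply: eq_bigr => j _.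
by rewrite mxE ComplexField.Normc.normcM exprMn.
Qed.

Lemma nsq_coord v j : normc (v ord0 j) ^+ 2 <= nsq v.
Proof. by rewrite /nsq (bigD1 j) //= lerDl sumr_ge0 // => k _; exact: sqr_ge0. Qed.

Lemma nsq_eq0 v : nsq v = 0 -> v = 0.
Proof.
move=> v0; apply/rowP => j; rewrite mxE; apply: ComplexField.Normc.eq0_normc.
apply/eqP; rewrite -sqrf_eq0 eq_le sqr_ge0 andbT -v0; exact: nsq_coord.
Qed.

Lemma nsqD_le (del : R) p w : 0 < del ->
  nsq (p + w) <= (1 + del) * nsq p + (1 + del^-1) * nsq w.
Proof.
move=> d0; rewrite /nsq !mulr_sumr -big_split /=; apply: ler_sum => j _.
rewrite mxE; set a := p ord0 j; set c := w ord0 j.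
apply: (@le_trans _ _ ((normc a + normc c) ^+ 2)).
  by rewrite lerXn2r ?nnegrE ?addr_ge0 ?normc_ge0 // normcD_le.
rewrite -subr_ge0; set x := normc a; set y := normc c.
have -> : (1 + del) * x ^+ 2 + (1 + del^-1) * y ^+ 2 - (x + y) ^+ 2 =
  del^-1 * (del * x - y) ^+ 2 by field; exact: lt0r_neq0.
by rewrite mulr_ge0 ?sqr_ge0 // invr_ge0 ltW.
Qed.

Lemma nsq_segment (s t : R) v w : 0 <= t <= 1 -> nsq v <= s -> nsq w <= s ->
  nsq (v + t%:C *: (w - v)) <= s.
Proof.
move=> /andP[t0 t1] vs ws.
apply: (@le_trans _ _ ((1 - t) * nsq v + t * nsq w)); last first.
  apply: (@le_trans _ _ ((1 - t) * s + t * s)); last by rewrite -mulrDl subrK mul1r.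
  by apply: lerD; rewrite ler_wpM2l // subr_ge0.
rewrite /nsq !mulr_sumr -big_split /=; apply: ler_sum => j _.
rewrite !mxE; set a := v ord0 j; set c := w ord0 j.
have -> : a + t%:C * (c - a) = (1 - t)%:C * a + t%:C * c.
  by rewrite rmorphB rmorph1; ring.
apply: (@le_trans _ _ (((1 - t) * normc a + t * normc c) ^+ 2)).
  have u0 : 0 <= (1 - t) * normc a + t * normc c.
    by rewrite addr_ge0 // mulr_ge0 ?normc_ge0 // subr_ge0.
  rewrite lerXn2r ?nnegrE ?normc_ge0 //; apply: le_trans (normcD_le _ _) _.
  rewrite !ComplexField.Normc.normcM !normc_real !ger0_norm // subr_ge0 //.
rewrite -subr_ge0; set x := normc a; set y := normc c.
have -> : (1 - t) * x ^+ 2 + t * y ^+ 2 - ((1 - t) * x + t * y) ^+ 2 =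
  (t * (1 - t)) * (x - y) ^+ 2 by ring.
by rewrite mulr_ge0 ?sqr_ge0 // mulr_ge0 // subr_ge0.
Qed.

(** The weighted inequality [nsqD_le] with del = (1 - s) / 2 gives s + (1 - s)(3 s + 3) / 8, and the
    last fraction is less than 1. *)
Lemma nsq_room (s : R) p w : 0 <= s < 1 -> nsq p <= s -> nsq w <= (1 - s) ^+ 2 / 8 ->
  unit_ball (p + w).
Proof.
move=> /andP[s0 s1] ps ws; apply/unit_ballE.
have d0 : 0 < (1 - s) / 2 by rewrite divr_gt0 // subr_gt0.
apply: le_lt_trans (nsqD_le p w d0) _.
apply: (@le_lt_trans _ _ ((1 + (1 - s) / 2) * s + (1 + ((1 - s) / 2)^-1) * ((1 - s) ^+ 2 / 8))).
  apply: lerD; rewrite ler_wpM2l // addr_ge0 // ?invr_ge0 ?ltW //.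
have -> : (1 + (1 - s) / 2) * s + (1 + ((1 - s) / 2)^-1) * ((1 - s) ^+ 2 / 8) =
   s + (1 - s) * ((3 * s + 3) / 8).
  by field; rewrite subr_eq0 eq_sym lt_eqF.
have : (1 - s) * ((3 * s + 3) / 8) < (1 - s) * 1.
  by rewrite ltr_pM2l ?subr_gt0 //; lra.
lra.
Qed.

End Nsq.

(** * Cauchy and Lipschitz estimates on smaller balls *)

Section CauchyEstimate.
Context (R : realType) (n : nat) (F : 'rV[R[i]]_n -> R[i]).
Context (F_diff : forall v, unit_ball v -> differentiable F v).
Context (F_bd : forall v, unit_ball v -> normc (F v) <= 1).

Lemma line_differentiable (G : 'rV[R[i]]_n -> R[i]) p b (z : R[i]) :
  differentiable G (p + z *: b) -> differentiable (fun x : R[i] => G (p + x *: b)) z.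
Proof.
move=> dG; apply: (@differentiable_comp _ _ _ _ (fun x : R[i] => p + x *: b) G).
  apply: differentiableD; first exact: differentiable_cst.
  exact: (@differentiableZl _ _ _ (fun x : R[i] => x)).
exact: dG.
Qed.

(** A Cauchy estimate by the maximum principle: on the circle of radius tau the difference quotient
    of a function bounded by 1 is at most 2 / tau, and its value at the centre is the derivative. *)
Lemma derivative_bound (s tau : R) p b (a : R[i]) : 0 <= s < 1 -> nsq p <= s -> 0 < tau ->
  tau ^+ 2 * nsq b <= (1 - s) ^+ 2 / 8 -> cdiff (fun z => F (p + z *: b)) 0 a ->
  complex.Re a <= 2 / tau.
Proof.
move=> s01 ps tau0 tb ca.
have inB z : normc z <= tau -> unit_ball (p + z *: b).
  move=> zt; apply: (nsq_room s01 ps); apply: le_trans tb; rewrite nsqZ.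
  by rewrite ler_wpM2r ?nsq_ge0 // lerXn2r ?nnegrE ?normc_ge0 // ltW.
pose h z := F (p + z *: b).
(* Filling the hole with a makes q continuous at 0, which is all that [circle_max] asks there. *)
pose q z := if z == 0 then a else (h z - h 0) * z^-1.
have q0 : q 0 = a by rewrite /q eqxx.
have qd z : 0 < normc z <= tau -> exists c, cdiff q z c.
  move=> /andP[z0 zt]; apply: differentiable_cdiff.
  have znz : z != 0 by apply: contraTneq z0 => ->; rewrite ComplexField.Normc.normc0 ltxx.
  apply: (@near_differentiable _ _ _ (fun y : R[i] => (h y - h 0) * y^-1)).
    apply/nbhs_ballP; exists `|z|; first by rewrite /= normr_gt0.
    move=> y; rewrite /ball /= => yz; rewrite /q; case: eqP => // y0.
    by move: yz; rewrite y0 subr0 ltxx.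
  apply: (@differentiableM _ _ (fun y => h y - h 0) (fun y => y^-1)).
    apply: differentiableB; last exact: differentiable_cst.
    by apply: line_differentiable; exact/F_diff/inB.
  exact: differentiable_Rinv.
have qc (e : R) : 0 < e -> exists2 del : R, 0 < del &
    forall z, normc z < del -> normc (q z - q 0) <= e.
  move=> e0; have [del del0 H] := ca e e0; exists del => // z zd; rewrite q0 /q.
  case: eqP => [_|/eqP z0]; first by rewrite subrr ComplexField.Normc.normc0 ltW.
  have := H z zd; rewrite add0r -/(h z) -/(h 0) => k.
  have nz : 0 < normc z.
    rewrite lt_neqAle normc_ge0 andbT eq_sym; apply: contra_neq z0.
    exact: ComplexField.Normc.eq0_normc.
  have -> : (h z - h 0) * z^-1 - a = (h z - h 0 - a * z) * z^-1 by field.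
  by rewrite ComplexField.Normc.normcM ComplexField.Normc.normcV ler_pdivrMr.
rewrite -q0; apply: (circle_max tau0 qd qc) => x.
set z := tau%:C * cis x.
have nz : normc z = tau.
  by rewrite ComplexField.Normc.normcM normc_cis mulr1 normc_real gtr0_norm.
apply: le_trans (ler_norm _) _; apply: le_trans (norm_Re_le _) _.
rewrite /q; case: eqP => [z0|_].
  by move: tau0; rewrite -nz z0 ComplexField.Normc.normc0 ltxx.
rewrite ComplexField.Normc.normcM ComplexField.Normc.normcV nz ler_wpM2r ?invr_ge0 ?(ltW tau0) //.
apply: le_trans (normcD_le _ _) _; rewrite normcN.
have h1 : normc (h z) <= 1 by apply: F_bd; apply: inB; rewrite nz.
have h2 : normc (h 0) <= 1.
  by apply: F_bd; apply: inB; rewrite ComplexField.Normc.normc0 ltW.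
lra.
Qed.

End CauchyEstimate.

Lemma is_derive_of_approx (R : realType) (f : R -> R) (x l : R) :
  (forall e : R, 0 < e -> exists2 del : R, 0 < del &
    forall h : R, `|h| < del -> `|f (x + h) - f x - l * h| <= e * `|h|) ->
  is_derive x 1 f l.
Proof.
move=> H.
have cv : h^-1 *: ((f \o shift x) (h *: 1) - f x) @[h --> 0^'] --> l.
  apply/cvgrPdist_le => e e0; have [del del0 k] := H e e0.
  rewrite near_withinE; apply/nbhs_ballP; exists del => //= h.
  rewrite /ball /= sub0r normrN => hd h0; have := k h hd.
  rewrite /shift /= [h *: 1]mulr1 [x + h]addrC => {}k.
  have -> : l - h^-1 *: (f (h + x) - f x) = - ((f (h + x) - f x - l * h) * h^-1).
    by rewrite /GRing.scale /=; field.
  by rewrite normrN normrM normfV ler_pdivrMr ?normr_gt0.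
apply: DeriveDef; first by apply/cvg_ex; exists l.
by apply: cvg_lim.
Qed.

Lemma Re_affine (R : realType) (u v a : R[i]) (h : R) :
  complex.Re (u - v - a * h%:C) = complex.Re u - complex.Re v - complex.Re a * h.
Proof. by case: u v a => u u' [v v'] [a a'] /=; rewrite mulr0 subr0. Qed.

Section LipschitzEstimate.
Context (R : realType) (n : nat) (F : 'rV[R[i]]_n -> R[i]).
Context (F_diff : forall v, unit_ball v -> differentiable F v).
Context (F_bd : forall v, unit_ball v -> normc (F v) <= 1).

(** The mean value theorem along the segment from x to y, which stays in the ball of squared radius
    s, with the derivative bounded in both directions by applying the Cauchy estimate to F and -
    F. *)
Lemma holomorphic_lipschitz (s : R) x y : 0 <= s < 1 -> nsq x <= s -> nsq y <= s ->
  `|complex.Re (F y) - complex.Re (F x)| <= 2 * Num.sqrt 8 / (1 - s) * Num.sqrt (nsq (y - x)).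
Proof.
move=> s01 xs ys; have /andP[s0 s1] := s01.
have [b0|bn0] := eqVneq (nsq (y - x)) 0.
  have /eqP := nsq_eq0 b0; rewrite subr_eq0 => /eqP ->.
  by rewrite subrr normr0 mulr_ge0 ?sqrtr_ge0 // !mulr_ge0 ?sqrtr_ge0 // invr_ge0 subr_ge0 ltW.
set b := y - x in bn0 *.
have nb : 0 < nsq b by rewrite lt_neqAle eq_sym bn0 nsq_ge0.
have rb : 0 < Num.sqrt (nsq b) by rewrite sqrtr_gt0.
have r8 : 0 < Num.sqrt 8 :> R by rewrite sqrtr_gt0.
have s1' : 0 < 1 - s by rewrite subr_gt0.
(* The largest radius that [nsq_room] allows in the direction b; it makes 2 / tau the claimed
   bound. *)
pose tau := (1 - s) / (Num.sqrt 8 * Num.sqrt (nsq b)).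
have tau0 : 0 < tau by rewrite divr_gt0 // mulr_gt0.
have tauE : tau ^+ 2 * nsq b = (1 - s) ^+ 2 / 8.
  rewrite /tau exprMn exprVn exprMn !sqr_sqrtr ?nsq_ge0 //.
  by field; rewrite bn0.
have tau2 : tau ^+ 2 * nsq b <= (1 - s) ^+ 2 / 8 by rewrite tauE.
pose K := 2 / tau.
have KE : K = 2 * Num.sqrt 8 / (1 - s) * Num.sqrt (nsq b).
  by rewrite /K /tau; field; rewrite !lt0r_neq0.
rewrite -KE.
pose phi (t : R) : R := complex.Re (F (x + t%:C *: b)).
have der (t : R) : 0 <= t <= 1 -> exists l : R, `|l| <= K /\ is_derive t 1 phi l.
  move=> t01; have pt : nsq (x + t%:C *: b) <= s by exact: nsq_segment.
  have pB : unit_ball (x + t%:C *: b) by apply/unit_ballE; exact: le_lt_trans s1.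
  have [a ca] : exists a, cdiff (fun z => F (x + t%:C *: b + z *: b)) 0 a.
    apply: differentiable_cdiff; apply: line_differentiable; rewrite scale0r addr0.
    exact: F_diff.
  exists (complex.Re a); split.
    rewrite ler_norml; apply/andP; split; last first.
      exact: (derivative_bound F_diff F_bd s01 pt tau0 tau2 ca).
    rewrite lerNl.
    have -> : - complex.Re a = complex.Re (- a) by case: a {ca}.
    apply: (@derivative_bound _ _ (fun v => - F v) _ _ s tau (x + t%:C *: b) b) => //.
    - by move=> v vB; apply: differentiableN; exact: F_diff.
    - by move=> v vB; rewrite normcN; exact: F_bd.
    - move=> e e0; have [del del0 H] := ca e e0; exists del => // h hd.
      by have := H h hd; rewrite -normcN; congr (normc _ <= _); ring.
  apply: is_derive_of_approx => e e0; have [del del0 H] := ca e e0.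
  exists del => // h hd; have := H h%:C; rewrite normc_real => /(_ hd).
  apply: le_trans; apply: le_trans (norm_Re_le _).
  rewrite /phi add0r scale0r addr0.
  have -> : x + (t + h)%:C *: b = x + t%:C *: b + h%:C *: b.
    by rewrite rmorphD scalerDl addrA.
  by rewrite Re_affine.
have der' (t : R) : exists l : R, 0 <= t <= 1 -> `|l| <= K /\ is_derive t 1 phi l.
  have [t01|nt] := pselect (0 <= t <= 1); last by exists 0 => /nt.
  by have [l hl] := der t t01; exists l.
have [df dfP] := choice der'.
have cphi : {within `[0, 1], continuous phi}.
  apply: derivable_within_continuous => t; rewrite in_itv /= => t01.
  by have [_ [dd _]] := dfP t t01.
have [t ht|t ht e] := MVT_segment (ler01 : 0 <= 1 :> R) _ cphi (df := df).
  apply: (dfP t _).2; move: ht; rewrite in_itv /= => /andP[h1 h2].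
  by rewrite (ltW h1) (ltW h2).
have t01 : 0 <= t <= 1 by move: ht; rewrite in_itv.
have yE : x + b = y by rewrite /b addrC subrK.
move: e; rewrite subr0 mulr1 /phi rmorph0 scale0r addr0 rmorph1 scale1r yE => ->.
by have [] := dfP t t01.
Qed.

End LipschitzEstimate.

(** * The invariant distance on the ball *)

Section BallMetric.
Context (R : realType) (n : nat).
Local Notation B := (Ball R n).
Local Notation incl := (@ball_incl R n).

Lemma extend_incl (W : normedModType R[i]) (g : B -> W) x : extend incl g (incl x) = g x.
Proof. by apply: extendE; exact: ball_incl_inj. Qed.

Lemma holomorphicE (W : normedModType R[i]) (g : B -> W) (F : 'rV[R[i]]_n -> W) :
  (forall x, g x = F (incl x)) -> (forall v, unit_ball v -> differentiable F v) ->
  holomorphic incl g.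
Proof.
move=> gF dF x; apply: near_differentiable (dF _ (ball_inclP x)).
exact: near_extend.
Qed.

Lemma holomorphic_comp (W : normedModType R[i]) (h : B -> W) (g : B -> B) :
  holomorphic incl h -> holomorphic incl (incl \o g) -> holomorphic incl (h \o g).
Proof.
move=> dh dg; apply: (@holomorphicE _ _ (fun v => extend incl h (extend incl (incl \o g) v))).
  by move=> x; rewrite !extend_incl.
move=> _ /ball_incl_surj[x <-]; apply: differentiable_comp; first exact: dg.
by rewrite extend_incl /=; exact: dh.
Qed.

Definition unit_holo (g : B -> R[i]) := holomorphic incl g /\ forall x, normc (g x) <= 1.

(** The norm distance between the evaluations at x and y on bounded holomorphic functions, a
    distance of Caratheodory type: multiplying g by unit constants shows that the real part gives
    the same supremum as the modulus. *)
Definition cdist (x y : B) : R :=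
  sup [set `|complex.Re (g x) - complex.Re (g y)| | g in unit_holo].

Lemma unit_holo_cst : unit_holo (fun=> 0).
Proof.
split; last by move=> x; rewrite ComplexField.Normc.normc0.
by apply: (@holomorphicE _ _ (fun=> 0)) => // v _; exact: differentiable_cst.
Qed.

Lemma unit_holo_Re g x : unit_holo g -> `|complex.Re (g x)| <= 1.
Proof. by move=> [_ gb]; exact: le_trans (norm_Re_le _) _. Qed.

Lemma cdist_ge g x y : unit_holo g -> `|complex.Re (g x) - complex.Re (g y)| <= cdist x y.
Proof.
move=> hg; apply: ub_le_sup; last by exists g.
exists 2 => _ [h hh <-]; apply: le_trans (ler_normB _ _) _.
have := unit_holo_Re x hh; have := unit_holo_Re y hh; lra.
Qed.

Lemma cdist_le x y (c : R) : (forall g, unit_holo g ->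
  `|complex.Re (g x) - complex.Re (g y)| <= c) -> cdist x y <= c.
Proof.
move=> h; apply: ge_sup; last by move=> _ [g hg <-]; exact: h.
by exists `|complex.Re (0 : R[i]) - complex.Re (0 : R[i])|; exists (fun=> 0) => //; exact: unit_holo_cst.
Qed.

Lemma cdist_pm : pseudometric cdist.
Proof.
split=> [x|x y|x y z].
- apply/le_anti/andP; split.
    by apply: cdist_le => g _; rewrite subrr normr0.
  by apply: le_trans (cdist_ge x x unit_holo_cst); rewrite subrr normr0.
- by congr sup; apply/seteqP; split=> _ [g hg <-]; exists g => //; rewrite distrC.
- apply: cdist_le => g hg; have := cdist_ge x y hg; have := cdist_ge y z hg.
  have -> : complex.Re (g x) - complex.Re (g z) =
     (complex.Re (g x) - complex.Re (g y)) + (complex.Re (g y) - complex.Re (g z)) by ring.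
  by move=> h1 h2; apply: le_trans (ler_normD _ _) _; exact: lerD.
Qed.

Lemma aut_isometry g : Aut_ball g -> isometry cdist g.
Proof.
move=> [hg [h [hh gh hgK]]]; split; first by exists h.
have le k x y : holomorphic incl (incl \o k) -> cdist (k x) (k y) <= cdist x y.
  move=> hk; apply: cdist_le => u [hu bu].
  apply: (@cdist_ge (u \o k)); split; first exact: holomorphic_comp.
  by move=> z; exact: bu.
move=> x y; apply/le_anti; rewrite le //=.
by rewrite -{1}(gh x) -{1}(gh y); exact: le.
Qed.

Lemma cdist_lipschitz (s : R) x y : 0 <= s < 1 -> nsq (incl x) <= s -> nsq (incl y) <= s ->
  cdist x y <= 2 * Num.sqrt 8 / (1 - s) * Num.sqrt (nsq (incl x - incl y)).
Proof.
move=> s01 xs ys; apply: cdist_le => g [hg gb].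
have := holomorphic_lipschitz (F := extend incl g) _ _ s01 ys xs.
rewrite !extend_incl; apply.
- by move=> _ /ball_incl_surj[z <-]; exact: hg.
- by move=> _ /ball_incl_surj[z <-]; rewrite extend_incl.
Qed.

Lemma coord_differentiable j (v : 'rV[R[i]]_n) :
  differentiable (fun w : 'rV[R[i]]_n => w ord0 j) v.
Proof. exact: differentiable_coord. Qed.

Lemma unit_holo_coord (c : R[i]) j : normc c = 1 -> unit_holo (fun x => c * incl x ord0 j).
Proof.
move=> c1; split.
  apply: (@holomorphicE _ _ (fun w => c * w ord0 j)) => // v _.
  apply: (@differentiableM _ _ (fun=> c) (fun w : 'rV[R[i]]_n => w ord0 j)).
    exact: differentiable_cst.
  exact: coord_differentiable.
move=> x; rewrite ComplexField.Normc.normcM c1 mul1r.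
have h : normc (incl x ord0 j) ^+ 2 <= 1.
  by apply: le_trans (nsq_coord _ _) _; apply/ltW/unit_ballE/ball_inclP.
by rewrite -(@ler_pXn2r _ 2) ?nnegrE ?normc_ge0 ?expr1n.
Qed.

(** A coordinate and its multiple by i are admissible test functions, which control the real and the
    imaginary part. *)
Lemma coord_le_cdist x y j : normc (incl x ord0 j - incl y ord0 j) <= 2 * cdist x y.
Proof.
have h1 := cdist_ge x y (unit_holo_coord j (ComplexField.Normc.normc1 R)).
have h2 := cdist_ge x y (unit_holo_coord j (normc_i R)).
apply: le_trans (normc_le _) _.
move: h1 h2; rewrite !mul1r; case: (incl x ord0 j) => a b; case: (incl y ord0 j) => a' b' /=.
rewrite !mul0r !mul1r !sub0r opprK [- b + b']addrC => h1.
by rewrite -[`|b' - b|]distrC => h2; lra.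
Qed.

Lemma automorphism_exists (F G : 'rV[R[i]]_n -> 'rV[R[i]]_n) :
  (forall v, unit_ball v -> unit_ball (F v)) -> (forall v, unit_ball v -> unit_ball (G v)) ->
  (forall v, unit_ball v -> differentiable F v) -> (forall v, unit_ball v -> differentiable G v) ->
  (forall v, unit_ball v -> G (F v) = v) -> (forall v, unit_ball v -> F (G v) = v) ->
  exists g, Aut_ball g /\ forall x, incl (g x) = F (incl x).
Proof.
move=> FB GB dF dG GF FG.
have [g gE] := @choice _ _ (fun x y => incl y = F (incl x))
  (fun x => ball_incl_surj (FB _ (ball_inclP x))).
have [h hE] := @choice _ _ (fun x y => incl y = G (incl x))
  (fun x => ball_incl_surj (GB _ (ball_inclP x))).
exists g; split=> //; split; first exact: holomorphicE dF.
exists h; split; first exact: holomorphicE dG.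
- by move=> x; apply: ball_incl_inj; rewrite hE gE GF //; exact: ball_inclP.
- by move=> x; apply: ball_incl_inj; rewrite gE hE FG //; exact: ball_inclP.
Qed.

Lemma row_differentiable (V : normedModType R[i]) (f : V -> 'rV[R[i]]_n) x :
  (forall j, differentiable (fun v => f v ord0 j) x) -> differentiable f x.
Proof.
move=> df.
have -> : f = \sum_(j < n) (fun v => f v ord0 j *: (delta_mx 0 j : 'rV[R[i]]_n)).
  apply/funext => v; rewrite fct_sumE [LHS]row_sum_delta.
  by apply: eq_bigr => j _; rewrite !ord1.
apply: differentiable_sum => j.
exact: (@differentiableZl _ _ _ (fun v => f v ord0 j)).
Qed.

End BallMetric.

(** * Homogeneity of the ball *)

Section Moebius.
Context (R : realType) (n : nat).
Local Notation B := (Ball R n).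
Local Notation incl := (@ball_incl R n).
Local Notation "x ^*" := (conjc x) : ring_scope.

Lemma conjcM (x y : R[i]) : (x * y)^* = x^* * y^*.
Proof. exact: rmorphM. Qed.

Lemma conjcB (x y : R[i]) : (x - y)^* = x^* - y^*.
Proof. exact: rmorphB. Qed.

Lemma conjcN (x : R[i]) : (- x)^* = - x^*.
Proof. exact: rmorphN. Qed.

Lemma conjcD (x y : R[i]) : (x + y)^* = x^* + y^*.
Proof. exact: rmorphD. Qed.

Lemma conjcV (x : R[i]) : (x^-1)^* = (x^*)^-1.
Proof. exact: conjc_inv. Qed.

Lemma conjc_sum (F : 'I_n -> R[i]) : (\sum_(j < n) F j)^* = \sum_(j < n) (F j)^*.
Proof. exact: rmorph_sum. Qed.

Lemma normc_sqrE (z : R[i]) : (normc z ^+ 2)%:C = z * z^*.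
Proof. by rewrite rmorphXn /= -complex_normE sqr_normc. Qed.

Lemma nsqE (v : 'rV[R[i]]_n) : (nsq v)%:C = \sum_(j < n) v ord0 j * (v ord0 j)^*.
Proof. by rewrite rmorph_sum; apply: eq_bigr => j _; exact: normc_sqrE. Qed.

Lemma rotation_exists (c : R[i]) : normc c = 1 ->
  exists g, Aut_ball g /\ forall x : B, incl (g x) = c *: incl x.
Proof.
move=> c1; have c0 : c != 0.
  by apply: contra_eq_neq c1 => ->; rewrite ComplexField.Normc.normc0 eq_sym oner_eq0.
have ci : normc c^-1 = 1 by rewrite ComplexField.Normc.normcV c1 invr1.
have sB (e : R[i]) v : normc e = 1 -> @unit_ball R n v -> unit_ball (e *: v).
  by move=> e1 /unit_ballE vB; apply/unit_ballE; rewrite nsqZ e1 expr1n mul1r.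
have sd (e : R[i]) (v : 'rV[R[i]]_n) : differentiable (fun w : 'rV[R[i]]_n => e *: w) v.
  by apply: (@differentiableZ _ _ _ (fun w : 'rV[R[i]]_n => w)).
apply: (@automorphism_exists _ _ (fun v => c *: v) (fun v => c^-1 *: v)) => // v vB.
- exact: sB.
- exact: sB.
- by rewrite scalerA mulVf // scale1r.
- by rewrite scalerA mulfV // scale1r.
Qed.

Context (a : 'rV[R[i]]_n) (a_ball : unit_ball a).

Let s : R := Num.sqrt (1 - nsq a).

Let s_gt0 : 0 < s.
Proof. by rewrite sqrtr_gt0 subr_gt0; exact: (unit_ballE a).1. Qed.

Let s_sqr : nsq a = 1 - s ^+ 2.
Proof.
rewrite sqr_sqrtr; first by rewrite opprB addrC subrK.
by rewrite subr_ge0; apply: ltW; exact: (unit_ballE a).1.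
Qed.

Definition hip (v : 'rV[R[i]]_n) : R[i] := \sum_(j < n) v ord0 j * (a ord0 j)^*.

(* The involution (a - P v - s (v - P v)) / (1 - <v, a>) exchanging 0 and a, with
   P the projection on the line of a; as 1 - s^2 = |a|^2, the vector (1 - s) P v is
   <v, a> a / (1 + s), which makes sense also for a = 0. *)
Definition moebius (v : 'rV[R[i]]_n) : 'rV[R[i]]_n :=
  \row_j ((1 - hip v)^-1 *
    (a ord0 j - s%:C * v ord0 j - hip v * (1 + s%:C)^-1 * a ord0 j)).

Let S : R[i] := s%:C.

Let S_neq0 : S != 0.
Proof. by rewrite (inj_eq (@complexI R) s 0) gt_eqF. Qed.

Let S1_neq0 : 1 + S != 0.
Proof.
have -> : 1 + S = (1 + s)%:C by rewrite rmorphD rmorph1.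
by rewrite (inj_eq (@complexI R) (1 + s) 0) gt_eqF // addr_gt0.
Qed.

(** The inequality 2 x y <= x^2 + y^2 in each coordinate suffices, as both vectors have norm less
    than 1. *)
Lemma hip_lt1 v : unit_ball v -> normc (hip v) < 1.
Proof.
move=> /unit_ballE vB; have /unit_ballE aB := a_ball.
apply: (@le_lt_trans _ _ ((nsq v + nsq a) / 2)); last by lra.
rewrite /hip; apply: (@le_trans _ _ (\sum_(j < n) normc (v ord0 j * (a ord0 j)^*))).
  elim/big_rec2: _ => [|j x y _ h]; first by rewrite ComplexField.Normc.normc0.
  by apply: le_trans (normcD_le _ _) _; rewrite lerD2l.
rewrite /nsq -big_split mulr_suml /=; apply: ler_sum => j _.
rewrite ComplexField.Normc.normcM.
have -> : normc (a ord0 j)^* = normc (a ord0 j).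
  by case: (a ord0 j) => u w; rewrite /= sqrrN.
set x := normc (v _ _); set y := normc (a _ _).
have := sqr_ge0 (x - y); rewrite sqrrB; lra.
Qed.

Lemma hip1_neq0 v : unit_ball v -> 1 - hip v != 0.
Proof.
move=> /hip_lt1; apply: contraTneq => /eqP; rewrite subr_eq0 => /eqP <-.
by rewrite ComplexField.Normc.normc1 ltxx.
Qed.

(** The classical identity for 1 - |phi_a(v)|^2; positivity of its right side is what keeps the
    image in the ball. *)
Lemma moebius_norm v : unit_ball v ->
  (nsq (moebius v))%:C = 1 - (1 - nsq a)%:C * (1 - nsq v)%:C / ((1 - hip v) * (1 - hip v)^*).
Proof.
move=> vB; have z0 := hip1_neq0 vB.
have z0' : (1 - hip v)^* != 0 by rewrite conjc_eq0.
set z := hip v in z0 z0' *.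
have zE : z^* = \sum_(j < n) (v ord0 j)^* * a ord0 j.
  by rewrite conjc_sum; apply: eq_bigr => j _; rewrite conjcM conjcK.
have cS : S^* = S by exact: conjc_real.
have AE : \sum_(j < n) a ord0 j * (a ord0 j)^* = 1 - S ^+ 2.
  by rewrite -nsqE s_sqr rmorphB rmorph1 rmorphXn.
rewrite nsqE.
(* The numerator of the map is al a - s v; al' is the conjugate of al and k the squared modulus of
   the denominator's inverse. *)
pose al := 1 - z * (1 + S)^-1; pose al' := 1 - z^* * (1 + S)^-1.
pose k := (1 - z)^-1 * (1 - z^*)^-1.
have -> : \sum_(j < n) moebius v ord0 j * (moebius v ord0 j)^* =
   k * (al * al' * (1 - S ^+ 2) - S * al * z^* - S * al' * z + S ^+ 2 * (nsq v)%:C).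
  transitivity (\sum_(j < n) k * (al * al' * (a ord0 j * (a ord0 j)^*) -
      S * al * ((v ord0 j)^* * a ord0 j) - S * al' * (v ord0 j * (a ord0 j)^*) +
      S ^+ 2 * (v ord0 j * (v ord0 j)^*))).
    apply: eq_bigr => j _; rewrite !mxE -/z -/S.
    rewrite !(conjcM, conjcN, conjcV, conjcD, conjc1) cS.
    rewrite /k /al /al'; ring.
  rewrite -mulr_sumr big_split /= !sumrB -!mulr_sumr AE.
  by rewrite -zE -/(hip v) -nsqE.
have -> : (1 - nsq a)%:C = S ^+ 2.
  by rewrite s_sqr opprB addrC subrK rmorphXn.
rewrite (rmorphB (real_complex R)) (rmorph1 (real_complex R)) /k /al /al' conjcB conjc1.
field; rewrite S1_neq0 z0 /=.
by move: z0'; rewrite andbT conjcB conjc1.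
Qed.

Lemma moebius_ball v : unit_ball v -> unit_ball (moebius v).
Proof.
move=> vB; apply/unit_ballE; have := moebius_norm vB.
rewrite -normc_sqrE -fmorphV -!rmorphM -(rmorph1 (real_complex R)) -rmorphB => /complexI ->.
have a1 := (unit_ballE a).1 a_ball; have v1 := (unit_ballE v).1 vB.
have h : 0 < normc (1 - hip v).
  rewrite lt_neqAle normc_ge0 andbT eq_sym.
  by apply: contra_neq (hip1_neq0 vB); exact: ComplexField.Normc.eq0_normc.
by rewrite ltrBlDr ltrDl divr_gt0 ?mulr_gt0 // subr_gt0.
Qed.

Lemma hip_differentiable v : differentiable hip v.
Proof.
have -> : hip = \sum_(j < n) (fun w : 'rV[R[i]]_n => w ord0 j * (a ord0 j)^*).
  by apply/funext => w; rewrite fct_sumE.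
apply: differentiable_sum => j.
apply: (@differentiableM _ _ (fun w : 'rV[R[i]]_n => w ord0 j) (fun=> (a ord0 j)^*)).
  exact: coord_differentiable.
exact: differentiable_cst.
Qed.

Lemma moebius_differentiable v : unit_ball v -> differentiable moebius v.
Proof.
move=> vB; apply: row_differentiable => j.
have -> : (fun w => moebius w ord0 j) = (fun w => (1 - hip w)^-1 *
    (a ord0 j - S * w ord0 j - hip w * ((1 + S)^-1 * a ord0 j))).
  by apply/funext => w; rewrite mxE mulrA.
have dh := hip_differentiable v.
have dc (c : R[i]) : differentiable (fun _ : 'rV[R[i]]_n => c) v by exact: differentiable_cst.
apply: (@differentiableM _ _ (fun w => (1 - hip w)^-1)
  (fun w => a ord0 j - S * w ord0 j - hip w * ((1 + S)^-1 * a ord0 j))).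
  apply: (@differentiableV _ _ (fun w => 1 - hip w)); last exact: hip1_neq0.
  by have := @differentiableB R[i] _ _ (fun _ : 'rV[R[i]]_n => (1 : R[i])) hip v (dc 1) dh.
apply: (@differentiableB _ _ _ (fun w : 'rV[R[i]]_n => a ord0 j - S * w ord0 j)
  (fun w => hip w * ((1 + S)^-1 * a ord0 j))).
  apply: (@differentiableB _ _ _ (fun _ : 'rV[R[i]]_n => a ord0 j) (fun w : 'rV[R[i]]_n => S * w ord0 j)) => //.
  apply: (@differentiableM _ _ (fun=> S) (fun w : 'rV[R[i]]_n => w ord0 j)) => //.
  exact: coord_differentiable.
exact: (@differentiableM _ _ hip (fun=> (1 + S)^-1 * a ord0 j)).
Qed.

Lemma moebiusK v : unit_ball v -> moebius (moebius v) = v.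
Proof.
move=> vB; have z0 := hip1_neq0 vB.
have AE : \sum_(j < n) a ord0 j * (a ord0 j)^* = 1 - S ^+ 2.
  by rewrite -nsqE s_sqr rmorphB rmorph1 rmorphXn.
have hE : hip (moebius v) = (1 - hip v)^-1 * ((1 - S ^+ 2) - S * hip v - hip v * (1 + S)^-1 * (1 - S ^+ 2)).
  rewrite {1}/hip -AE [X in _ - S * X]/hip !mulr_sumr -!sumrB mulr_sumr.
  by apply: eq_bigr => j _; rewrite mxE -/S; ring.
apply/rowP => j; rewrite mxE hE mxE -/S.
(* The numerator of 1 - hip (moebius v) over the denominator (1 - hip v)(1 + S); its being nonzero
   is what [field] asks for. *)
have E : (1 - hip v) * (1 + S) - ((1 - S ^+ 2 - S * hip v) * (1 + S) - hip v * (1 - S ^+ 2)) =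
  (1 + S) * S ^+ 2 by ring.
by field; rewrite E S1_neq0 z0 mulf_neq0 // expf_neq0.
Qed.

Lemma moebius0 : moebius 0 = a.
Proof.
have h0 : hip 0 = 0 by apply: big1 => j _; rewrite mxE mul0r.
by apply/rowP => j; rewrite !mxE h0 subr0 invr1 mulr0 !mul0r !subr0 mul1r.
Qed.

Lemma moebius_exists : exists g : B -> B, [/\ Aut_ball g, cancel g g &
  forall x, incl x = 0 -> incl (g x) = a].
Proof.
have [g [Ag gE]] := automorphism_exists moebius_ball moebius_ball moebius_differentiable
  moebius_differentiable moebiusK moebiusK.
exists g; split=> // [x|x x0].
  by apply: ball_incl_inj; rewrite !gE moebiusK //; exact: ball_inclP.
by rewrite gE x0 moebius0.
Qed.

End Moebius.

Section Homogeneous.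
Context (R : realType) (n : nat).
Local Notation B := (Ball R n).
Local Notation incl := (@ball_incl R n).

Lemma nsq0 : nsq (0 : 'rV[R[i]]_n) = 0.
Proof. by apply: big1 => j _; rewrite mxE ComplexField.Normc.normc0 expr0n. Qed.

Lemma origin_exists : exists o : B, incl o = 0.
Proof. by apply/ball_incl_surj/unit_ballE; rewrite nsq0. Qed.

Lemma Aut_ball_comp (g h : B -> B) : Aut_ball g -> Aut_ball h -> Aut_ball (g \o h).
Proof.
move=> [dg [g' [dg' gg' g'g]]] [dh [h' [dh' hh' h'h]]]; split.
  exact: (@holomorphic_comp _ _ _ (incl \o g) h).
exists (h' \o g'); split; first exact: (@holomorphic_comp _ _ _ (incl \o h') g').
- by move=> x /=; rewrite gg' hh'.
- by move=> x /=; rewrite h'h g'g.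
Qed.

Lemma ball_homogeneous (x y : B) : exists g, Aut_ball g /\ g x = y.
Proof.
have [p p0] := origin_exists.
have from_p (z : B) : exists g : B -> B, [/\ Aut_ball g, g p = z & g z = p].
  have [g [Ag gg g0]] := moebius_exists (ball_inclP z).
  have e : g p = z by apply: ball_incl_inj; exact: g0.
  by exists g; split=> //; rewrite -e gg.
have [g [Ag _ gx]] := from_p x; have [h [Ah hy _]] := from_p y.
by exists (h \o g); split; [exact: Aut_ball_comp|rewrite /= gx].
Qed.

End Homogeneous.

(** * Totally bounded subsets of the ball *)

Section Keys.
Context (R : realType) (T : choiceType) (d : T -> T -> R).

(** A finite colouring with small classes gives a net: one representative of each class that meets
    A. *)
Lemma totbounded_keys (A : set T) :
  (forall e : R, 0 < e -> exists (K : finType) (key : T -> K),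
     forall x y, A x -> A y -> key x = key y -> d x y < e) -> totbounded d A.
Proof.
move=> H e e0; have [K [key hk]] := H e e0.
have [[a Aa]|noA] := pselect (A !=set0); last by exists [::] => x Ax; exfalso; apply: noA; exists x.
exists [seq xget a [set x | A x /\ key x = c] | c <- enum K] => x Ax.
exists (xget a [set y | A y /\ key y = key x]); first by apply: map_f; rewrite mem_enum.
have [Ay yx] : [set y | A y /\ key y = key x] (xget a [set y | A y /\ key y = key x]).
  by apply: (@xgetPex _ a); exists x.
exact: hk.
Qed.

End Keys.

Section BallGeometry.
Context (R : realType) (n : nat).
Local Notation B := (Ball R n).
Local Notation incl := (@ball_incl R n).

(** The cell index of a point of [-1, 1] lies between 0 and 2 N, with 2 N reached at 1. Hence the N
    + N + 1 cells, for which [inord] never falls back on its default. *)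
Lemma truncn_cell (N : nat) (a b : R) : `|a| <= 1 -> `|b| <= 1 -> (0 < N)%N ->
  (inord (Num.truncn (N%:R * (a + 1))) : 'I_(N + N).+1) = inord (Num.truncn (N%:R * (b + 1))) ->
  `|a - b| <= N%:R^-1.
Proof.
rewrite !ler_norml => /andP[a1 a2] /andP[b1 b2] N0 e.
have N0' : 0 < N%:R :> R by rewrite ltr0n.
have tr (x : R) : - 1 <= x -> x <= 1 -> (Num.truncn (N%:R * (x + 1)) < (N + N).+1)%N /\
   (Num.truncn (N%:R * (x + 1)))%:R <= N%:R * (x + 1) < (Num.truncn (N%:R * (x + 1))).+1%:R.
  move=> x1 x2; have x0 : 0 <= N%:R * (x + 1) by rewrite mulr_ge0 //; lra.
  have h := truncn_itv x0; split=> //; move: h => /andP[h _].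
  rewrite ltnS -(@ler_nat R) natrD; apply: le_trans h _.
  by have := mulr_ge0 (ltW N0') (_ : 0 <= 1 - x); rewrite subr_ge0 => /(_ x2); lra.
have [ha /andP[ha1 ha2]] := tr a a1 a2; have [hb /andP[hb1 hb2]] := tr b b1 b2.
have {}e := congr1 val e; rewrite /= !inordK // in e.
rewrite e -natr1 in ha1 ha2; rewrite -natr1 in hb2.
have E : `|N%:R * (a - b)| <= 1 by rewrite ler_norml; apply/andP; split; lra.
by rewrite -ler_norml -[leRHS]mul1r ler_pdivlMr // -(gtr0_norm N0') -normrM mulrC.
Qed.

Lemma normc_sub_cell (N : nat) (a b : R[i]) : normc a <= 1 -> normc b <= 1 -> (0 < N)%N ->
  (inord (Num.truncn (N%:R * (complex.Re a + 1))) : 'I_(N + N).+1) =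
     inord (Num.truncn (N%:R * (complex.Re b + 1))) ->
  (inord (Num.truncn (N%:R * (complex.Im a + 1))) : 'I_(N + N).+1) =
     inord (Num.truncn (N%:R * (complex.Im b + 1))) ->
  normc (a - b) <= 2 / N%:R.
Proof.
move=> a1 b1 N0 h1 h2.
have k1 := truncn_cell (le_trans (norm_Re_le a) a1) (le_trans (norm_Re_le b) b1) N0 h1.
have k2 := truncn_cell (le_trans (norm_Im_le a) a1) (le_trans (norm_Im_le b) b1) N0 h2.
apply: le_trans (normc_le _) _.
by move: k1 k2; case: (a) => u v; case: (b) => u' v' /=; lra.
Qed.

Lemma archi_small (C e : R) : 0 <= C -> 0 < e -> exists N : nat, (0 < N)%N /\ C / N%:R < e.
Proof.
move=> C0 e0; exists (Num.truncn (C / e)).+1; split=> //.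
rewrite ltr_pdivrMr ?ltr0n // mulrC -ltr_pdivrMr //.
exact: truncnS_gt.
Qed.

(** The keys are the cells of the coordinates in a grid of mesh 1 / N; the Lipschitz constant of
    [cdist], finite because s < 1, turns Euclidean closeness into closeness for [cdist]. *)
Lemma totbounded_ball (s : R) : 0 <= s < 1 -> totbounded (@cdist R n) [set x | nsq (incl x) <= s].
Proof.
move=> s01; apply: totbounded_keys => e e0.
have /andP[s0 s1] := s01.
pose C : R := 2 * Num.sqrt 8 / (1 - s).
have C0 : 0 <= C by rewrite divr_ge0 ?mulr_ge0 ?sqrtr_ge0 // subr_ge0 ltW.
have C1 : 0 <= C * (2 * Num.sqrt n%:R) by apply: mulr_ge0 => //; rewrite mulr_ge0 // sqrtr_ge0.
have [N [N0 hN]] := archi_small C1 e0.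
pose cell (t : R) : 'I_(N + N).+1 := inord (Num.truncn (N%:R * (t + 1))).
exists {ffun 'I_n -> 'I_(N + N).+1 * 'I_(N + N).+1}.
exists (fun x => [ffun j => (cell (complex.Re (incl x ord0 j)), cell (complex.Im (incl x ord0 j)))]).
move=> x y /= xs ys k; apply: le_lt_trans (cdist_lipschitz s01 xs ys) _.
apply: le_lt_trans hN; rewrite -/C -mulrA ler_wpM2l //.
have co (z : B) j : nsq (incl z) <= s -> normc (incl z ord0 j) <= 1.
  move=> zs; rewrite -(@ler_pXn2r _ 2) ?nnegrE ?normc_ge0 // expr1n.
  by apply: le_trans (nsq_coord _ _) _; apply: le_trans zs (ltW s1).
apply: (@le_trans _ _ (Num.sqrt (n%:R * (2 / N%:R) ^+ 2))).
  rewrite ler_wsqrtr // /nsq.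
  have -> : n%:R * (2 / N%:R) ^+ 2 = \sum_(j < n) (2 / N%:R) ^+ 2 :> R.
    by rewrite sumr_const card_ord mulr_natl.
  apply: ler_sum => j _; rewrite !mxE lerXn2r ?nnegrE ?normc_ge0 ?divr_ge0 //.
  have := congr1 (fun f : {ffun 'I_n -> 'I_(N + N).+1 * 'I_(N + N).+1} => f j) k.
  rewrite !ffunE => -[k1 k2].
  by apply: normc_sub_cell => //; exact: co.
by rewrite sqrtrM // sqrtr_sqr ger0_norm ?divr_ge0 // mulrC mulrAC.
Qed.

(** By [coord_le_cdist], a ball of this radius around the origin has coordinates below 1 / (2 (n +
    1)), so it lies in the ball of squared radius 1 / 2. *)
Definition ball_r0 : R := (4 * n.+1%:R)^-1.

Lemma ball_r0_gt0 : 0 < ball_r0.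
Proof. by rewrite invr_gt0 mulr_gt0. Qed.

Lemma nsq_near_origin (p y : B) : incl p = 0 -> cdist p y < ball_r0 -> nsq (incl y) <= 2^-1.
Proof.
move=> p0 py; have r0 := ball_r0_gt0.
apply: (@le_trans _ _ (\sum_(j < n) (2 * ball_r0) ^+ 2)).
  apply: ler_sum => j _; rewrite lerXn2r ?nnegrE ?normc_ge0 ?mulr_ge0 ?(ltW r0) //.
  have := coord_le_cdist p y j; rewrite p0 mxE sub0r normcN => h.
  by apply: le_trans h _; rewrite ler_pM2l // ltW.
rewrite sumr_const card_ord -[leLHS]mulr_natl /ball_r0.
have m1 : 0 < n.+1%:R :> R by [].
have -> : n%:R = n.+1%:R - 1 :> R by rewrite -natr1 addrK.
set m : R := n.+1%:R in m1 *.
have -> : (m - 1) * (2 * (4 * m)^-1) ^+ 2 = (m - 1) / (4 * m ^+ 2) by field; rewrite gt_eqF.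
rewrite ler_pdivrMr; last by rewrite mulr_gt0 // exprn_gt0.
have := sqr_ge0 m; have := sqr_ge0 (m - 1); rewrite sqrrB; lra.
Qed.

Lemma cdist_ball_tb (x : B) : totbounded (@cdist R n) [set y | cdist x y < ball_r0].
Proof.
have [p p0] := origin_exists R n.
have [g [Ag gp]] := ball_homogeneous x p.
have ig := aut_isometry Ag.
have tb : totbounded (@cdist R n) [set y | nsq (incl y) <= 2^-1].
  by apply: totbounded_ball; rewrite invr_ge0 ler0n /= invf_lt1 // ltr1n.
apply: totboundedS (totbounded_iso ig tb).
by move=> y /= xy; apply: nsq_near_origin p0 _; rewrite -gp ig.2.
Qed.

Lemma chain_seq (r : R) (c : nat -> B) m : (forall k, (k < m)%N -> cdist (c k) (c k.+1) < r) ->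
  chain (@cdist R n) r m (c 0%N) (c m).
Proof.
elim: m c => [|m IH] c h //=; exists (c 1%N); first exact: h.
by apply: (IH (fun k => c k.+1)) => k km; exact: h.
Qed.

(** Since [cdist] is compared with Euclidean distance only on smaller balls, x is moved to the
    origin; the segment from there to the image of y stays in such a ball and is cut into N equal
    pieces. *)
Lemma cdist_chain (r : R) (x y : B) : 0 < r -> exists m, chain (@cdist R n) r m x y.
Proof.
move=> r0; have [p p0] := origin_exists R n.
have [g [Ag gx]] := ball_homogeneous x p.
have [m hm] : exists m, chain (@cdist R n) r m p (g y).
  set w := incl (g y); set s := nsq w.
  have s01 : 0 <= s < 1.
    by rewrite nsq_ge0 /=; apply/unit_ballE; exact: ball_inclP.
  pose C : R := 2 * Num.sqrt 8 / (1 - s).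
  have C0 : 0 <= C.
    by rewrite divr_ge0 ?mulr_ge0 ?sqrtr_ge0 // subr_ge0 ltW //; case/andP: s01.
  have [N [N0 hN]] := archi_small (mulr_ge0 C0 (sqrtr_ge0 s)) r0.
  have nN : 0 < N%:R :> R by rewrite ltr0n.
  have cs (k : nat) : (k <= N)%N -> nsq ((k%:R / N%:R)%:C *: w) <= s.
    move=> kN; rewrite nsqZ normc_real ger0_norm ?divr_ge0 //.
    have k1 : k%:R / N%:R <= 1 :> R by rewrite ler_pdivrMr // mul1r ler_nat.
    by rewrite -[leRHS]mul1r ler_wpM2r ?nsq_ge0 // exprn_ile1 // divr_ge0.
  have ce (k : nat) : exists z : B, (k <= N)%N -> incl z = (k%:R / N%:R)%:C *: w.
    have [kN|] := leqP k N; last by exists p.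
    have [|z zE] := @ball_incl_surj R n ((k%:R / N%:R)%:C *: w); last by exists z.
    by apply/unit_ballE; apply: le_lt_trans (cs k kN) _; case/andP: s01.
  have [c cE] := choice ce.
  exists N.
  have <- : c 0%N = p by apply: ball_incl_inj; rewrite cE // mul0r scale0r p0.
  have <- : c N = g y.
    by apply: ball_incl_inj; rewrite cE // divff ?lt0r_neq0 // scale1r.
  apply: chain_seq => k kN; apply: le_lt_trans hN.
  have e0 := cE k (ltnW kN); have e1 := cE k.+1 kN.
  have hl : cdist (c k) (c k.+1) <= C * Num.sqrt (nsq (incl (c k) - incl (c k.+1))).
    by apply: cdist_lipschitz s01 _ _; [rewrite e0; exact/cs/ltnW|rewrite e1; exact: cs].
  apply: le_trans hl _; rewrite e0 e1.
  rewrite -(mulrA C) ler_wpM2l // -scalerBl nsqZ -rmorphB normc_real.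
  rewrite sqrtrM ?sqr_ge0 // sqrtr_sqr normr_id mulrC ler_wpM2l ?sqrtr_ge0 //.
  by rewrite -mulrBl -natr1 opprD addNKr normrM normrN normr1 mul1r gtr0_norm // invr_gt0.
have [_ [h [Ah gh hg]]] := Ag.
have Ah' : Aut_ball h by split=> //; exists g; split=> //; case: Ag.
have h1 : h p = x by rewrite -gx gh.
exists m; rewrite -(gh y) -h1.
by apply: chain_iso hm; exact: aut_isometry.
Qed.

End BallGeometry.

(** * The mean value property on the ball *)

Section CisLipschitz.
Context (R : realType).

Lemma derive_le1_lipschitz (f df : R -> R) (x y : R) :
  (forall t : R, is_derive t 1 f (df t)) -> (forall t, `|df t| <= 1) -> `|f x - f y| <= `|x - y|.
Proof.
move=> fd fb; wlog xy : x y / x <= y.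
  move=> h; have [/h //|/ltW/h] := leP x y.
  by rewrite distrC [`|y - x|]distrC.
have cf : {within `[x, y], continuous f}.
  by apply: derivable_within_continuous => t _; have [] := fd t.
have [c _ e] := MVT_segment xy (fun t _ => fd t) cf.
by rewrite distrC e [`|x - y|]distrC normrM ler_piMl.
Qed.

Lemma cis_lipschitz (x y : R) : normc (cis x - cis y) <= 2 * `|x - y|.
Proof.
apply: le_trans (normc_le _) _; rewrite /cis /= mulr_natl mulr2n.
apply: lerD.
  apply: (@derive_le1_lipschitz cos (fun t => - sin t)) => t.
  by rewrite normrN ler_norml sin_geN1 sin_le1.
apply: (@derive_le1_lipschitz sin cos) => t.
by rewrite ler_norml cos_geN1 cos_le1.
Qed.

Lemma cdiff_cont (q : R[i] -> R[i]) (a : R[i]) : cdiff q 0 a -> forall e : R, 0 < e ->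
  exists2 del : R, 0 < del & forall z, normc z < del -> normc (q z - q 0) <= e.
Proof.
move=> ca e e0; have [del del0 H] := ca 1 ltr01.
have k0 : 0 < 1 + normc a by rewrite ltr_pwDl // normc_ge0.
exists (Num.min del (e / (1 + normc a))); first by rewrite lt_min del0 divr_gt0.
move=> z; rewrite lt_min => /andP[zd ze]; have := H z zd; rewrite add0r mul1r => h.
have -> : q z - q 0 = (q z - q 0 - a * z) + a * z by ring.
apply: le_trans (normcD_le _ _) _; rewrite ComplexField.Normc.normcM.
apply: (@le_trans _ _ ((1 + normc a) * normc z)); first by rewrite mulrDl mul1r lerD2r.
by rewrite mulrC -ler_pdivlMr // ltW.
Qed.

End CisLipschitz.

Section MeanProperty.
Context (R : realType) (n : nat).
Local Notation B := (Ball R n).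
Local Notation incl := (@ball_incl R n).
Local Notation d := (@cdist R n).
Context (L : (B -> R) -> R) (LP : haar d (ball_r0 R n) L).
Context (r : R) (r_gt0 : 0 < r) (r_le : r + r <= ball_r0 R n).

Lemma isometry_homogeneous (x y : B) : exists g, isometry d g /\ g x = y.
Proof. by have [g [Ag gx]] := ball_homogeneous x y; exists g; split=> //; exact: aut_isometry. Qed.

Lemma unit_holo_lipb g : unit_holo g -> lipb d (fun x => complex.Re (g x)).
Proof.
move=> hg; exists 1; split=> [x|x y]; first exact: unit_holo_Re.
by rewrite mul1r; exact: cdist_ge.
Qed.

(** The mean value property on the unit circle of the slice z -> g (z y), whose rotated arguments
    are the points cis x y. *)
Lemma circle_riemann_ball (g : B -> R[i]) (rho : R -> B -> B) (y : B) (N : nat) (p : B) :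
  unit_holo g -> (forall x z, incl (rho x z) = cis x *: incl z) -> incl p = 0 ->
  nsq (incl y) <= 2^-1 -> (0 < N)%N ->
  `|complex.Re (g p) - N%:R^-1 * \sum_(j < N) complex.Re (g (rho (j%:R * ((pi *+ 2 : R) / N%:R)) y))|
     <= (2 * Num.sqrt 8 / (1 - 2^-1) * 2) * ((pi *+ 2 : R) / N%:R).
Proof.
(* The constant of [cdist_lipschitz] at s = 1 / 2 times the 2 of [cis_lipschitz]; it does not depend
   on y. *)
move=> hg rhoE p0 ys N0; set C : R := 2 * _ / _ * 2.
pose q (z : R[i]) := extend incl g (z *: incl y).
have inB z : normc z <= 1 -> unit_ball (z *: incl y).
  move=> z1; apply/unit_ballE; rewrite nsqZ; apply: (@le_lt_trans _ _ (nsq (incl y))).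
    by rewrite -[leRHS]mul1r ler_wpM2r ?nsq_ge0 // exprn_ile1 // normc_ge0.
  by apply/unit_ballE; exact: ball_inclP.
have qd z : normc z <= 1 -> exists a, cdiff q z a.
  move=> z1; apply: differentiable_cdiff.
  have -> : q = (fun x => extend incl g (0 + x *: incl y)) by apply/funext => x; rewrite add0r.
  apply: line_differentiable; rewrite add0r.
  by have [x <-] := ball_incl_surj (inB z z1); exact: hg.1.
have [a ca] : exists a, cdiff q 0 a by apply: qd; rewrite ComplexField.Normc.normc0.
have qE x : complex.Re (q (1%:C * cis x)) = complex.Re (g (rho x y)).
  by rewrite /q rmorph1 mul1r -rhoE extend_incl.
have q0 : q 0 = g p by rewrite /q scale0r -p0 extend_incl.
have lip (x x' : R) : `|complex.Re (q (1%:C * cis x)) - complex.Re (q (1%:C * cis x'))| <= C * `|x - x'|.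
  rewrite !qE; apply: le_trans (cdist_ge _ _ hg) _.
  have rs t : nsq (incl (rho t y)) <= 2^-1 by rewrite rhoE nsqZ normc_cis expr1n mul1r.
  have s01 : 0 <= (2^-1 : R) < 1 by rewrite invr_ge0 ler0n /= invf_lt1 // ltr1n.
  apply: le_trans (cdist_lipschitz s01 (rs x) (rs x')) _.
  rewrite !rhoE -scalerBl nsqZ /C -[leRHS]mulrA ler_wpM2l //.
    by rewrite divr_ge0 ?mulr_ge0 ?sqrtr_ge0 // subr_ge0; case/andP: s01 => _ /ltW.
  rewrite sqrtrM ?sqr_ge0 // sqrtr_sqr ger0_norm ?normc_ge0 //.
  apply: le_trans (cis_lipschitz x x'); rewrite ler_piMr ?normc_ge0 //.
  rewrite -sqrtr1 ler_wsqrtr //; apply: le_trans ys _.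
  by case/andP: s01 => _ /ltW.
have := circle_riemann ltr01 _ (cdiff_cont ca) N0 lip.
rewrite q0; under eq_bigr do rewrite qE.
by apply; move=> z /andP[_ z1]; exact: qd.
Qed.

(** Rotations fix the origin, so averaging a rotated function there gives the same value. The mean
    of N rotated copies is within C / N of the constant Re g p on the support of the kernel. *)
Lemma mean_property_origin (g : B -> R[i]) (p : B) : unit_holo g -> incl p = 0 ->
  avg d L r (fun x => complex.Re (g x)) p = complex.Re (g p).
Proof.
move=> hg p0; have r0 := ball_r0_gt0 R n; have tb := @cdist_ball_tb R n.
have dP := @cdist_pm R n; have hom := isometry_homogeneous.
have rho_ex (x : R) : exists h : B -> B, Aut_ball h /\ forall z, incl (h z) = cis x *: incl z.
  by apply: rotation_exists; exact: normc_cis.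
have [rho rhoP] := choice rho_ex.
pose v x := complex.Re (g x).
have hv : lipb d v by exact: unit_holo_lipb.
have hvr t : lipb d (fun y => v (rho t y)).
  by apply: lipb_iso => //; apply: aut_isometry; case: (rhoP t).
have rp t : rho t p = p.
  by apply: ball_incl_inj; case: (rhoP t) => _ ->; rewrite p0 scaler0.
have av t : avg d L r (fun y => v (rho t y)) p = avg d L r v p.
  rewrite -[in RHS](rp t); apply: (avg_iso dP tb hom LP r_gt0 r_le) => //.
  by apply: aut_isometry; case: (rhoP t).
pose C : R := (2 * Num.sqrt 8 / (1 - 2^-1) * 2) * (pi *+ 2 : R).
have C0 : 0 <= C.
  rewrite /C !mulr_ge0 ?sqrtr_ge0 // ?invr_ge0 ?subr_ge0 ?invf_le1 ?ler1n //.
  by rewrite mulrn_wge0 // pi_ge0.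
apply/eqP; rewrite -subr_eq0 -normr_eq0 eq_le normr_ge0 andbT.
apply/ler_addgt0Pr => e e0; rewrite add0r.
have [N [N0 hN]] := archi_small C0 e0; apply: le_trans (ltW hN).
pose ang (j : 'I_N) : R := j%:R * ((pi *+ 2 : R) / N%:R).
pose V y := N%:R^-1 * \sum_(j < N) v (rho (ang j) y).
have hV : lipb d V by apply: lipbZ => //; apply: lipb_sum.
have aV : avg d L r V p = avg d L r v p.
  rewrite /V (avgZ dP tb LP r_gt0 r_le) ; last exact: lipb_sum.
  rewrite (avg_sum dP tb LP r_gt0 r_le) // (eq_bigr (fun=> avg d L r v p)) => [|j _]; last exact: av.
  by rewrite sumr_const card_ord -[X in _ * X]mulr_natl mulrA mulVf ?mul1r // pnatr_eq0 -lt0n.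
have near y : d p y < r -> `|v p - V y| <= C / N%:R.
  move=> py; have ys : nsq (incl y) <= 2^-1.
    apply: (nsq_near_origin p0); apply: lt_le_trans py _; apply: le_trans r_le.
    by rewrite lerDl ltW.
  have h := circle_riemann_ball hg (fun x z => (rhoP x).2 z) p0 ys N0.
  by rewrite [X in _ <= X]mulrA in h.
rewrite -aV.
have hc (c : R) : lipb d (fun=> c) by exact: lipb_cst.
have cE (c : R) : avg d L r (fun=> c) p = c by exact: (avg_cst dP tb LP r_gt0 r_le).
rewrite ler_distl; apply/andP; split.
  rewrite -[leLHS]cE; apply: (avg_le_near dP tb LP r_gt0 r_le) => // y /near.
  by rewrite distrC ler_distl => /andP[].
rewrite -[leRHS]cE; apply: (avg_le_near dP tb LP r_gt0 r_le) => // y /near.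
by rewrite distrC ler_distl => /andP[].
Qed.

Lemma mean_property (g : B -> R[i]) (z : B) : unit_holo g ->
  avg d L r (fun x => complex.Re (g x)) z = complex.Re (g z).
Proof.
move=> hg; have [p p0] := origin_exists R n.
have [h [Ah hp]] := ball_homogeneous p z.
have hgh : unit_holo (g \o h).
  split; last by move=> x; exact: hg.2.
  by apply: holomorphic_comp; [exact: hg.1|exact: Ah.1].
rewrite -hp -(mean_property_origin hgh p0) /=.
apply/esym/(@avg_iso _ _ _ (@cdist_pm R n) _ (@cdist_ball_tb R n) isometry_homogeneous _ LP _ r_gt0 r_le) => //.
  exact: aut_isometry.
exact: unit_holo_lipb.
Qed.

End MeanProperty.

Local Open Scope quotient_scope.

(** * Discrete and cocompact groups *)

Section BallTopology.
Context (R : realType) (n : nat).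
Local Notation B := (Ball R n).
Local Notation incl := (@ball_incl R n).

Lemma ball_incl_continuous : continuous incl.
Proof. exact: (@initial_continuous (set_type (@unit_ball R n)) _ set_val). Qed.

Lemma coord_ball (v w : 'rV[R[i]]_n) (del : R) : 0 < del ->
  ball v del%:C w <-> forall j, normc (w ord0 j - v ord0 j) < del.
Proof.
move=> d0; split.
  move=> h j; have [_ /(_ ord0 j)] := h; rewrite /ball /= complex_normE.
  by rewrite ltcR -normcN opprB.
move=> h; split; first by rewrite -(rmorph0 (real_complex R)) ltcR.
move=> i j; rewrite ord1 /ball /= complex_normE ltcR -normcN opprB; exact: h.
Qed.

Lemma near_coord (x : B) (del : R) : 0 < del ->
  \forall x' \near x, forall j, normc (incl x' ord0 j - incl x ord0 j) < del.
Proof.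
move=> d0; have d0' : 0 < del%:C by rewrite -(rmorph0 (real_complex R)) ltcR.
have h : nbhs x (incl @^-1` ball (incl x) del%:C).
  have k : nbhs (incl x) (ball (incl x) del%:C).
    by apply/nbhs_ballP; exists del%:C.
  have := @ball_incl_continuous x _ k.
  by rewrite nbhs_filterE.
by apply: filterS h => x' h; exact: (coord_ball _ _ d0).1.
Qed.

Lemma open_coord (O : set B) (x : B) : open O -> O x ->
  exists2 del : R, 0 < del & forall y, (forall j, normc (incl y ord0 j - incl x ord0 j) < del) -> O y.
Proof.
move=> [W oW WO] Ox; have Wx : W (incl x) by rewrite -WO in Ox.
have /nbhs_ballP[e /= e0 eW] : nbhs (incl x) W by exact: open_nbhs_nbhs.
have e0' : e = (complex.Re e)%:C /\ 0 < complex.Re e.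
  by move: e0; case: e {eW} => a b; rewrite ltcE /= => /andP[/eqP -> ->].
exists (complex.Re e); first exact: e0'.2.
by move=> y h; rewrite -WO; apply: eW; rewrite e0'.1; apply/coord_ball => //; exact: e0'.2.
Qed.

Lemma open_nsq_lt (c : R) : open [set v : 'rV[R[i]]_n | nsq v < c].
Proof.
have -> : [set v : 'rV[R[i]]_n | nsq v < c] =
    (fun z : 'rV[R[i]]_n => \sum_(j < n) `|z ord0 j| ^+ 2) @^-1` (ball (0 : R[i]) c%:C).
  have E (v : 'rV[R[i]]_n) : \sum_(j < n) `|v ord0 j| ^+ 2 = (nsq v)%:C :> R[i].
    by rewrite rmorph_sum; apply: eq_bigr => j _; rewrite complex_normE -rmorphXn.
  apply/seteqP; split=> v; rewrite /= -ball_normE /= E sub0r normrN complex_normE ltcR normc_real;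
    by rewrite ger0_norm // nsq_ge0.
apply: open_comp; last exact: ball_open.
by move=> z _; exact: sqnorm_continuous.
Qed.

Lemma archi_inv (e : R) : 0 < e -> exists N : nat, forall k, (N <= k)%N -> (k.+1%:R)^-1 < e.
Proof.
move=> e0; have [N [N0 hN]] := archi_small ler01 e0; exists N => k Nk.
apply: le_lt_trans hN; rewrite mul1r lef_pV2 ?posrE ?ltr0n // ler_nat.
exact: leqW.
Qed.

(** A Lebesgue number for [cdist]: closeness in [cdist] controls the coordinates, and compactness in
    its near-covering form, with k tending to infinity, makes the margin uniform. *)
Lemma compact_margin (K O : set B) : compact K -> open O -> K `<=` O ->
  exists N : nat, forall k, (N <= k)%N -> forall x y, K x -> cdist y x < (k.+1%:R)^-1 -> O y.
Proof.
move=> /compact_near_coveringP cK oO KO.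
have h x : K x -> \forall x' \near x & k \near \oo, forall y, cdist y x' < (k.+1%:R : R)^-1 -> O y.
  move=> /KO /(open_coord oO)[del del0 hO].
  have del4 : 0 < del / 4 by rewrite divr_gt0.
  have [N hN] := archi_inv del4.
  exists ([set x' | forall j, normc (incl x' ord0 j - incl x ord0 j) < del / 4],
          [set k | (N <= k)%N]).
    by split; [exact: near_coord|exact: nbhs_infty_ge].
  move=> [x' k] [/= hx' Nk] y yx'; apply: hO => j.
  have -> : incl y ord0 j - incl x ord0 j =
    (incl y ord0 j - incl x' ord0 j) + (incl x' ord0 j - incl x ord0 j) by ring.
  apply: le_lt_trans (normcD_le _ _) _.
  apply: (@lt_trans _ _ (2 * (del / 4) + del / 4)); last by lra.
  apply: ltrD; last exact: hx'.
  apply: le_lt_trans (coord_le_cdist y x' j) _; rewrite ltr_pM2l //.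
  exact: lt_trans yx' (hN k Nk).
have [N _ hN] := cK nat \oo (fun k x' => forall y, cdist y x' < (k.+1%:R : R)^-1 -> O y) _ h.
by exists N => k Nk x y Kx; exact: (hN k Nk x Kx).
Qed.

Lemma compact_in_subball (K : set B) : compact K ->
  exists N : nat, forall k, (N <= k)%N -> forall x, K x -> nsq (incl x) <= 1 - (k.+1%:R)^-1.
Proof.
move=> /compact_near_coveringP cK.
have h x : K x -> \forall x' \near x & k \near \oo, nsq (incl x') <= 1 - (k.+1%:R)^-1.
  move=> _; have x1 := (unit_ballE _).1 (ball_inclP x).
  set s := nsq (incl x) in x1.
  have e0 : 0 < (1 - s) / 2 by rewrite divr_gt0 // subr_gt0.
  have [N hN] := archi_inv e0.
  exists ([set x' | nsq (incl x') < (1 + s) / 2], [set k | (N <= k)%N]).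
    split; last exact: nbhs_infty_ge.
    have k : nbhs (incl x) [set v : 'rV[R[i]]_n | nsq v < (1 + s) / 2].
      by apply: open_nbhs_nbhs; split; [exact: open_nsq_lt|rewrite /= -/s; lra].
    by have := @ball_incl_continuous x _ k; rewrite nbhs_filterE.
  move=> [x' k] [/= hx' Nk]; move: hx' (hN k Nk).
  by move: (k.+1%:R^-1) (nsq _) => a b; lra.
have [N _ hN] := cK nat \oo (fun k x' => nsq (incl x') <= 1 - (k.+1%:R)^-1) _ h.
by exists N => k Nk x Kx; exact: (hN k Nk x Kx).
Qed.

Context (G : Aut_subgroup R n).

(** The sets U k of maps close to the identity on a subball generate a filter converging to the
    identity in the compact-open topology, so one of them lies in a neighbourhood isolating the
    identity. *)
Lemma discrete_near_id : discrete_subgroup G -> exists s eta : R, [/\ 0 <= s < 1, 0 < eta &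
  forall g, aut_car G g -> (forall x, nsq (incl x) <= s -> cdist (g x) x < eta) -> g = id].
Proof.
move=> dG; have [_ [V nV VG]] : isolated (aut_car G : set {compact-open, B -> B}) id.
  by rewrite dG; exact: aut_id.
pose U (k : nat) : set {compact-open, B -> B} :=
  [set g : B -> B | forall x, nsq (incl x) <= 1 - (k.+1%:R)^-1 -> cdist (g x) x < (k.+1%:R)^-1].
have Umono k l : (k <= l)%N -> U l `<=` U k.
  move=> kl g Ug x xk; have kl' : (l.+1%:R)^-1 <= (k.+1%:R)^-1 :> R.
    by rewrite lef_pV2 ?posrE ?ltr0n // ler_nat.
  by apply: lt_le_trans (Ug x _) (kl'); apply: le_trans xk _; rewrite lerD2l lerN2.
have FF : Filter (filter_from [set: nat] U).
  apply: filter_from_filter; first by exists 0%N.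
  move=> k l _ _; exists (maxn k l) => // g Ug; split.
    exact: (Umono _ _ (leq_maxl k l)).
  exact: (Umono _ _ (leq_maxr k l)).
have : filter_from [set: nat] U --> (id : {compact-open, B -> B}).
  apply/compact_open_cvgP => K O cK oO KO.
  have KO' : K `<=` O by move=> x Kx; apply: KO; exists x.
  have [N hN] := compact_margin cK oO KO'; have [M hM] := compact_in_subball cK.
  exists (maxn N M) => // g Ug _ [x Kx <-].
  apply: (hN _ (leq_maxl N M) x) => //; apply: Ug.
  exact: (hM _ (leq_maxr N M)).
move=> /(_ V nV)[k _ UV].
exists (1 - (k.+1%:R)^-1), (k.+1%:R)^-1; split.
- by rewrite subr_ge0 invf_le1 ?ler1n //= ltrBlDr ltrDl invr_gt0.
- by rewrite invr_gt0.
- move=> g Gg hg; have : (V `&` aut_car G) g by split=> //; exact: UV.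
  by rewrite VG.
Qed.

Lemma Aut_ball_continuous g : Aut_ball g -> continuous (incl \o g).
Proof.
move=> [hg _] x.
have -> : incl \o g = extend incl (incl \o g) \o incl.
  by apply/funext => y; rewrite /= extend_incl.
apply: continuous_comp; first exact: ball_incl_continuous.
exact: differentiable_continuous.
Qed.

(** The sets W k are open, saturated and exhaust the ball as k grows; compactness of the quotient
    makes a single k suffice. *)
Lemma cocompact_subball : cocompact G -> exists s : R, 0 <= s < 1 /\
  forall x, exists g, aut_car G g /\ nsq (incl (g x)) <= s.
Proof.
move=> /compact_near_coveringP cS.
pose W (k : nat) : set B := [set x | exists g, aut_car G g /\ nsq (incl (g x)) < 1 - (k.+1%:R)^-1].
have oW k : open (W k).
  have -> : W k = \bigcup_(g in aut_car G) ((incl \o g) @^-1` [set v | nsq v < 1 - (k.+1%:R)^-1]).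
    by apply/seteqP; split=> x [g]; [move=> [Gg gx]; exists g|move=> Gg gx; exists g].
  apply: bigcup_open => g Gg; apply: open_comp; last exact: open_nsq_lt.
  by move=> x _; apply: Aut_ball_continuous; exact: aut_sub Gg.
pose pi (x : B) : Sigma G := \pi_{eq_quot (orbit_equiv G)} x.
(* W k is a union of orbits, so testing it on the chosen representative of a class loses nothing. *)
have Wpi k (q : Sigma G) x : pi x = q -> W k (repr q) <-> W k x.
  move=> <-; have : orbit_rel G x (repr (pi x)).
    by apply/(@eqmodP _ (orbit_equiv G)); rewrite reprK.
  move=> /asboolP[g Gg ->]; split=> [[h [Gh hx]]|[h [Gh hx]]].
    by exists (h \o g); split=> //; exact: aut_comp.
  have [g' [Gg' gg' _]] := aut_inv Gg.
  by exists (h \o g'); split; [exact: aut_comp|rewrite /= gg'].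
have h (q : Sigma G) : [set: Sigma G] q -> \forall q' \near q & k \near \oo, W k (repr q').
  move=> _; have x1 := (unit_ballE _).1 (ball_inclP (repr q)).
  have e0 : 0 < 1 - nsq (incl (repr q)) by rewrite subr_gt0.
  have [N hN] := archi_inv e0.
  exists ([set q' | W N (repr q')], [set k | (N <= k)%N]); last first.
    move=> [q' k] [/= [g [Gg gq]] Nk]; exists g; split=> //.
    apply: lt_le_trans gq _; rewrite lerD2l lerN2 lef_pV2 ?posrE ?ltr0n // ler_nat ltnS //.
  split; last exact: nbhs_infty_ge.
  apply: open_nbhs_nbhs; split; last first.
    by exists id; split; [exact: aut_id|rewrite /= ltrBrDl -ltrBrDr; exact: hN].
  rewrite /open /= /quotient_open.
  have -> // : \pi_(quotient_topology {eq_quot (orbit_equiv G)}) @^-1` [set q' | W N (repr q')] = W N.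
  by apply/seteqP; split=> x /= hx; apply/(Wpi N _ x erefl).
have [N _ hN] := cS nat \oo (fun k q => W k (repr q)) _ h.
exists (1 - (N.+1%:R)^-1); split.
  by rewrite subr_ge0 invf_le1 ?ler1n //= ltrBlDr ltrDl invr_gt0.
move=> x; have [g [Gg gx]] : W N x by apply/(Wpi N (pi x)) => //; exact: (hN N (leqnn N) (pi x)).
by exists g; split=> //; exact: ltW.
Qed.

End BallTopology.

(** * Functions on the quotient *)

Section Pullback.
Context (R : realType) (n : nat) (G : Aut_subgroup R n).
Local Notation B := (Ball R n).
Local Notation incl := (@ball_incl R n).
Context (F : Omega G -> R[i]) (F_holo : Omega_holomorphic F).

Definition pullback (z w : B) : R[i] := F (Omega_pi G (z, w)).

Lemma pullback_inv g z w : aut_car G g -> pullback (g z) (g w) = pullback z w.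
Proof.
move=> Gg; congr F; apply/esym/(@eqmodP _ (diag_equiv G)).
by apply/asboolP; exists g.
Qed.

Lemma ball2_incl_inj : injective (@ball2_incl R n).
Proof. by move=> [z w] [z' w'] [/ball_incl_inj -> /ball_incl_inj ->]. Qed.

Lemma extend_pullback z w : extend (@ball2_incl R n) (F \o Omega_pi G) (incl z, incl w) = pullback z w.
Proof. exact: (extendE _ ball2_incl_inj (z, w)). Qed.

Lemma pullback_holor z : holomorphic incl (pullback z).
Proof.
apply: (@holomorphicE _ _ _ _ (fun v => extend (@ball2_incl R n) (F \o Omega_pi G) (incl z, v))).
  by move=> w; rewrite extend_pullback.
move=> _ /ball_incl_surj[w <-].
apply: (@differentiable_comp _ _ _ _ (fun v => (incl z, v))); last exact: (F_holo (z, w)).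
apply: differentiable_pair; [exact: differentiable_cst|exact: ex_diff].
Qed.

Lemma pullback_holol w : holomorphic incl (pullback^~ w).
Proof.
apply: (@holomorphicE _ _ _ _ (fun v => extend (@ball2_incl R n) (F \o Omega_pi G) (v, incl w))).
  by move=> z; rewrite extend_pullback.
move=> _ /ball_incl_surj[z <-].
apply: (@differentiable_comp _ _ _ _ (fun v => (v, incl w))); last exact: (F_holo (z, w)).
apply: differentiable_pair; [exact: ex_diff|exact: differentiable_cst].
Qed.

Lemma unit_holoZ (c : R[i]) (h : B -> R[i]) : holomorphic incl h ->
  (forall x, normc (c * h x) <= 1) -> unit_holo (fun x => c * h x).
Proof.
move=> dh hb; split=> //.
apply: (@holomorphicE _ _ _ _ (fun v => c * extend incl h v)).
  by move=> x; rewrite extend_incl.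
move=> _ /ball_incl_surj[x <-].
apply: (@differentiableM _ _ (fun=> c) (extend incl h)); last exact: dh.
exact: differentiable_cst.
Qed.

Context (G_discrete : discrete_subgroup G) (G_cocompact : cocompact G).

(** The factor c both scales the bound to 1 and may rotate, so one statement serves for real and
    imaginary parts. Cocompactness supplies the set meeting all orbits, discreteness the finiteness
    of returns. *)
Lemma pullback_Re_cst (c : R[i]) : (forall z w, normc (c * pullback z w) <= 1) ->
  forall z w z' w', complex.Re (c * pullback z w) = complex.Re (c * pullback z' w').
Proof.
move=> fb.
have hl w : unit_holo (fun z => c * pullback z w).
  by apply: unit_holoZ => // ; exact: pullback_holol.
have hr z : unit_holo (fun w => c * pullback z w).
  by apply: unit_holoZ => //; exact: pullback_holor.
have r0 := ball_r0_gt0 R n; have tb := @cdist_ball_tb R n.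
have dP := @cdist_pm R n; have hom := @isometry_homogeneous R n.
have [p _] := origin_exists R n.
have [L LP] := haar_exists dP r0 tb hom p.
pose r := ball_r0 R n / 2; have r_gt0 : 0 < r by rewrite divr_gt0.
have r_le : r + r <= ball_r0 R n by rewrite -splitr.
have ch (x y : B) : exists m, chain (@cdist R n) r m x y by exact: cdist_chain.
have G_iso g : aut_car G g -> isometry (@cdist R n) g.
  by move=> Gg; apply: aut_isometry; exact: aut_sub Gg.
have G_comp := @aut_comp _ _ G; have G_inv := @aut_inv _ _ G.
have [s [s01 scov]] := cocompact_subball G_cocompact.
have [s' [eta [s'01 eta0 G_id]]] := discrete_near_id G_discrete.
have G_fin := locally_finite dP tb r_gt0 r_le ch G_iso G_comp G_inv (totbounded_ball n s'01) eta0 G_id.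
apply: (biharmonic_cst dP r0 tb hom LP r_gt0 r_le G_iso G_comp G_inv G_fin (totbounded_ball n s01)
   scov ch (u := fun z w => complex.Re (c * pullback z w))).
- exists 1; split=> [z w|z w z' w']; first exact: unit_holo_Re (hl w).
  have := cdist_ge z z' (hl w); have := cdist_ge w w' (hr z'); rewrite mul1r.
  set a := complex.Re _; set b := complex.Re _; set e := complex.Re _ => h1 h2.
  have -> : e - b = (e - a) + (a - b) by ring.
  by apply: le_trans (ler_normD _ _) _; exact: lerD.
- by move=> g z w Gg; rewrite pullback_inv.
- by move=> z w; apply: (mean_property LP r_gt0 r_le z (hl w)).
- by move=> z w; apply: (mean_property LP r_gt0 r_le w (hr z)).
Qed.

End Pullback.

(** * From real parts to the function itself *)

Theorem theorem4p22 (R : realType) (n : nat) (hn : (1 <= n)%N)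
    (Gamma : Aut_subgroup R n)
    (Gamma_torsion_free : torsion_free Gamma)
    (Gamma_discrete : discrete_subgroup Gamma)
    (Gamma_cocompact : cocompact Gamma)
    (H0_eq0 : forall m : nat, (0 < m <= n.+1)%N ->
       sym_differentials Gamma m = [set cst 0])
    (F : Omega Gamma -> R[i])
    (F_holomorphic : Omega_holomorphic F)
    (F_bounded : Omega_bounded F) :
  exists c : R[i], forall x : Omega Gamma, F x = c.
Proof.
have [p _] := origin_exists R n; have [M FM] := F_bounded.
have fb z w : normc (pullback F z w) <= M by rewrite -lecR -complex_normE; exact: FM.
have M0 : 0 <= M by apply: le_trans (fb p p); exact: normc_ge0.
have M1 : 0 < M + 1 by rewrite ltr_wpDl.
(* The values e = 1 and e = 'i recover the two components of F; dividing by M + 1 rather than M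
   covers M = 0. *)
have cst (e : R[i]) : normc e = 1 -> forall z w z' w',
    complex.Re (e * pullback F z w) = complex.Re (e * pullback F z' w').
  move=> e1 z w z' w'; have c0 : (M + 1)^-1 != 0 by rewrite invr_neq0 // gt_eqF.
  apply: (mulfI c0).
  have E (u : R[i]) : (M + 1)^-1 * complex.Re (e * u) = complex.Re ((M + 1)^-1%:C * e * u).
    by rewrite -mulrA; case: (e * u) => a b /=; rewrite mul0r subr0.
  rewrite !E; apply: (pullback_Re_cst F_holomorphic Gamma_discrete Gamma_cocompact) => x y.
  rewrite !ComplexField.Normc.normcM normc_real e1 mulr1 gtr0_norm ?invr_gt0 //.
  by rewrite mulrC ler_pdivrMr // mul1r; apply: le_trans (fb x y) _; rewrite lerDl.
exists (pullback F p p) => x.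
have -> : F x = pullback F (repr x).1 (repr x).2.
  by rewrite /pullback -surjective_pairing /Omega_pi reprK.
have h1 := cst 1 (ComplexField.Normc.normc1 R) (repr x).1 (repr x).2 p p.
have h2 := cst 'i (normc_i R) (repr x).1 (repr x).2 p p.
move: h1 h2; rewrite !mul1r.
case: (pullback _ _ _) => a b; case: (pullback _ _ _) => a' b' /= ->.
by rewrite !mul0r !mul1r !sub0r => /oppr_inj ->.
Qed.
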